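(* Let $(X,\mathsf d,\mathfrak m)$ be a metric measure space such that $\mathrm S^2(X)$ is separable (w.r.t. the seminorm $\|f\|_{\mathrm S^2}:=\||Df|\|_{L^2(X,\mathfrak m)}$) and $\mathfrak m$ gives finite mass to bounded sets. Let $(\mu_t)_{t\in[0,1]}\subset\mathscr P_2(X)$ be a 2-a.c. curve w.r.t. $W_2$ with bounded compression, let $\{L_t\}$ be the linear operators on $\mathrm S^2(X)$ associated to it (see context), and let $\nu\in\mathscr P_2(X)$ have bounded support. Then $t\mapsto\frac12W_2^2(\mu_t,\nu)$ is absolutely continuous and for a.e. $t\in[0,1]$ the formula $$\frac{d}{dt}\frac12W_2^2(\mu_t,\nu)=L_t(\varphi_t)$$ holds, where $\varphi_t$ is any Kantorovich potential from $\mu_t$ to $\nu$ for which there is a bounded set $B\subset X$ with $\partial^c\varphi_t(x)\cap B\ne\emptyset$ for every $x\in X$.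
   Context: Metric measure space: $(X,\mathsf d)$ is a complete separable metric space and $\mathfrak m$ is a non-negative, non-zero Radon measure on $X$. $\mathscr P(X)$ is the set of Borel probability measures on $X$; $\mathscr P_2(X)$ is the set of those with finite second moment, equipped with the quadratic transportation distance $W_2$, $W_2^2(\mu,\nu)=\inf\int \mathsf d^2(x,y)\,d\gamma(x,y)$ over couplings $\gamma$ of $\mu,\nu$. A curve $\gamma:[0,1]\to Y$ in a metric space $(Y,\mathsf d_Y)$ is absolutely continuous (resp. 2-absolutely continuous, 2-a.c.) if there is $g\in L^1(0,1)$ (resp. $g\in L^2(0,1)$) with $\mathsf d_Y(\gamma_s,\gamma_t)\le\int_t^s g(r)\,dr$ for all $t<s$ in $[0,1]$. For such a curve the metric speed $|\dot\gamma_t|:=\lim_{h\to0}\mathsf d_Y(\gamma_{t+h},\gamma_t)/|h|$ exists for a.e. $t$. For a continuous curve that is not absolutely continuous, $\int_0^1|\dot\gamma_t|^2dt:=+\infty$. A curve $(\mu_t)_{t\in[0,1]}\subset\mathscr P(X)$ has bounded compression if there is $C>0$ with $\mu_t\le C\mathfrak m$ for every $t\in[0,1]$. Let $\mathrm e_t:C([0,1],X)\to X$, $\mathrm e_t(\gamma)=\gamma_t$. A test plan is $\pi\in\mathscr P(C([0,1],X))$ such that $t\mapsto(\mathrm e_t)_\sharp\pi$ has bounded compression and $\iint_0^1|\dot\gamma_t|^2\,dt\,d\pi(\gamma)<\infty$. The Sobolev class $\mathrm S^2(X)$ is the space of Borel $f:X\to\mathbb R$ for which there is $G\in L^2(X,\mathfrak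 m)$, $G\ge0$, with $\int|f(\gamma_1)-f(\gamma_0)|\,d\pi(\gamma)\le\iint_0^1G(\gamma_t)|\dot\gamma_t|\,dt\,d\pi(\gamma)$ for every test plan $\pi$; the minimal (in the $\mathfrak m$-a.e. sense) such $G$ exists and is denoted $|Df|$. For $\mu\in\mathscr P_2(X)$ with $\mu\le C\mathfrak m$ for some $C>0$, put $\|f\|_\mu^2:=\int|Df|^2\,d\mu$ for $f\in\mathrm S^2(X)$, and for linear $L:\mathrm S^2(X)\to\mathbb R$ define $\|L\|_\mu^*$ by $\frac12(\|L\|_\mu^* )^2:=\sup_{f\in\mathrm S^2(X)}\big(L(f)-\frac12\|f\|_\mu^2\big)$. The cotangent space $\mathrm{CoTan}_\mu(X)$ is the completion of the quotient of $\mathrm S^2(X)$ by $f\sim_\mu g\Leftrightarrow\|f-g\|_\mu=0$, w.r.t. the norm induced by $\|\cdot\|_\mu$. A linear $L$ with $\|L\|^*_\mu<\infty$ extends uniquely to a continuous linear functional on $\mathrm{CoTan}_\mu(X)$, still denoted $L$. Operators associated to the curve: since $\mathrm S^2(X)$ is separable, there exist an $\mathcal L^1$-negligible set $\mathcal N\subset[0,1]$ and linear maps $L_t:\mathrm S^2(X)\to\mathbb R$, $t\in[0,1]\setminus\mathcal N$, such that every $t\in[0,1]\setminus\mathcal N$ is a Lebesgue point of $s\mapsto|\dot\mu_s|^2$, the metric speed exists at $t$ and $|\dot\mu_t|=\|L_t\|^*_{\mu_t}$; and for every $f\in L^1(X,\mathfrak m)\cap\mathrm S^2(X)$ the map $t\mapsto\int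 f\,d\mu_t$ is absolutely continuous and differentiable at every $t\in[0,1]\setminus\mathcal N$, with derivative $L_t(f)$. These are the $L_t$ in the claim. The $c$-transform of $\varphi:X\to\mathbb R\cup\{-\infty\}$ (not identically $-\infty$) is $\varphi^c(y):=\inf_{x\in X}\frac{\mathsf d^2(x,y)}2-\varphi(x)$; $\varphi$ is $c$-concave if it is not identically $-\infty$ and $\varphi=\psi^c$ for some $\psi$. The $c$-superdifferential $\partial^c\varphi(x)$ is the set of $y\in X$ with $\varphi(x)+\varphi^c(y)=\frac{\mathsf d^2(x,y)}2$. A Kantorovich potential from $\mu$ to $\nu$ is a $c$-concave $\varphi$ with $\int\varphi\,d\mu+\int\varphi^c\,d\nu=\frac12W_2^2(\mu,\nu)$. Meaning of $L_t(\varphi_t)$: for $\varphi_t$ as in the claim, the truncations $\min\{n,\varphi_t\}$ belong to $\mathrm S^2(X)$ and are Cauchy w.r.t. $\|\cdot\|_{\mu_t}$, hence define as $n\to\infty$ an element of $\mathrm{CoTan}_{\mu_t}(X)$, still denoted $\varphi_t$, on which the extended functional $L_t$ is evaluated; i.e. $L_t(\varphi_t)=\lim_nL_t(\min\{n,\varphi_t\})$. *)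

(* Defs.v *)
From HB Require Import structures.
From mathcomp Require Import all_boot all_order all_algebra.
From mathcomp Require Import all_classical all_reals all_analysis.

Set Implicit Arguments.
Unset Strict Implicit.
Unset Printing Implicit Defensive.

Import Order.TTheory GRing.Theory Num.Theory.
Import numFieldNormedType.Exports.

Local Open Scope classical_set_scope.
Local Open Scope ring_scope.

(* Complete metric spaces. The library's complete spaces (and its measurable
   spaces) carry a base point; no generality is lost, since a space with a
   non-zero measure is not empty. *)
#[short(type="completeMetricType")]
HB.structure Definition CompleteMetric (R : realType) :=
  { T of Metric R T & Complete T }.

Notation borel T := (g_sigma_algebraType (@open T)).

Definition separable_space (T : topologicalType) :=
  exists2 D : set T, countable D & dense D.

Definition metric_bounded (R : realType) (X : metricType R) (B : set X) :=
  exists x r, B `<=` ball x r.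

(* A curve on [0, 1] is represented by a function on R whose values outside
   [0, 1] are irrelevant; the limits below are only used at interior points. *)

Section Curves.
Context (R : realType) (Y : Type) (d : Y -> Y -> R).
Local Notation leb := (@lebesgue_measure R).

(* p-absolute continuity on [0, 1]: p = 1 is plain absolute continuity. *)
Definition abs_cont (p : nat) (c : R -> Y) :=
  exists g : R -> R,
    [/\ measurable_fun (`[0, 1]%classic : set R) g,
        (\int[leb]_(r in `[0%R, 1%R]) (`|g r| ^+ p)%:E < +oo)%E &
        forall t s : R, 0 <= t -> t < s -> s <= 1 ->
          d (c s) (c t) <= \int[leb]_(r in `[t, s]) g r].

Definition difference_quotient (c : R -> Y) (t h : R) : R :=
  d (c (t + h)) (c t) / `|h|.

Definition has_metric_speed (c : R -> Y) (t : R) :=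
  cvg (difference_quotient c t h @[h --> 0^']).

Definition metric_speed (c : R -> Y) (t : R) : R :=
  lim (difference_quotient c t h @[h --> 0^']).

End Curves.

Definition rdist (R : realType) (x y : R) : R := `|x - y|.

Definition unit_interval (R : realType) : set R := `[0, 1].
Arguments unit_interval R : clear implicits.

Lemma unit_interval0 (R : realType) : 0 \in unit_interval R.
Proof. by rewrite inE /unit_interval/= in_itv/= lexx ler01. Qed.

Definition unit0 (R : realType) : unit_interval R :=
  exist _ 0 (unit_interval0 R).

Definition curve (R : realType) (X : completeMetricType R) :=
  continuousType (unit_interval R) X.

Section CurveInstances.
Context (R : realType) (X : completeMetricType R).
HB.instance Definition _ := gen_eqMixin (curve X).
HB.instance Definition _ := gen_choiceMixin (curve X).
HB.instance Definition _ :=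
  isPointed.Build (curve X) (cst point : continuousType _ X).
HB.instance Definition _ := Topological.copy (curve X)
  (initial_topology
    ((fun c => c : unit_interval R -> X) :
       curve X -> {uniform unit_interval R -> X})).
End CurveInstances.

(* For t outside [0, 1] this is the (irrelevant) value at 0. *)
Definition eval_at (R : realType) (X : completeMetricType R) (t : R)
  (c : curve X) : X := (c : continuousType _ X) (insubd (unit0 R) t).

Section MetricMeasureSpace.
Context (R : realType) (X : completeMetricType R).
Local Notation leb := (@lebesgue_measure R).

Definition radon (m : set (borel X) -> \bar R) :=
  (forall x : X, exists2 U : set X, open_nbhs x U & (m U < +oo)%E) /\
  (forall A : set (borel X), measurable A ->
     m A = ereal_sup [set m K | K in [set K : set X | compact K /\ K `<=` A]]).

Definition finite_second_moment (mu : probability (borel X) R) :=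
  exists x0 : X, (\int[mu]_x (mdist (x : X) x0 ^+ 2)%:E < +oo)%E.

Definition coupling (mu nu : probability (borel X) R)
    (g : probability (borel X * borel X)%type R) :=
  forall A : set (borel X), measurable A ->
    pushforward g fst A = mu A /\ pushforward g snd A = nu A.

Definition W2sq (mu nu : probability (borel X) R) : \bar R :=
  ereal_inf [set (\int[g]_z (mdist (z.1 : X) (z.2 : X) ^+ 2)%:E)%E
            | g in coupling mu nu].

Definition W2 (mu nu : probability (borel X) R) : R :=
  Num.sqrt (fine (W2sq mu nu)).

Definition msupport (mu : probability (borel X) R) : set X :=
  [set x | forall U : set X, open_nbhs x U -> (0 < mu U)%E].

Variable m : {measure set (borel X) -> \bar R}.

Definition bounded_compression (mu : R -> set (borel X) -> \bar R) :=
  exists2 C : R, 0 < C & forall t, 0 <= t <= 1 ->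
    forall A : set (borel X), measurable A -> (mu t A <= C%:E * m A)%E.

Definition curve_speed (c : curve X) (t : R) : R :=
  metric_speed (@mdist R X) (fun s => eval_at s c) t.

Definition energy (c : curve X) : \bar R :=
  if `[< abs_cont (@mdist R X) 1 (fun s => eval_at s c) >]
  then (\int[leb]_(t in `[0%R, 1%R]) (curve_speed c t ^+ 2)%:E)%E
  else +oo%E.

Definition test_plan (pi : probability (borel (curve X)) R) :=
  bounded_compression
    (fun t => pushforward pi (eval_at t : borel (curve X) -> borel X)) /\
  (\int[pi]_c energy c < +oo)%E.

Definition weak_upper_gradient (f G : X -> R) :=
  [/\ (G : borel X -> R) \in Lfun m 2%:E, forall x, 0 <= G x &
      forall pi, test_plan pi ->
        (\int[pi]_c `|f (eval_at 1%R c) - f (eval_at 0%R c)|%:E <=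
         \int[pi]_c \int[leb]_(t in `[0%R, 1%R])
           (G (eval_at t c) * curve_speed c t)%:E)%E].

Definition S2 : set (X -> R) :=
  [set f | measurable_fun setT (f : borel X -> R) /\
           exists G, weak_upper_gradient f G].

Definition minimal_weak_upper_gradient (f : X -> R) : set (X -> R) :=
  [set G | weak_upper_gradient f G /\
           forall G', weak_upper_gradient f G' ->
             {ae m, forall x : borel X, G x <= G' x}].

(* |Df|, which is determined up to m-null sets. *)
Definition min_grad (f : X -> R) : X -> R :=
  xget (cst 0) (minimal_weak_upper_gradient f).

Definition S2_separable :=
  exists D : set (X -> R), [/\ countable D, D `<=` S2 &
    forall f, S2 f -> forall e : R, 0 < e ->
      exists2 g, D g & ('N[m]_2%:E[EFin \o min_grad (f \- g)%R] < e%:E)%E].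

(* ||f||_mu ^ 2 *)
Definition sqnorm (mu : probability (borel X) R) (f : X -> R) : \bar R :=
  (\int[mu]_x (min_grad f x ^+ 2)%:E)%E.

(* Functionals on S2 are functions of all f : X -> R whose values outside S2
   are irrelevant. *)
Definition S2_linear (L : (X -> R) -> R) :=
  forall (a : R) f g, S2 f -> S2 g -> L (a \*o f \+ g) = a * L f + L g.

(* The solution l >= 0 of l ^ 2 / 2 = sup_f (L f - ||f||_mu ^ 2 / 2). *)
Definition dual_norm (mu : probability (borel X) R) (L : (X -> R) -> R)
    : \bar R :=
  sqrte (2%:E * ereal_sup
    [set ((L f)%:E - (2^-1)%:E * sqnorm mu f)%E | f in S2])%E.

Definition cauchy_S2 (mu : probability (borel X) R) : set (nat -> X -> R) :=
  [set u | (forall n, S2 (u n)) /\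
           forall e : R, 0 < e -> exists n0 : nat, forall i j : nat,
             (n0 <= i)%N -> (n0 <= j)%N -> (sqnorm mu (u i \- u j)%R < e%:E)%E].

(* CoTan_mu(X), the completion of S2 / ~_mu, is realized as the set of classes
   of ||.||_mu-Cauchy sequences in S2, modulo sequences that converge to 0:
   its elements are the cotan_class mu u with cauchy_S2 mu u. *)
Definition cotan_class (mu : probability (borel X) R) (u : nat -> X -> R)
    : set (nat -> X -> R) :=
  [set v | cauchy_S2 mu v /\
           sqnorm mu (u n \- v n) @[n --> \oo] --> 0%E].

(* The continuous extension of L to CoTan_mu(X). *)
Definition cotan_ext (L : (X -> R) -> R) (w : set (nat -> X -> R)) : R :=
  get [set l : R | exists2 u, w u & L (u n) @[n --> \oo] --> l].

(* At the end points the derivatives would have to be one-sided; as N is only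
   determined up to null sets, nothing is required there. *)
Definition associated_operators (mu : R -> probability (borel X) R)
    (N : set R) (L : R -> (X -> R) -> R) :=
  [/\ leb.-negligible N,
      forall t, 0 < t < 1 -> ~ N t ->
        [/\ S2_linear (L t),
            lebesgue_pt (fun s => metric_speed W2 mu s ^+ 2) t,
            has_metric_speed W2 mu t &
            (metric_speed W2 mu t)%:E = dual_norm (mu t) (L t)] &
      forall f, S2 f -> m.-integrable setT (EFin \o f : borel X -> \bar R) ->
        abs_cont (@rdist R) 1 (fun t => \int[mu t]_x f x) /\
        forall t, 0 < t < 1 -> ~ N t ->
          is_derive t 1 (fun s => \int[mu s]_x f x : R) (L t f)].

Definition half_sqdist (x y : X) : \bar R := (mdist x y ^+ 2 / 2)%:E.

(* The function phi : X -> R \cup {-oo} is not identically -oo. *)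
Definition proper_potential (phi : X -> \bar R) :=
  (forall x, phi x != +oo%E) /\ exists x, phi x != -oo%E.

Definition c_transform (phi : X -> \bar R) (y : X) : \bar R :=
  ereal_inf [set (half_sqdist x y - phi x)%E | x in [set: X]].

Definition c_concave (phi : X -> \bar R) :=
  proper_potential phi /\
  exists2 psi, proper_potential psi & phi = c_transform psi.

Definition c_superdifferential (phi : X -> \bar R) (x : X) : set X :=
  [set y | (phi x + c_transform phi y)%E = half_sqdist x y].

Definition kantorovich_potential (mu nu : probability (borel X) R)
    (phi : X -> \bar R) :=
  c_concave phi /\
  (\int[mu]_x phi x + \int[nu]_y c_transform phi y =
   (2^-1)%:E * W2sq mu nu)%E.

(* min {n, phi}, for phi finite everywhere *)
Definition truncation (phi : X -> \bar R) (n : nat) (x : X) : R :=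
  Num.min n%:R (fine (phi x)).

(* phi as an element of CoTan_mu(X), when its truncations are Cauchy in S2 *)
Definition cotan_of (mu : probability (borel X) R) (phi : X -> \bar R) :=
  cotan_class mu (truncation phi).

End MetricMeasureSpace.

(* Main.v *)
From HB Require Import structures.
Require Import Defs.
From mathcomp Require Import all_boot all_order all_algebra.
From mathcomp Require Import all_classical all_reals all_analysis.
From mathcomp Require Import measurable_realfun.
From mathcomp Require Import ring lra.

Set Implicit Arguments.
Unset Strict Implicit.
Unset Printing Implicit Defensive.

Import Order.TTheory GRing.Theory Num.Theory.
Import numFieldNormedType.Exports.
Local Open Scope classical_set_scope.
Local Open Scope ring_scope.

(** Write F(s) = W2(mu_s, nu)^2 / 2. The squared distance to [nu] is Lipschitz on
    W2-bounded sets, so F is absolutely continuous and therefore differentiable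
    almost everywhere ([W2_abs_cont], [dominated_increments_ftc]).

    Let t be an interior point where F is differentiable and where the operator
    L_t is defined, and let phi be a potential as in the theorem. The pair
    (phi, phi^c) is admissible in the dual problem between any mu_s and [nu], so
      F(s) >= \int phi dmu_s + \int phi^c dnu,
    with equality at s = t ([potential_dual_bound]). Two differentiable functions
    that touch in this way have the same derivative ([is_derive_touching]), hence
    all that remains is to show that s |-> \int phi dmu_s has derivative
    L_t(phi) at t.

    As the superdifferential of phi meets a fixed ball at every point, phi is
    touched from above everywhere by parabolas centred in that ball
    ([bounded_superdifferential]). Hence phi is finite, its local slope grows at
    most linearly and phi itself grows quadratically. The truncation min(n, phi)
    is thus locally Lipschitz and constant off a bounded set, so it lies in the
    Sobolev class and minus n it is m-integrable; by the defining property of L_t,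
    the integral of min(n, phi) has derivative L_t(min(n, phi)) at t.

    The passage to the limit needs that the excess phi - min(n, phi) contributes
    little to the difference quotients. Its slope is supported where the distance
    d to the base point is large, and is of the order of (d - K)^+ for a radius K
    that grows with n, which is small in L^2(mu_t). For a nearly optimal coupling of mu_s and mu_t the integrals of the
    excess therefore differ by at most a small multiple of |s - t|, since
    W2(mu_s, mu_t) is at most a constant times |s - t| by the existence of the
    metric speed ([W2_integral_diff], [potential_integral_derive]). So the numbers
    L_t(min(n, phi)) converge and their limit is the derivative; since L_t is
    continuous for the seminorm of the cotangent space, this limit is the value of
    the extended functional ([cotan_ext_cvg]).

    Two general facts take most of the work. The first is that a function which is
    Lipschitz on bounded sets, with local slope at most G, has weak upper gradient G
    ([slope_weak_upper_gradient]); it requires metric speeds, the fundamental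
    theorem of calculus for absolutely continuous functions, and that a test plan
    is concentrated on a Borel set of absolutely continuous curves. The second is
    the triangle inequality for W2, which is obtained from a gluing of couplings
    along a fine partition of the space ([approximate_gluing]), so that no
    disintegration of measures is involved. *)

(** * Integrals of functions that may fail to be measurable *)

(** The energy of a curve and the integral of a gradient along a curve are
    integrated over test plans before anything is known about their
    measurability. What is needed of such integrals are inequalities that hold
    for the supremum over the simple functions below the integrand. *)
Section LowerIntegral.
Local Open Scope ereal_scope.
Context d (T : measurableType d) (R : realType).
Variable m : {measure set T -> \bar R}.
Import HBNNSimple.

Lemma ge0_le_lower_integral (D : set T) (f g : T -> \bar R) :
  (forall x, D x -> 0 <= f x) -> (forall x, D x -> f x <= g x) ->
  \int[m]_(x in D) f x <= \int[m]_(x in D) g x.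
Proof.
move=> f0 fg; rewrite !ge0_integralE//; last first.
  by move=> x Dx; rewrite (le_trans (f0 _ Dx))// fg.
apply: ge_ereal_sup => _ [h/= hf <-].
apply: ereal_sup_ubound; exists h => //= x.
apply: le_trans (hf x) _; rewrite /patch; case: ifPn => //.
by rewrite inE => /fg.
Qed.

(** The simple functions below [f] whose integrals approach the supremum that
    defines the integral of [f] have a measurable supremum; through it, the
    theory of measurable integrands applies to arbitrary ones. *)
Lemma measurable_minorant (D : set T) (f : T -> \bar R) :
  measurable D -> (forall x, D x -> 0 <= f x) ->
  exists g : T -> \bar R,
    [/\ measurable_fun D g, forall x, D x -> 0 <= g x,
        forall x, D x -> g x <= f x &
        \int[m]_(x in D) g x = \int[m]_(x in D) f x].
Proof.
move=> mD f0.
set S := [set sintegral m h |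
  h in [set h : {nnsfun T >-> R} | forall x, (h x)%:E <= (f \_ D) x]].
have ES : \int[m]_(x in D) f x = ereal_sup S by rewrite ge0_integralE.
have /set0P S0 : S !=set0.
  exists (sintegral m (@nnsfun0 _ T R)); exists (@nnsfun0 _ T R) => //= x.
  exact: erestrict_ge0.
have [u uS ucvg] := ereal_sup_seq S0.
have /choice[h hP] : forall n, exists h : {nnsfun T >-> R},
    (forall x, (h x)%:E <= (f \_ D) x) /\ sintegral m h = u n.
  by move=> n; have := uS n => -[h ? <-]; exists h.
pose g x := ereal_sup (range (fun n => (h n x)%:E)).
have hg n x : (h n x)%:E <= g x by apply: ereal_sup_ubound; exists n.
have gf x : g x <= (f \_ D) x.
  by apply: ge_ereal_sup => _ [n _ <-]; exact: (hP n).1.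
have g0 x : 0 <= g x by rewrite (le_trans _ (hg 0%N x))// lee_fin.
exists g; split => //.
- apply: measurable_funTS.
  rewrite (_ : g = (fun x => esups (fun n => (h n x)%:E) 0%N)); last first.
    apply/funext => x; rewrite /g /esups/= /sdrop.
    by congr ereal_sup; apply/seteqP; split => [_ [n _ <-]|_ [n _ <-]]; exists n.
  by apply: measurable_fun_esups => n; apply/measurable_EFinP.
- move=> x Dx; rewrite (le_trans (gf x))// /patch mem_set//.
- apply/eqP; rewrite eq_le; apply/andP; split.
    apply: ge0_le_lower_integral => // x Dx.
    by rewrite (le_trans (gf x))// /patch mem_set.
  rewrite ES -(cvg_lim _ ucvg)//; apply: lime_le.
    by apply/cvg_ex; eexists; exact: ucvg.
  apply: nearW => n; rewrite -(hP n).2 -integralT_nnsfun.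
  rewrite [leRHS]integral_mkcond.
  apply: ge0_le_lower_integral => x _; first by rewrite lee_fin.
  rewrite /patch; case: ifPn => // /negP xD.
  by have := (hP n).1 x; rewrite /patch; case: ifPn.
Qed.

(** Without measurability, the integral is superadditive only. *)
Lemma lower_integralD (D : set T) (f g : T -> \bar R) : measurable D ->
  (forall x, D x -> 0 <= f x) -> (forall x, D x -> 0 <= g x) ->
  \int[m]_(x in D) f x + \int[m]_(x in D) g x <= \int[m]_(x in D) (f x + g x).
Proof.
move=> mD f0 g0.
have [f' [mf' f'0 f'f <-]] := measurable_minorant mD f0.
have [g' [mg' g'0 g'g <-]] := measurable_minorant mD g0.
rewrite -ge0_integralD//; apply: ge0_le_lower_integral => x Dx.
  by rewrite adde_ge0 ?f'0 ?g'0.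
by rewrite leeD ?f'f ?g'g.
Qed.

Lemma lower_integralZl (D : set T) (f : T -> \bar R) (k : R) : measurable D ->
  (0 <= k)%R -> (forall x, D x -> 0 <= f x) ->
  k%:E * \int[m]_(x in D) f x <= \int[m]_(x in D) (k%:E * f x).
Proof.
move=> mD k0 f0.
have [f' [mf' f'0 f'f <-]] := measurable_minorant mD f0.
rewrite -ge0_integralZl_EFin//; apply: ge0_le_lower_integral => x Dx.
  by rewrite mule_ge0 ?f'0.
by rewrite lee_wpmul2l ?lee_fin ?f'f.
Qed.

(** Almost everywhere monotonicity survives when only the smaller integrand is
    measurable. *)
Lemma ae_le_lower_integral (D : set T) (f g : T -> \bar R) : measurable D ->
  measurable_fun D f -> (forall x, D x -> 0 <= f x) ->
  (forall x, D x -> 0 <= g x) ->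
  {ae m, forall x, D x -> f x <= g x} ->
  \int[m]_(x in D) f x <= \int[m]_(x in D) g x.
Proof.
move=> mD mf f0 g0 [N [mN muN fgN]].
rewrite (ge0_negligible_integral mN)//.
rewrite integral_mkcond [leRHS]integral_mkcond.
apply: ge0_le_lower_integral => x _.
  by apply: erestrict_ge0 => // t [Dt _]; exact: f0.
rewrite /patch; case: ifPn => [/set_mem[Dx Nx]|_].
  by rewrite mem_set//; move/subsetCl : fgN => /(_ x Nx); exact.
by case: ifPn => // /set_mem/g0.
Qed.

End LowerIntegral.

(** * Absolutely continuous functions *)

Section StieltjesAbsolutelyContinuous.
Context (R : realType).
Local Notation leb := (@lebesgue_measure R).

Lemma lebesgue_stieltjes_ocitv (f : cumulative R R) (a b : R) : a <= b ->
  lebesgue_stieltjes_measure f `]a, b]%classic = (f b - f a)%:E.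
Proof.
move=> ab; rewrite /lebesgue_stieltjes_measure/=.
rewrite /measure_extension/= measurable_mu_extE/=; last exact: is_ocitv.
by rewrite wlength_itv_bnd.
Qed.

(** Used to compare Stieltjes measures: the one of [f] dominates the one of [g]
    as soon as [f - g] is again nondecreasing. *)
Lemma lebesgue_stieltjesD (f g h : cumulative R R) (A : set R) :
  (forall x, f x = g x + h x) -> measurable A ->
  lebesgue_stieltjes_measure f A =
  (lebesgue_stieltjes_measure g A + lebesgue_stieltjes_measure h A)%E.
Proof.
move=> fgh mA; rewrite -measure_addE.
apply: lebesgue_stieltjes_measure_unique => // X /ocitvP[->|[[a b]/= /ltW ab ->]].
  by rewrite !measure0.
rewrite [RHS]/msum !big_ord_recl big_ord0 adde0.
rewrite /= !lebesgue_stieltjes_ocitv// -EFinD !fgh.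
by congr EFin; ring.
Qed.

Lemma cumulative_mk (f : R -> R) : {homo f : x y / x <= y} ->
  (forall x, f%function @ at_right x --> f%function x) ->
  exists F : cumulative R R, F = f :> (R -> R).
Proof.
move=> ndf rcf.
pose T := isCumulative.Build R _ R f ndf rcf.
pose F : cumulative R R := HB.pack f T.
by exists F.
Qed.

Lemma lebesgue_stieltjesZ (k : R) (f g : cumulative R R) (A : set R) :
  0 <= k -> (forall x, f x = k * g x) -> measurable A ->
  lebesgue_stieltjes_measure f A = (k%:E * lebesgue_stieltjes_measure g A)%E.
Proof.
move=> k0 fg mA.
apply: (@lebesgue_stieltjes_measure_unique _ f
  (mscale (NngNum k0) (lebesgue_stieltjes_measure g))) => //.
move=> X /ocitvP[->|[[a b]/= /ltW ab ->]]; first by rewrite !measure0.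
rewrite /mscale/= !lebesgue_stieltjes_ocitv// -EFinM !fg.
by congr EFin; ring.
Qed.

(** The increments of [V] are uniformly integrable in the sense that they
    exceed a large multiple of the length by an arbitrarily small total amount.
    Hence the Stieltjes measure of [V] does not charge Lebesgue-null sets, and
    the Radon-Nikodym theorem provides its density. *)
Lemma uniformly_integrable_increments_density (V : R -> R) :
  {homo V : x y / x <= y} -> right_continuous V ->
  (forall e : R, 0 < e -> exists (l : R) (E : R -> R), [/\ 0 <= l, {homo E : x y / x <= y},
     right_continuous E, E 1 - E 0 <= e &
     forall a b, a <= b -> V b - V a <= l * (b - a) + (E b - E a)]) ->
  exists v : R -> R, [/\ forall x, 0 <= v x,
    leb.-integrable setT (EFin \o v) &
    forall a b, 0 <= a -> a <= b -> b <= 1 ->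
      V b - V a = \int[leb]_(r in `[a, b]) v r].
Proof.
move=> ndV rcV Vui; have [F FV] := cumulative_mk ndV rcV.
have mD : measurable (`]0, 1]%classic : set (measurableTypeR R)) by exact: measurable_itv.
have muD : (lebesgue_stieltjes_measure F `]0%R, 1%R]%classic < +oo)%E.
  by rewrite lebesgue_stieltjes_ocitv ?ltry.
pose nu : {finite_measure set (measurableTypeR R) -> \bar R} := mfrestr mD muD.
have nu_leb : nu `<< leb.
  apply/null_content_dominatesP => A mA A0.
  apply/eqP; rewrite eq_le measure_ge0 andbT.
  apply/lee_addgt0Pr => e e0; rewrite add0e.
  have [l [E [l0 ndE rcE Ee VE]]] := Vui e e0.
  have [FE FEE] := cumulative_mk ndE rcE.
  (* The functions l * x + E x - V x and V are both nondecreasing, so that the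
     measure of V is at most l times the Lebesgue measure plus that of E. *)
  pose lid := fun x : R => l * x.
  have ndl : {homo lid : x y / x <= y} by move=> x y xy; exact: ler_wpM2l.
  have rcl : right_continuous lid.
    by apply: right_continuousW => x; apply: cvgMr; exact: cvg_id.
  have [Fl Fll] := cumulative_mk ndl rcl.
  pose S := fun x : R => l * x + E x.
  have ndS : {homo S : x y / x <= y}.
    by move=> x y xy; apply: lerD; [exact: ndl|exact: ndE].
  have rcS : right_continuous S by move=> x; apply: cvgD; [exact: rcl|exact: rcE].
  have [FS FSS] := cumulative_mk ndS rcS.
  pose W := fun x : R => l * x + E x - V x.
  have ndW : {homo W : x y / x <= y}.
    move=> x y xy; rewrite /W; have := VE _ _ xy; rewrite mulrBr; lra.
  have rcW : right_continuous W by move=> x; apply: cvgB; [exact: rcS|exact: rcV].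
  have [FW FWW] := cumulative_mk ndW rcW.
  have mAD : measurable (A `&` `]0, 1]%classic) by exact: measurableI.
  rewrite /nu/= /mfrestr /mrestr/=.
  apply: (@le_trans _ _ (lebesgue_stieltjes_measure FS (A `&` `]0, 1]%classic))).
    rewrite (@lebesgue_stieltjesD FS F FW)//; last first.
      by move=> x; rewrite FSS FV FWW /S /W; ring.
    by rewrite leeDl.
  rewrite (@lebesgue_stieltjesD FS Fl FE)//; last first.
    by move=> x; rewrite FSS Fll FEE.
  rewrite (@lebesgue_stieltjesZ l Fl idfun)//; last by move=> x; rewrite Fll.
  rewrite [X in (_ * X)%E](_ : _ = 0%E); last first.
    apply/eqP; rewrite eq_le measure_ge0 andbT.
    rewrite -[leRHS]A0; apply: le_measure; rewrite ?inE//.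
  rewrite mule0 add0e; apply: (@le_trans _ _ (lebesgue_stieltjes_measure FE `]0%R, 1%R]%classic)).
    by apply: le_measure; rewrite ?inE//; exact: subIsetr.
  by rewrite lebesgue_stieltjes_ocitv// lee_fin FEE.
have [f [f0 ffin fint fE]] := @radon_nikodym_sigma_finite _ _ R leb nu nu_leb.
have ffE : EFin \o (fine \o f) = f by apply/funext => x/=; rewrite fineK.
exists (fine \o f); split.
- by move=> x; exact: fine_ge0.
- by rewrite ffE.
- move=> a b a0 ab b1.
  rewrite -Rintegral_itv_obnd_cbnd; last first.
    by rewrite ffE; exact: integrableS fint.
  rewrite /Rintegral.
  rewrite [X in fine X](_ : _ = nu `]a, b]%classic); last first.
    by rewrite fE//; apply: eq_integral => x _; rewrite /= fineK.
  rewrite /nu/= /mfrestr /mrestr/= setIidl.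
    by rewrite lebesgue_stieltjes_ocitv// FV.
  by apply: subset_itv; rewrite bnd_simp.
Qed.

End StieltjesAbsolutelyContinuous.

(** Dominated convergence for sequences that are eventually zero at each point,
    such as the excesses of a function over the level [n]. *)
Lemma vanishing_integral d (T : measurableType d) (R : realType)
    (m : {measure set T -> \bar R}) (f_ : nat -> T -> R) (g : T -> R) :
  m.-integrable setT (EFin \o g) ->
  (forall n, measurable_fun setT (f_ n)) ->
  (forall n x, 0 <= f_ n x <= g x) ->
  (forall x, exists n0, forall n, (n0 <= n)%N -> f_ n x = 0) ->
  forall e : R, 0 < e -> exists n0, forall n, (n0 <= n)%N ->
    (\int[m]_x (f_ n x)%:E < e%:E)%E.
Proof.
move=> ig mf fg f0 e e0.
have [|||||_ _ ] := @dominated_convergence _ T R m setT measurableT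
  (fun n x => (f_ n x)%:E) (cst 0%E) (EFin \o g).
- by move=> n; exact/measurable_EFinP.
- exact: measurable_cst.
- apply: aeW => x _; have [n0 fn0] := f0 x.
  by apply: cvg_near_cst; exists n0 => // n /= n0n; rewrite fn0.
- exact: ig.
- apply: aeW => x n _ /=; have /andP[fn0 fng] := fg n x.
  by rewrite lee_fin ger0_norm.
rewrite integral0 => /fine_cvgP[[n1 _ finn]] /cvgrPdist_lt/(_ e e0)[n2 _ h].
exists (maxn n1 n2) => n; rewrite geq_max => /andP[n1n n2n].
have := h n n2n; rewrite /= sub0r normrN ger0_norm; last first.
  by apply: fine_ge0; apply: integral_ge0 => x _; rewrite lee_fin; case/andP: (fg n x).
by rewrite -lte_fin fineK//; exact: finn.
Qed.

Section Primitive.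
Context (R : realType).
Local Notation leb := (@lebesgue_measure R).
Implicit Types (f g u : R -> R) (a b t : R).

Definition primitive g t := \int[leb]_(r in `]-oo, t]) g r.

Lemma primitiveB g a b : leb.-integrable setT (EFin \o g) -> a <= b ->
  primitive g b - primitive g a = \int[leb]_(r in `[a, b]) g r.
Proof.
move=> ig ab; rewrite /primitive Rintegral_itvB//; last first.
  by apply: integrableS ig.
by rewrite Rintegral_itv_obnd_cbnd//; exact: integrableS ig.
Qed.

Lemma primitive_homo g : leb.-integrable setT (EFin \o g) ->
  (forall x, 0 <= g x) -> {homo primitive g : x y / x <= y}.
Proof.
by move=> ig g0 x y xy; rewrite -subr_ge0 primitiveB// Rintegral_ge0.
Qed.

Lemma primitive_right_continuous g : leb.-integrable setT (EFin \o g) ->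
  right_continuous (primitive g).
Proof.
move=> ig x; apply/cvgrPdist_lt => e e0.
have [d [d0 hd]] := integral_normr_continuous ig e0.
near=> y; have xy : x <= y by near: y; exact: nbhs_right_ge.
rewrite distrC primitiveB//.
apply: (le_lt_trans (le_normr_Rintegral _ _)) => //.
  exact: integrableS ig.
apply: hd; first exact: measurable_itv.
rewrite [X in (X < _)%E]lebesgue_measure_itv/= lte_fin.
case: ifPn => _; last by rewrite lte_fin.
rewrite -EFinD lte_fin ltrBlDl; near: y.
by apply: nbhs_right_lt; rewrite ltrDl.
Unshelve. all: by end_near. Qed.

Lemma primitive_derive_ae g : leb.-integrable setT (EFin \o g) ->
  {ae leb, forall t, is_derive t 1 (primitive g) (g t)}.
Proof.
move=> ig.
have igy y : leb.-integrable `]-oo, y] (EFin \o g) by exact: integrableS ig.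
have lig : locally_integrable [set: R] g.
  by apply: open_integrable_locally => //; exact: openT.
have := FTC1Ny igy lig.
apply: filterS => [|t [dt <-]]; first exact: (ae_filter_ringOfSetsType leb).
by rewrite derive1E; exact: DeriveDef.
Qed.

(** The retraction onto [0, 1]: composing with it extends functions given on the
    unit interval to the whole line, on which Stieltjes measures live. *)
Definition clip t : R := Num.max 0 (Num.min 1 t).

Lemma clip_itv t : 0 <= clip t <= 1.
Proof. by rewrite /clip le_max lexx/= ge_max ler01/= ge_min lexx. Qed.

Lemma clip_id t : 0 <= t <= 1 -> clip t = t.
Proof. by case/andP=> t0 t1; rewrite /clip min_r// max_r. Qed.

Lemma clip_homo : {homo clip : x y / x <= y}.
Proof.
move=> x y xy; rewrite /clip ge_max le_max lexx/=.
by rewrite le_max orbC le_min ge_min lexx/= ge_min xy !orbT.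
Qed.

Lemma clip_between x y : x <= y ->
  clip x = clip y \/ (x <= clip x) && (clip y <= y).
Proof.
rewrite /clip => xy.
by case: (leP 1 x); case: (leP 1 y); case: (leP 0 x); case: (leP 0 y) => *;
  rewrite /Num.max/=; do ?[case: ifP => ?]; (try (left; lra)); right; apply/andP; split; lra.
Qed.

End Primitive.

Section AbsolutelyContinuousFunctions.
Context (R : realType).
Local Notation leb := (@lebesgue_measure R).
Implicit Types (g u : R -> R) (a b t : R).

Lemma integrable_cst_itv a b (k : R) : leb.-integrable `[a, b] (EFin \o cst k).
Proof.
apply: measurable_bounded_integrable => //.
  rewrite [X in (X < _)%E]lebesgue_measure_itv/=; case: ifP => _; rewrite ?ltry//.
by exists `|k|; split=> [|M kM x _ /=]; [exact: num_real|exact: ltW].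
Qed.

(** A single integrable function is uniformly integrable; in this form the fact
    splits [g] into a bounded part and a part of small integral. *)
Lemma integral_excess g : leb.-integrable setT (EFin \o g) ->
  (forall x, 0 <= g x) -> forall e : R, 0 < e -> exists n : nat,
  leb.-integrable setT (EFin \o (fun r => Num.max (g r - n%:R) 0)) /\
  \int[leb]_r Num.max (g r - n%:R) 0 <= e.
Proof.
move=> ig g0 e e0.
have mg : measurable_fun setT g.
  by apply/measurable_EFinP; exact: (measurable_int leb).
have mgn n : measurable_fun setT (fun r => Num.max (g r - n%:R) 0).
  by apply: measurable_maxr => //; apply: measurable_funB.
have gn n x : 0 <= Num.max (g x - n%:R) 0 <= g x.
  rewrite le_max lexx orbT/= ge_max g0 andbT.
  by rewrite lerBlDr lerDl.
have gn0 x : exists n0, forall n, (n0 <= n)%N -> Num.max (g x - n%:R) 0 = 0.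
  exists (Num.trunc (g x)).+1 => n gn'; apply/max_idPr; rewrite subr_le0.
  by rewrite ltW// (lt_le_trans (truncnS_gt (g x)))// ler_nat.
have [n0 hn] := vanishing_integral ig mgn gn gn0 e0.
have h := hn n0 (leqnn _).
exists n0; split.
  apply: (le_integrable measurableT _ _ ig).
    by apply/measurable_EFinP; exact: mgn.
  move=> x _ /=; rewrite lee_fin !ger0_norm// ?le_max ?lexx ?orbT//.
  by rewrite ge_max g0 andbT lerBlDr lerDl.
rewrite /Rintegral -lee_fin fineK; first exact: ltW.
rewrite ge0_fin_numE; first by rewrite (lt_trans h)// ltry.
by apply: integral_ge0 => x _; rewrite lee_fin le_max lexx orbT.
Qed.

(** Adding a primitive of the dominating function makes [u] nondecreasing, with
    uniformly integrable increments; the density of the sum, minus the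
    dominating function, is the derivative of [u]. *)
Lemma dominated_increments_ftc u g : leb.-integrable setT (EFin \o g) ->
  (forall x, 0 <= g x) ->
  (forall a b, 0 <= a -> a < b -> b <= 1 ->
     `|u b - u a| <= \int[leb]_(r in `[a, b]) g r) ->
  exists v : R -> R, [/\ leb.-integrable setT (EFin \o v),
    (forall a b, 0 <= a -> a <= b -> b <= 1 ->
       u b - u a = \int[leb]_(r in `[a, b]) v r) &
    {ae leb, forall t, 0 < t < 1 -> is_derive t 1 u (v t)}].
Proof.
move=> ig g0 ug.
have G_homo := primitive_homo ig g0.
have uG x y : x <= y -> `|u (clip y) - u (clip x)| <= primitive g y - primitive g x.
  move=> xy; have [->|/andP[xc cy]] := clip_between xy.
    by rewrite subrr normr0 subr_ge0; exact: G_homo.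
  have := clip_homo xy; rewrite le_eqVlt => /predU1P[->|cxy].
    by rewrite subrr normr0 subr_ge0; exact: G_homo.
  have /andP[x0 _] := clip_itv x; have /andP[_ y1] := clip_itv y.
  apply: le_trans (ug _ _ x0 cxy y1) _.
  rewrite -primitiveB//; last exact: ltW.
  by apply: lerB; exact: G_homo.
pose V t := u (clip t) + primitive g t.
have ndV : {homo V : x y / x <= y}.
  by move=> x y /uG; rewrite /V ler_norml; lra.
have rcG := primitive_right_continuous ig.
have rcV : right_continuous V.
  move=> x; apply: cvgD; last exact: rcG.
  apply/cvgrPdist_le => e e0.
  have /cvgrPdist_le/(_ e e0) := rcG x.
  move=> h; near=> y.
  have xy : x <= y by near: y; exact: nbhs_right_ge.
  rewrite distrC (le_trans (uG _ _ xy))// -[leLHS]ger0_norm; last first.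
    by rewrite subr_ge0; exact: G_homo.
  by rewrite distrC; near: y.
have [|v [v0 iv vE]] := uniformly_integrable_increments_density ndV rcV.
  move=> e e0.
  have ig2 : leb.-integrable setT (EFin \o (fun x => 2 * g x)).
    rewrite (_ : _ \o _ = (fun x => 2%:E * (g x)%:E)%E)//.
    exact: integrableZl.
  have g20 x : 0 <= 2 * g x by rewrite mulr_ge0.
  have [n [iE En]] := integral_excess ig2 g20 e0.
  set E := (fun r => Num.max _ 0) in iE En.
  have E0 x : 0 <= E x by rewrite /E le_max lexx orbT.
  have E_homo := primitive_homo iE E0.
  exists n%:R, (primitive E); split => //.
  - exact: primitive_right_continuous.
  - rewrite primitiveB//; apply: le_trans En.
    rewrite /Rintegral fine_le//.
    + by apply: integrable_fin_num => //; exact: integrableS iE.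
    + exact: integrable_fin_num.
    + apply: ge0_subset_integral => //.
      * by apply: (measurable_int leb).
      * by move=> x _; rewrite lee_fin.
  - move=> a b ab; rewrite primitiveB//.
    have -> : n%:R * (b - a) = \int[leb]_(r in `[a, b]) n%:R.
      rewrite Rintegral_cst//= lebesgue_measure_itv/= lte_fin.
      by move: ab; rewrite le_eqVlt => /predU1P[->|ab]; rewrite ?ltxx ?subrr// ab.
    rewrite -RintegralD//; last 2 first.
    + exact: integrable_cst_itv.
    + by apply: integrableS iE.
    apply: le_trans (_ : \int[leb]_(r in `[a, b]) (2 * g r) <= _).
      rewrite RintegralZl//; last by apply: integrableS ig.
      rewrite -primitiveB//; have := uG _ _ ab; rewrite /V ler_norml; lra.
    apply: le_Rintegral => //.
    + by apply: integrableS ig2.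
    + rewrite (_ : _ \o _ = (EFin \o cst n%:R) \+ (EFin \o E))%E//.
      apply: integrableD => //; last by apply: integrableS iE.
      exact: integrable_cst_itv.
    + by move=> x _; rewrite /E -lerBlDl le_max lexx.
have ivg : leb.-integrable setT (EFin \o (fun x => v x - g x)).
  rewrite (_ : _ \o _ = (fun x => (v x)%:E - (g x)%:E)%E)//.
  exact: integrableB.
have uE a b : 0 <= a -> a <= b -> b <= 1 ->
    u b - u a = \int[leb]_(r in `[a, b]) (v r - g r).
  move=> a0 ab b1; rewrite RintegralB//; last 2 first.
  - by apply: integrableS iv.
  - by apply: integrableS ig.
  rewrite -vE// -primitiveB// /V !clip_id; first by ring.
    by rewrite a0 (le_trans ab).
  by rewrite (le_trans a0 ab).
exists (fun x => v x - g x); split => //.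
have := primitive_derive_ae ivg; apply: filterS => [|t dt /andP[t0 t1]].
  exact: (ae_filter_ringOfSetsType leb).
pose F x := u 0 + (primitive (fun x => v x - g x) x - primitive (fun x => v x - g x) 0).
apply: (@near_eq_is_derive _ _ _ F).
  near=> x.
  have x0 : 0 <= x by near: x; exact: lt_le_nbhsr.
  have x1 : x <= 1 by near: x; exact: lt_le_nbhsl.
  by rewrite /F primitiveB// -uE//; ring.
rewrite -[X in is_derive _ _ _ X]add0r; apply: is_deriveD.
rewrite -[X in is_derive _ _ _ X]subr0; apply: is_deriveB.
Unshelve. all: by end_near. Qed.

End AbsolutelyContinuousFunctions.

(** * The metric speed *)

Section MetricSpeed.
Context (R : realType).
Local Notation leb := (@lebesgue_measure R).
Implicit Types (g u : R -> R) (a b t : R).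

Lemma ae_lebesgue_neq (r : R) : {ae leb, forall t, t != r}.
Proof.
exists [set r]; split=> //; first exact: lebesgue_measure_set1.
by move=> t /= /negP; rewrite negbK => /eqP.
Qed.

Lemma abs_cont_dominated (Y : Type) (d : Y -> Y -> R) (c : R -> Y) :
  abs_cont d 1 c -> exists g : R -> R, [/\ leb.-integrable setT (EFin \o g),
    (forall x, 0 <= g x) & forall a b, 0 <= a -> a < b -> b <= 1 ->
    d (c b) (c a) <= \int[leb]_(r in `[a, b]) g r].
Proof.
move=> [g [mg ig dg]].
have ig1 : leb.-integrable `[0, 1]%classic (EFin \o g).
  apply/integrableP; split; first exact/measurable_EFinP.
  by under eq_integral do rewrite /= -[`|g _|]expr1.
pose g' := (fun r => `|g r|) \_ `[0, 1]%classic.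
have ig' : leb.-integrable setT (EFin \o g').
  rewrite /g' -restrict_EFin; rewrite -integrable_mkcond//.
  rewrite (_ : _ \o _ = abse \o (EFin \o g))//.
  exact: integrable_abse.
exists g'; split => //.
  by move=> x; rewrite /g' patchE; case: ifP.
move=> a b a0 ab b1; apply: le_trans (dg _ _ a0 ab b1) _.
have abS : `[a, b]%classic `<=` `[0, 1]%classic.
  by apply: subset_itv; rewrite bnd_simp.
apply: le_Rintegral => //.
- by apply: integrableS ig1.
- by apply: integrableS ig'.
- by move=> x /abS x01; rewrite /g' patchE mem_set// ler_norm.
Qed.

Lemma is_derive_norm_quotient u t l : is_derive t 1 u l ->
  `|u (t + h) - u t| / `|h| @[h --> 0^'] --> `|l|.
Proof.
move=> [/cvg_ex[/= l' ul'] ul].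
have {}ul : l' = l by rewrite -ul; exact/esym/cvg_lim.
rewrite ul in ul'; have {}ul' := cvg_norm (FF := dnbhs_filter 0) ul'; move: ul'.
apply: cvg_trans; apply: near_eq_cvg; near=> h.
rewrite /= normrZ normfV mulrC.
by rewrite (mulr1 h : h *: 1 = h) [t + h]addrC.
Unshelve. all: by end_near. Qed.

Lemma is_derive_norm_le u g t l k (e : R) : 0 < e ->
  is_derive t 1 u l -> is_derive t 1 g k ->
  (forall h, `|h| < e -> `|u (t + h) - u t| <= `|g (t + h) - g t|) ->
  `|l| <= `|k|.
Proof.
move=> e0 /is_derive_norm_quotient ul /is_derive_norm_quotient gk ug.
apply: ler_cvg_to ul gk _.
near=> h; rewrite ler_pM2r ?invr_gt0 ?normr_gt0//; last by near: h; exact: nbhs_dnbhs_neq.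
apply: ug; near: h; apply: dnbhs0_lt; exact: e0.
Unshelve. all: by end_near. Qed.

(** The distances to countably many points of the curve are absolutely
    continuous, and the supremum of the moduli of their derivatives is the
    metric speed: that supremum dominates the increments of the curve after
    integration, and each distance is 1-Lipschitz. *)
Lemma metric_speed_ae (X : metricType R) (c : R -> X) :
  abs_cont (@mdist R X) 1 c -> exists m : R -> R,
    [/\ leb.-integrable setT (EFin \o m), (forall t, 0 <= m t) &
        {ae leb, forall t, 0 < t < 1 ->
           difference_quotient (@mdist R X) c t h @[h --> 0^'] --> m t}].
Proof.
move=> /abs_cont_dominated[g [ig g0 cg]].
(* The points q k are the rational points of [0, 1]. *)
pose q (k : nat) := clip (ratr (odflt 0%Q (unpickle k)) : R).
pose u k t := mdist (c t) (c (q k)).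
have uc k a b : `|u k b - u k a| <= mdist (c b) (c a).
  rewrite /u ler_norml; have := metric_triangle (c b) (c a) (c (q k)).
  by have := metric_triangle (c a) (c b) (c (q k)); rewrite [mdist (c a) (c b)]metric_sym; lra.
have ug k a b : 0 <= a -> a < b -> b <= 1 ->
    `|u k b - u k a| <= \int[leb]_(r in `[a, b]) g r.
  by move=> a0 ab b1; exact: le_trans (uc k a b) (cg _ _ a0 ab b1).
have /choice[v vP] := fun k => dominated_increments_ftc ig g0 (ug k).
(* The minimum with g keeps the supremum over k finite at every t; almost everywhere
   it is |v k t|. *)
pose w k t := Num.min `|v k t| (g t).
have mg : measurable_fun setT g.
  by apply/measurable_EFinP; exact: (measurable_int leb).
have mw k : measurable_fun setT (w k).
  apply: measurable_minr => //; apply: measurableT_comp => //.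
  by apply/measurable_EFinP; apply: (measurable_int leb); case: (vP k).
pose em t := ereal_sup (range (fun k => (w k t)%:E)).
pose m t := fine (em t).
have wem k t : ((w k t)%:E <= em t)%E by apply: ereal_sup_ubound; exists k.
have emg t : (em t <= (g t)%:E)%E.
  by apply: ge_ereal_sup => _ [k _ <-]; rewrite lee_fin ge_min lexx orbT.
have em_fin t : em t \is a fin_num.
  apply/fin_numPlt; rewrite (lt_le_trans _ (wem 0%N t)) ?ltNyr//=.
  by rewrite (le_lt_trans (emg t)) ?ltry.
have w0 k t : 0 <= w k t by rewrite le_min normr_ge0 g0.
have wm k t : w k t <= m t by rewrite -lee_fin fineK.
have m0 t : 0 <= m t by rewrite (le_trans (w0 0%N t)).
have mm : measurable_fun setT em.
  rewrite (_ : em = (fun x => esups (fun n => (w n x)%:E) 0%N)); last first.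
    apply/funext => x; rewrite /em /esups/= /sdrop.
    by congr ereal_sup; apply/seteqP; split => [_ [n _ <-]|_ [n _ <-]]; exists n.
  by apply: measurable_fun_esups => n; apply/measurable_EFinP.
have im : leb.-integrable setT (EFin \o m).
  apply: (le_integrable measurableT _ _ ig).
    by rewrite (_ : _ \o _ = em)//; apply/funext => x /=; rewrite fineK.
  by move=> x _ /=; rewrite lee_fin !ger0_norm// -lee_fin fineK.
have dG := primitive_derive_ae ig.
have dM := primitive_derive_ae im.
have vg k : {ae leb, forall t, 0 < t < 1 -> `|v k t| <= g t}.
  have [_ _ dv] := vP k.
  apply: (filterS2 _ _ dG dv); first exact: (ae_filter_ringOfSetsType leb).
  move=> t dGt dvt /[dup] t01 /andP[t0 t1].
  rewrite -[leRHS]ger0_norm//.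
  apply: (@is_derive_norm_le (u k) (primitive g) t _ _ (Num.min t (1 - t))).
  - by rewrite lt_min t0 subr_gt0.
  - exact: dvt.
  - move=> h; rewrite lt_min => /andP[ht ht1].
    have th0 : 0 <= t + h by move: ht; rewrite ltr_norml; lra.
    have th1 : t + h <= 1 by move: ht1; rewrite ltr_norml; lra.
    have [h0|h0|->] := ltgtP h 0; last by rewrite addr0 subrr normr0.
    + rewrite distrC [leRHS]distrC (le_trans _ (ler_norm _))//.
      rewrite primitiveB//; last by rewrite gerDl ltW.
      apply: le_trans (uc _ _ _) _; apply: cg => //; last exact: ltW.
      by rewrite gtrDl.
    + rewrite (le_trans _ (ler_norm _))// primitiveB//; last by rewrite lerDl ltW.
      apply: le_trans (uc _ _ _) _; apply: cg => //; first exact: ltW.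
      by rewrite ltrDl.
have um k a b : 0 <= a -> a <= b -> b <= 1 ->
    `|u k b - u k a| <= primitive m b - primitive m a.
  move=> a0 ab b1; have [iv uv _] := vP k.
  rewrite uv// primitiveB//.
  apply: le_trans (le_normr_Rintegral _ _) _ => //; first by apply: integrableS iv.
  rewrite /Rintegral fine_le//.
  - apply: integrable_fin_num => //.
    by apply: integrable_norm; apply: integrableS iv.
  - by apply: integrable_fin_num => //; apply: integrableS im.
  - apply: ae_ge0_le_integral => //.
    + apply/measurable_EFinP/measurable_funTS; apply: measurableT_comp => //.
      by apply/measurable_EFinP; apply: (measurable_int leb).
    + by move=> x _; rewrite lee_fin.
    + by apply: measurable_funTS; apply: (measurable_int leb).
    + apply: (filterS3 _ _ (vg k) (ae_lebesgue_neq 0) (ae_lebesgue_neq 1)).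
        exact: (ae_filter_ringOfSetsType leb).
      move=> x vgx x0 x1 /=; rewrite in_itv/= => /andP[ax xb]; rewrite lee_fin.
      apply: le_trans (wm k x); rewrite /w min_l// vgx//.
      by rewrite !lt_neqAle eq_sym x0 x1 (le_trans a0 ax) (le_trans xb b1).
have cm a b : 0 <= a -> a < b -> b <= 1 ->
    mdist (c b) (c a) <= primitive m b - primitive m a.
  move=> a0 ab b1; apply/ler_addgt0Pr => e e0.
  have e20 : 0 < e / 2 by rewrite divr_gt0.
  have /cvgrPdist_lt/(_ _ e20) := primitive_right_continuous ig (x := a).
  rewrite /at_right near_withinE => -[d /= d0 hd].
  have : a < Num.min (a + d) b by rewrite lt_min ab ltrDl d0.
  move=> /rat_in_itvoo[r]; rewrite in_itv/= lt_min => /and3P[ar rad rb].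
  have qr : q (pickle r) = ratr r.
    by rewrite /q pickleK/= clip_id// (le_trans a0 (ltW ar)) (le_trans (ltW rb)).
  have := um (pickle r) a b a0 (ltW ab) b1.
  have uar : u (pickle r) a <= e / 2.
    rewrite /u qr metric_sym; apply: le_trans (cg _ _ _ ar _) _ => //.
      exact: le_trans (ltW rb) b1.
    rewrite -primitiveB//; last exact: ltW.
    have := hd (ratr r); rewrite /= => /(_ _ ar) h.
    apply: le_trans (ler_norm _) _; rewrite distrC ltW// h//.
    by rewrite distrC gtr0_norm ?subr_gt0// ltrBlDl.
  have := metric_triangle (c b) (c (q (pickle r))) (c a).
  rewrite -[mdist (c (q _)) _]metric_sym -/(u _ b) -/(u _ a).
  by move: uar => + ?; rewrite ler_norml; lra.
exists m; split => //.
have vgall : {ae leb, forall t, forall k, 0 < t < 1 -> `|v k t| <= g t}.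
  exact: ae_foralln.
have dvall : {ae leb, forall t, forall k, 0 < t < 1 -> is_derive t 1 (u k) (v k t)}.
  by apply: ae_foralln => k; case: (vP k).
apply: (filterS3 _ _ vgall dvall dM); first exact: (ae_filter_ringOfSetsType leb).
move=> t vgt dvt dMt /[dup] t01 /andP[t0 t1].
apply/cvgrPdist_le => e e0.
(* The quotient of the curve lies between that of u k, which tends to |v k t|,
   and that of the primitive of m, which tends to m t. *)
have [k vk] : exists k, m t - e / 2 <= `|v k t|.
  have : ((m t - e / 2)%:E < em t)%E.
    by rewrite -[em t]fineK// lte_fin ltrBlDr ltrDl divr_gt0.
  move=> /ereal_sup_gt[_ [k _ <-]]; rewrite lte_fin /w => h; exists k.
  by move: h; rewrite min_l ?vgt// => /ltW.
have e20 : 0 < e / 2 by rewrite divr_gt0.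
have /is_derive_norm_quotient/cvgrPdist_le/(_ _ e20) hv := dvt k t01.
have /is_derive_norm_quotient/cvgrPdist_le/(_ _ e0) hM := dMt.
near=> h.
have h0 : h != 0 by near: h; exact: nbhs_dnbhs_neq.
have th0 : 0 <= t + h.
  have : `|h| < t by near: h; exact: dnbhs0_lt.
  by rewrite ltr_norml; lra.
have th1 : t + h <= 1.
  have : `|h| < 1 - t by near: h; apply: dnbhs0_lt; rewrite subr_gt0.
  by rewrite ltr_norml; lra.
have nh : 0 < `|h| by rewrite normr_gt0.
have low : `|u k (t + h) - u k t| / `|h| <= difference_quotient (@mdist R X) c t h.
  by rewrite ler_pM2r ?invr_gt0.
have up : difference_quotient (@mdist R X) c t h <=
    `|primitive m (t + h) - primitive m t| / `|h|.
  rewrite ler_pM2r ?invr_gt0//.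
  have [h1|h1|h1] := ltgtP h 0; last by rewrite h1 eqxx in h0.
  - rewrite metric_sym distrC (le_trans _ (ler_norm _))// cm//; last exact: ltW.
    by rewrite gtrDl.
  - rewrite (le_trans _ (ler_norm _))// cm//; first exact: ltW.
    by rewrite ltrDl.
have : `| `|v k t| - `|u k (t + h) - u k t| / `|h| | <= e / 2 by near: h.
have : `| `|m t| - `|primitive m (t + h) - primitive m t| / `|h| | <= e by near: h.
rewrite (ger0_norm (m0 t)); move: low up vk; rewrite !ler_norml; lra.
Unshelve. all: by end_near. Qed.

End MetricSpeed.

(** * The absolutely continuous curves form a Borel set *)

(** Absolute continuity asks for a density. It is recast as a condition on finite
    chains 0 <= x_1 <= ... <= x_k <= 1, each instance of which is a closed
    condition on the curve. *)
Section Chains.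
Context (R : realType).
Implicit Types (q : R -> R -> R) (x y a b t : R) (s : seq R) (W : R -> R).

Fixpoint chain_sum q x s : R :=
  if s is y :: s' then q x y + chain_sum q y s' else 0.

Lemma chain_sum_rcons q x s y :
  chain_sum q x (rcons s y) = chain_sum q x s + q (last x s) y.
Proof.
by elim: s x => [x|z s ih x] /=; rewrite ?addr0 ?add0r// ih addrA.
Qed.

Lemma path_le_last x s : path <=%R x s -> x <= last x s.
Proof.
elim: s x => [x _|y s ih x /= /andP[xy ys]] //=.
exact: le_trans xy (ih _ ys).
Qed.

Lemma chain_sum_le q W x s : path <=%R x s ->
  (forall a b, x <= a -> a <= b -> b <= last x s -> q a b <= W b - W a) ->
  chain_sum q x s <= W (last x s) - W x.
Proof.
elim: s x => [x _ _|y s ih x /= /andP[xy ys] qW] /=; first by rewrite subrr.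
have ylast := path_le_last ys.
have := qW x y (lexx _) xy ylast.
have := ih y ys (fun a b ya ab bl => qW a b (le_trans xy ya) ab bl); lra.
Qed.

Definition chain_values q t : set R :=
  [set chain_sum q 0 s | s in [set s | path <=%R 0 s /\ last 0 s <= t]].

(** For [q x y] the distance between the points of a curve at times x and y, this
    is the variation of the curve up to time [t]. *)
Definition chain_sup q t : R := sup (chain_values q (clip t)).

Section ChainSup.
Variables (q : R -> R -> R) (M : R).
Hypothesis q0 : forall x y, 0 <= q x y.
Hypothesis qM : forall s, path <=%R 0 s -> last 0 s <= 1 -> chain_sum q 0 s <= M.

Let ubM t : ubound (chain_values q (clip t)) M.
Proof.
by move=> _ [s [ps ls] <-]; apply: qM => //; rewrite (le_trans ls)//; case/andP: (clip_itv t).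
Qed.

Let nonempty t : chain_values q (clip t) 0.
Proof. by exists [::] => //; split => //=; case/andP: (clip_itv t). Qed.

Lemma chain_sum_le_sup s t : path <=%R 0 s -> last 0 s <= clip t ->
  chain_sum q 0 s <= chain_sup q t.
Proof.
move=> ps ls; apply: ub_le_sup; first by exists M; exact: ubM.
by exists s.
Qed.

Lemma chain_sup_ge0 t : 0 <= chain_sup q t.
Proof. by apply: ub_le_sup => //; exists M; exact: ubM. Qed.

Lemma chain_sup_le t : chain_sup q t <= M.
Proof. by apply: ge_sup; [exists 0; exact: nonempty|exact: ubM]. Qed.

Lemma chain_sup_homo : {homo chain_sup q : x y / x <= y}.
Proof.
move=> x y xy; apply: ge_sup; first by exists 0; exact: nonempty.
by move=> _ [s [ps ls] <-]; apply: chain_sum_le_sup => //; rewrite (le_trans ls)// clip_homo.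
Qed.

Lemma chain_sup_increment a b : 0 <= a -> a <= b -> b <= 1 ->
  q a b <= chain_sup q b - chain_sup q a.
Proof.
move=> a0 ab b1; rewrite lerBrDl addrC -lerBrDl.
apply: ge_sup; first by exists 0; exact: nonempty.
move=> _ [s [ps ls] <-]; rewrite lerBrDl.
have aE : clip a = a by rewrite clip_id// a0 (le_trans ab).
have bE : clip b = b by rewrite clip_id// (le_trans a0 ab).
rewrite aE in ls.
have := @chain_sum_le_sup (rcons (rcons s a) b) b.
rewrite !last_rcons bE !rcons_path last_rcons ps ls ab => /(_ isT (lexx _)).
by rewrite !chain_sum_rcons last_rcons; have := q0 (last 0 s) a; lra.
Qed.

(** A chain is cut at [a]: its part before [a] contributes to the supremum at
    [a], the other part is dominated by the increment of [W]. *)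
Lemma chain_sup_minimal W a b : 0 <= a -> a <= b -> b <= 1 ->
  (forall x y z, x <= y -> y <= z -> q x z <= q x y + q y z) ->
  (forall x y, 0 <= x -> x <= y -> y <= 1 -> q x y <= W y - W x) ->
  chain_sup q b - chain_sup q a <= W b - W a.
Proof.
move=> a0 ab b1 qD qW.
have aE : clip a = a by rewrite clip_id// a0 (le_trans ab).
have bE : clip b = b by rewrite clip_id// (le_trans a0 ab).
have Whomo x y : 0 <= x -> x <= y -> y <= 1 -> W x <= W y.
  by move=> x0 xy y1; rewrite -subr_ge0 (le_trans (q0 x y))// qW.
suff H s x : 0 <= x -> x <= a -> path <=%R x s -> last x s <= b ->
    chain_sum q x s <= chain_sup q a - chain_sup q x + (W b - W a).
  rewrite lerBlDl; apply: ge_sup; first by exists 0; exact: nonempty.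
  move=> _ [s [ps ls] <-]; rewrite bE in ls.
  have := H s 0 (lexx _) a0 ps ls.
  have := chain_sup_ge0 0; lra.
elim: s x => [x x0 xa _ _|y s ih x x0 xa /= /andP[xy ys] ls] /=.
  have := Whomo _ _ a0 ab b1.
  have := chain_sup_homo xa; lra.
have yb : y <= b := le_trans (path_le_last ys) ls.
have [ya|ay] := leP y a.
  have := ih y (le_trans x0 xy) ya ys ls.
  have := chain_sup_increment x0 xy (le_trans yb b1); lra.
have := qD _ _ _ xa (ltW ay).
have := chain_sup_increment x0 xa (le_trans ab b1).
have := qW _ _ a0 (ltW ay) (le_trans yb b1).
have : chain_sum q y s <= W b - W y.
  apply: (@le_trans _ _ (W (last y s) - W y)).
    apply: chain_sum_le => // u v yu uv vl; apply: qW => //.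
      by rewrite (le_trans x0)// (le_trans xy).
    by rewrite (le_trans vl)// (le_trans ls).
  rewrite lerB// Whomo// (le_trans _ (path_le_last ys))//.
  exact: le_trans x0 xy.
lra.
Qed.

End ChainSup.
End Chains.

Section ChainCharacterization.
Context (R : realType).
Local Notation leb := (@lebesgue_measure R).
Implicit Types (x y a b t : R).

Lemma clip_lip x y : x <= y -> clip y - clip x <= y - x.
Proof.
by move=> xy; have [->|/andP[h1 h2]] := clip_between xy;
  [rewrite subrr subr_ge0|rewrite lerB].
Qed.

Section Curve.
Variables (Y : metricType R) (c : R -> Y).

Definition excess (l : R) x y : R :=
  Num.max (mdist (c y) (c x) - l * (y - x)) 0.

(** The curve moves at speed [l], up to a total excess of at most 1/(n+1): this is
    uniform integrability of its increments. *)
Definition chain_abs_cont := forall n : nat, exists l : nat,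
  forall s, path <=%R 0 s -> last 0 s <= 1 ->
  chain_sum (excess l%:R) 0 s <= n.+1%:R^-1.

Lemma excess_ge0 l x y : 0 <= excess l x y.
Proof. by rewrite /excess le_max lexx orbT. Qed.

Lemma excess_subadditive l x y z :
  excess l x z <= excess l x y + excess l y z.
Proof.
rewrite /excess ge_max addr_ge0 ?le_max ?lexx ?orbT// andbT.
have := metric_triangle (c z) (c y) (c x).
have : forall r : R, r <= Num.max r 0 by move=> r; rewrite le_max lexx.
move=> h; have := h (mdist (c y) (c x) - l * (y - x)).
have := h (mdist (c z) (c y) - l * (z - y)); lra.
Qed.

Lemma abs_cont_chain : abs_cont (@mdist R Y) 1 c -> chain_abs_cont.
Proof.
move=> /abs_cont_dominated[g [ig g0 cg]] n.
have n0 : 0 < n.+1%:R^-1 :> R by rewrite invr_gt0.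
have [l [il El]] := integral_excess ig g0 n0; exists l => s ps ls.
set E := (fun r => Num.max _ 0) in il El.
have E0 x : 0 <= E x by rewrite /E le_max lexx orbT.
apply: (@le_trans _ _ (primitive E (last 0 s) - primitive E 0)).
  apply: chain_sum_le => // a b a0 ab bl.
  rewrite primitiveB// /excess ge_max Rintegral_ge0// andbT.
  move: ab; rewrite le_eqVlt => /predU1P[<-|ab].
    by rewrite mdistxx !subrr mulr0 subrr Rintegral_ge0.
  have -> : l%:R * (b - a) = \int[leb]_(r in `[a, b]) l%:R.
    by rewrite Rintegral_cst//= lebesgue_measure_itv/= lte_fin ab.
  rewrite lerBlDl -RintegralD//; last 2 first.
  - exact: integrable_cst_itv.
  - by apply: integrableS il.
  apply: le_trans (cg _ _ a0 ab (le_trans bl ls)) _.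
  apply: le_Rintegral => //.
  - by apply: integrableS ig.
  - rewrite (_ : _ \o _ = (EFin \o cst l%:R) \+ (EFin \o E))%E//.
    apply: integrableD => //; last by apply: integrableS il.
    exact: integrable_cst_itv.
  - by move=> x _; rewrite /E -lerBlDl le_max lexx.
rewrite primitiveB//; last exact: path_le_last.
apply: le_trans El; rewrite /Rintegral fine_le//.
- by apply: integrable_fin_num => //; exact: integrableS il.
- exact: integrable_fin_num.
- apply: ge0_subset_integral => //.
  + by apply: (measurable_int leb).
  + by move=> x _; rewrite lee_fin.
Qed.

(** The variation of the curve is nondecreasing and dominates the increments of
    the curve. Its own increments exceed [l] times the length by at most those of
    the chain suprema of [excess l], so that it has a density. *)
Lemma chain_abs_cont_abs_cont : chain_abs_cont -> abs_cont (@mdist R Y) 1 c.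
Proof.
move=> H.
pose q0 x y := mdist (c y) (c x).
have q00 x y : 0 <= q0 x y by exact: mdist_ge0.
have q0E l x y : q0 x y <= l * (y - x) + excess l x y.
  by rewrite -lerBlDl /excess le_max lexx.
have q0D x y z : x <= y -> y <= z -> q0 x z <= q0 x y + q0 y z.
  by move=> _ _; rewrite addrC; exact: metric_triangle.
have [l1 H1] := H 0%N.
have q0M s : path <=%R 0 s -> last 0 s <= 1 -> chain_sum q0 0 s <= l1%:R + 1.
  move=> ps ls.
  have := H1 s ps ls; rewrite invr1.
  have h t : path <=%R t s ->
      chain_sum q0 t s <= l1%:R * (last t s - t) + chain_sum (excess l1%:R) t s.
    elim: s t {ps ls} => [t _|y s ih t /= /andP[ty ys]] /=.
      by rewrite subrr mulr0 addr0.
    have := ih y ys; have := q0E l1%:R t y; lra.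
  have := h 0 ps; rewrite subr0.
  have : l1%:R * last 0 s <= l1%:R :> R by rewrite ler_piMr.
  lra.
pose V := chain_sup q0.
have V_homo : {homo V : x y / x <= y} := chain_sup_homo q0M.
have VE (n : nat) : exists l : R, [/\ 0 <= l,
    {homo chain_sup (excess l) : x y / x <= y},
    chain_sup (excess l) 1 - chain_sup (excess l) 0 <= n.+1%:R^-1,
    (forall a b, a <= b -> chain_sup (excess l) b - chain_sup (excess l) a
       <= V b - V a) &
    forall a b, a <= b -> V b - V a <=
      l * (b - a) + (chain_sup (excess l) b - chain_sup (excess l) a)].
  have [l Hl] := H n; exists l%:R.
  have eM := Hl.
  have e0 := excess_ge0 l%:R.
  have clipE (f : R -> R -> R) x : chain_sup f (clip x) = chain_sup f x.
    by rewrite /chain_sup (clip_id (clip_itv x)).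
  split => //.
  - exact: chain_sup_homo eM.
  - by apply: le_trans (chain_sup_le eM 1); rewrite gerBl (chain_sup_ge0 eM).
  - move=> a b ab; rewrite -(clipE _ b) -(clipE _ a) /V -(clipE q0 b) -(clipE q0 a).
    have /andP[a0 _] := clip_itv a; have /andP[_ b1] := clip_itv b.
    apply: (chain_sup_minimal e0 eM) => //; first exact: clip_homo.
      by move=> x y z _ _; exact: excess_subadditive.
    move=> x y x0 xy y1.
    apply: (@le_trans _ _ (q0 x y)); last exact: (chain_sup_increment q00 q0M).
    rewrite /excess ge_max q00 andbT lerBlDr lerDl mulr_ge0//.
    by rewrite subr_ge0.
  - move=> a b ab; rewrite -(clipE _ b) -(clipE _ a) /V -(clipE q0 b) -(clipE q0 a).
    have /andP[a0 _] := clip_itv a; have /andP[_ b1] := clip_itv b.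
    apply: (@le_trans _ _ (l%:R * (clip b - clip a) +
      (chain_sup (excess l%:R) (clip b) - chain_sup (excess l%:R) (clip a)))).
      rewrite [X in _ <= X](_ : _ = (l%:R * clip b + chain_sup (excess l%:R) (clip b))
        - (l%:R * clip a + chain_sup (excess l%:R) (clip a))); last by ring.
      apply: (chain_sup_minimal q00 q0M (W := fun x => l%:R * x + chain_sup (excess l%:R) x)) => //.
        exact: clip_homo.
      move=> x y x0 xy y1.
      have := q0E l%:R x y; have := chain_sup_increment e0 eM x0 xy y1; lra.
    by rewrite lerD2r ler_wpM2l// clip_lip.
have small (e : R) : 0 < e -> exists n : nat, n.+1%:R^-1 <= e.
  move=> e0; exists (Num.trunc e^-1); rewrite invf_ple ?posrE//.
  by rewrite ltW// truncnS_gt.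
have rcV : right_continuous V.
  move=> x; apply/cvgrPdist_le => e e0.
  have e20 : 0 < e / 2 by rewrite divr_gt0.
  have [n ne] := small _ e20.
  have [l [l0 Eh E1 _ VEl]] := VE n.
  have El a b : chain_sup (excess l) b - chain_sup (excess l) a <= e / 2.
    apply: le_trans ne; apply: le_trans E1.
    have : chain_sup (excess l) b <= chain_sup (excess l) 1.
      by rewrite /chain_sup -(clip_id (clip_itv b)) Eh//; case/andP: (clip_itv b).
    have : chain_sup (excess l) 0 <= chain_sup (excess l) a.
      by rewrite /chain_sup -(clip_id (clip_itv a)) Eh//; case/andP: (clip_itv a).
    lra.
  near=> y; have xy : x <= y by near: y; exact: nbhs_right_ge.
  rewrite distrC ger0_norm ?subr_ge0 ?V_homo//.
  have := VEl _ _ xy; have := El x y.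
  have : l * (y - x) <= e / 2.
    apply: (@le_trans _ _ ((l + 1) * (y - x))).
      by rewrite ler_wpM2r ?subr_ge0// lerDl.
    rewrite mulrC -ler_pdivlMr ?ltr_wpDl// lerBlDl.
    near: y; apply: nbhs_right_le; rewrite ltrDl divr_gt0// ltr_wpDl//.
  lra.
have [|v [v0 iv vE]] := uniformly_integrable_increments_density V_homo rcV.
  move=> e e0; have [n ne] := small _ e0; have [l [l0 Eh E1 EV VEl]] := VE n.
  exists l, (chain_sup (excess l)); split => //; last exact: le_trans E1 ne.
  move=> x; apply/cvgrPdist_le => e' e'0.
  have /cvgrPdist_le/(_ e' e'0) hV := rcV x.
  near=> y; have xy : x <= y by near: y; exact: nbhs_right_ge.
  rewrite distrC ger0_norm ?subr_ge0 ?Eh//.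
  apply: le_trans (EV _ _ xy) _; rewrite -[leLHS]ger0_norm ?subr_ge0 ?V_homo//.
  by rewrite distrC; near: y.
exists v; split.
- by apply: measurable_funTS; apply/measurable_EFinP; apply: (measurable_int leb).
- have iv01 : leb.-integrable `[0, 1]%classic (EFin \o v) by apply: integrableS iv.
  have /integrableP[_] := iv01.
  by under eq_integral do rewrite /= -[`|v _|]expr1.
- move=> t s t0 ts s1; rewrite -vE//; last exact: ltW.
  by apply: (chain_sup_increment q00 q0M) => //; exact: ltW.
Unshelve. all: by end_near. Qed.

End Curve.
End ChainCharacterization.

Section MetricContinuity.
Context (R : realType) (X : metricType R).

Lemma continuous_mdist (T : topologicalType) (f g : T -> X) :
  continuous f -> continuous g -> continuous (fun t => mdist (f t) (g t) : R).
Proof.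
move=> cf cg t; apply/cvgrPdist_lt => e e0.
have e20 : 0 < e / 2 by rewrite divr_gt0.
have /metricType_numDomainType.cvgrPdist_lt/(_ _ e20) hf := cf t.
have /metricType_numDomainType.cvgrPdist_lt/(_ _ e20) hg := cg t.
near=> s.
have : mdist (f t) (f s) < e / 2 by near: s.
have : mdist (g t) (g s) < e / 2 by near: s.
have := metric_triangle (f t) (f s) (g t).
have := metric_triangle (f s) (g s) (g t).
have := metric_triangle (f s) (f t) (g s).
have := metric_triangle (f t) (g t) (g s).
rewrite [mdist (f s) (f t)]metric_sym [mdist (g s) (g t)]metric_sym.
rewrite ltr_norml; lra.
Unshelve. all: by end_near. Qed.

End MetricContinuity.

Section BorelFunctions.
Context (R : realType).

Lemma borel_open (T : ptopologicalType) (U : set T) :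
  open U -> measurable (U : set (borel T)).
Proof. by move=> oU; exact: sub_sigma_algebra. Qed.

Lemma borel_closed (T : ptopologicalType) (U : set T) :
  closed U -> measurable (U : set (borel T)).
Proof. by move=> cU; rewrite -(setCK U); apply: measurableC; apply: borel_open; exact: closed_openC. Qed.

Lemma continuous_borel_fun (T : ptopologicalType) (f : T -> R) :
  continuous f -> measurable_fun setT (f : borel T -> R).
Proof.
move=> cf; apply: (measurability _ (RGenOpens.measurableE R)) => //.
move=> _ [_ [a [b ->] <-]]; rewrite setTI; apply: borel_open.
by move/continuousP : cf; apply; exact: interval_open.
Qed.

Lemma continuous_borel_map (T S : ptopologicalType) (f : T -> S) :
  continuous f -> measurable_fun setT (f : borel T -> borel S).
Proof.
move=> cf; apply: (@measurability _ _ (borel T) (borel S) setT f (@open S) erefl).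
move=> _ [U oU <-].
by rewrite setTI; apply: borel_open; move/continuousP : cf; exact.
Qed.

End BorelFunctions.

Section CurveSpace.
Context (R : realType) (X : completeMetricType R).

Lemma eval_at_continuous (t : R) : continuous (eval_at t : curve X -> X).
Proof.
move=> c A.
rewrite -nbhs_entourageE => -[E entE EA].
have ic := @initial_continuous (curve X) {uniform unit_interval R -> X}
  (fun c => c : unit_interval R -> X) c.
have := ic [set h | A (h (insubd (unit0 R) t))]; apply.
apply/uniform_nbhs; exists E; split => // h Eh.
by apply: EA; apply/xsectionP; exact: Eh.
Qed.

(** Each chain sum depends continuously on the curve, so that the uncountable
    intersection over all chains is closed. *)
Lemma borel_chain_abs_cont :
  measurable [set c : borel (curve X) | chain_abs_cont (fun s => eval_at s (c : curve X))].
Proof.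
rewrite (_ : [set _ | _] = \bigcap_n \bigcup_l
  \bigcap_(s in [set s | path <=%R 0 s /\ last 0 s <= 1])
  [set c : curve X | chain_sum (excess (fun s => eval_at s c) l%:R) 0 s <= n.+1%:R^-1]); last first.
  apply/seteqP; split => c /= h n.
    by move=> _; have [l hl] := h n; exists l => // s [ps ls]; exact: hl.
  by have [l _ hl] := h n Logic.I; exists l => s ps ls; exact: hl.
apply: bigcap_measurable => // n _; apply: bigcup_measurable => l _.
apply: borel_closed; apply: closed_bigI => s _.
rewrite (_ : [set _ | _] =
  (fun c => chain_sum (excess (fun s => eval_at s c) l%:R) 0 s) @^-1`
  [set x | x <= n.+1%:R^-1])//.
apply: closed_comp; last exact: closed_le.
move=> c _; suff : forall x : R, continuous (fun c : curve X => chain_sum (excess (fun s => eval_at s c) l%:R) x s).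
  exact.
elim: s => [|y s ih] x /=; first exact: cst_continuous.
move=> c'; apply: (cvgD (FF := nbhs_filter c')); last exact: ih.
apply: (@continuous_max _ (curve X)
  (fun c => mdist (eval_at y c) (eval_at x c) - l%:R * (y - x)) (cst 0)).
  apply: (cvgB (FF := nbhs_filter c')); last exact: cvg_cst.
  by apply: continuous_mdist; exact: eval_at_continuous.
exact: cst_continuous.
Qed.

Lemma energy_not_abs_cont (c : curve X) :
  ~ chain_abs_cont (fun s => eval_at s c) -> energy c = +oo%E.
Proof.
move=> nc; rewrite /energy; case: asboolP => // /abs_cont_chain h.
by exfalso; apply: nc.
Qed.

End CurveSpace.

(** * Local slopes are weak upper gradients *)

Section UpperGradientAlongCurve.
Context (R : realType) (X : metricType R).
Local Notation leb := (@lebesgue_measure R).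
Implicit Types (f G : X -> R) (c : R -> X).

Lemma metric_speed_ge0 c t : 0 <= metric_speed (@mdist R X) c t.
Proof.
rewrite /metric_speed.
have [cv|/dvgP ->] := pselect (cvg (difference_quotient (@mdist R X) c t h @[h --> 0^'])); last by [].
apply: limr_ge => //; apply: nearW => h.
by rewrite /difference_quotient mulr_ge0 ?invr_ge0// mdist_ge0.
Qed.

(** The composition of [f] with the curve is absolutely continuous, and its
    derivative is at most the slope of [f] times the metric speed. *)
Lemma upper_gradient_along_curve f G c (K : R) :
  abs_cont (@mdist R X) 1 c ->
  (forall a b, 0 <= a <= 1 -> 0 <= b <= 1 ->
     `|f (c b) - f (c a)| <= K * mdist (c b) (c a)) ->
  (forall x, 0 <= G x) ->
  (forall x e, 0 < e -> exists2 d, 0 < d & forall y, mdist y x < d ->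
     `|f y - f x| <= (G x + e) * mdist y x) ->
  (`|f (c 1) - f (c 0)|%:E <=
    \int[leb]_(t in `[0%R, 1%R]) (G (c t) * metric_speed (@mdist R X) c t)%:E)%E.
Proof.
move=> ac fK G0 fG.
have [g [ig g0 cg]] := abs_cont_dominated ac.
have iKg : leb.-integrable setT (EFin \o (fun x => `|K| * g x)).
  rewrite (_ : _ \o _ = (fun x => `|K|%:E * (g x)%:E)%E)//.
  exact: integrableZl.
have Kg0 x : 0 <= `|K| * g x by rewrite mulr_ge0.
have fcg a b : 0 <= a -> a < b -> b <= 1 ->
    `|f (c b) - f (c a)| <= \int[leb]_(r in `[a, b]) (`|K| * g r).
  move=> a0 ab b1; rewrite RintegralZl//; last by apply: integrableS ig.
  apply: le_trans (fK _ _ _ _) _.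
  - by rewrite a0 (le_trans (ltW ab)).
  - by rewrite b1 (le_trans a0 (ltW ab)).
  rewrite (le_trans (ler_wpM2r (mdist_ge0 _ _) (ler_norm K)))//.
  by rewrite ler_wpM2l// cg.
have [v [iv vE dv]] := dominated_increments_ftc (u := f \o c) iKg Kg0 fcg.
have [m [im m0 mspeed]] := metric_speed_ae ac.
have mv : measurable_fun setT v.
  by apply/measurable_EFinP; apply: (measurable_int leb).
apply: (@le_trans _ _ (\int[leb]_(t in `[0%R, 1%R]) `|v t|%:E)%E).
  have -> : f (c 1) - f (c 0) = (f \o c) 1 - (f \o c) 0 by [].
  rewrite vE// EFin_normr_Rintegral//; last by apply: integrableS iv.
  apply: le_abse_integral => //.
  by apply/measurable_EFinP; exact: measurable_funTS.
apply: ae_le_lower_integral => //.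
- by apply/measurable_EFinP; apply: measurableT_comp => //; exact: measurable_funTS.
- by move=> t _; rewrite lee_fin mulr_ge0// metric_speed_ge0.
have h01 : {ae leb, forall t, t != 0 /\ t != 1}.
  by apply: (filterS2 _ _ (ae_lebesgue_neq 0) (ae_lebesgue_neq 1)); first exact: (ae_filter_ringOfSetsType leb).
apply: (filterS3 _ _ dv mspeed h01); first exact: (ae_filter_ringOfSetsType leb).
move=> t dvt mt [tn0 tn1] /=; rewrite in_itv/= => /andP[t0 t1].
have t01 : 0 < t < 1 by rewrite !lt_neqAle eq_sym tn0 tn1 t0.
have {}mt := mt t01.
have sE : metric_speed (@mdist R X) c t = m t by apply: cvg_lim.
rewrite lee_fin sE; apply/ler_addgt0Pr => e e0.
have /is_derive_norm_quotient vt := dvt t01.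
have e1 : 0 < e / (m t + 1) by rewrite divr_gt0// ltr_wpDl.
have [d d0 fd] := fG (c t) _ e1.
have hm : (G (c t) + e / (m t + 1)) * difference_quotient (@mdist R X) c t h
    @[h --> 0^'] --> (G (c t) + e / (m t + 1)) * m t.
  by apply: cvgMr.
apply: (@le_trans _ _ ((G (c t) + e / (m t + 1)) * m t)); last first.
  rewrite mulrDl lerD2l mulrAC ler_pdivrMr ?ltr_wpDl// ler_pM2l//.
  by rewrite lerDl.
apply: ler_cvg_to vt hm _.
have /cvgrPdist_lt/(_ _ ltr01) hq := mt.
near=> h.
have h0 : h != 0 by near: h; exact: nbhs_dnbhs_neq.
rewrite /= /difference_quotient mulrA ler_pM2r ?invr_gt0 ?normr_gt0//.
apply: fd.
have : `|m t - difference_quotient (@mdist R X) c t h| < 1 by near: h.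
move=> hq1; have : difference_quotient (@mdist R X) c t h < m t + 1.
  by move: hq1; rewrite ltr_norml; lra.
rewrite /difference_quotient ltr_pdivrMr ?normr_gt0// => /lt_le_trans; apply.
rewrite mulrC -ler_pdivlMr ?ltr_wpDl//.
by near: h; apply: dnbhs0_le; rewrite divr_gt0// ltr_wpDl.
Unshelve. all: by end_near. Qed.

End UpperGradientAlongCurve.

Section WeakUpperGradients.
Context (R : realType) (X : completeMetricType R).
Variable m : {measure set (borel X) -> \bar R}.
Local Notation leb := (@lebesgue_measure R).
Implicit Types (f G : X -> R) (pi : probability (borel (curve X)) R).

Lemma measurable_eval_at (t : R) :
  measurable_fun setT (eval_at t : borel (curve X) -> borel X).
Proof. by apply: continuous_borel_map; exact: eval_at_continuous. Qed.

Lemma measurable_increment f : measurable_fun setT (f : borel X -> R) ->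
  measurable_fun setT (fun c : borel (curve X) =>
    `|f (eval_at 1 (c : curve X)) - f (eval_at 0 (c : curve X))|%:E).
Proof.
move=> mf; apply/measurable_EFinP; apply: measurableT_comp => //.
apply: measurable_funB.
  exact: (measurableT_comp mf (measurable_eval_at 1)).
exact: (measurableT_comp mf (measurable_eval_at 0)).
Qed.

Lemma energy_ge0 (c : curve X) : (0 <= energy c)%E.
Proof.
rewrite /energy; case: ifP => // _; apply: integral_ge0 => t _.
by rewrite lee_fin sqr_ge0.
Qed.

(** A curve of finite energy is absolutely continuous; as those form a Borel
    set, its complement cannot be charged. *)
Lemma test_plan_abs_cont pi : test_plan m pi ->
  {ae pi, forall c : borel (curve X),
     abs_cont (@mdist R X) 1 (fun s => eval_at s (c : curve X))}.
Proof.
move=> [_ fin].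
set S := [set c : borel (curve X) |
  chain_abs_cont (fun s => eval_at s (c : curve X))].
have mS : measurable (~` S) by apply: measurableC; exact: borel_chain_abs_cont.
exists (~` S); split=> //; last first.
  by move=> c /= nc hc; apply: nc; exact: chain_abs_cont_abs_cont.
apply/eqP; rewrite eq_le measure_ge0 andbT leNgt; apply/negP => piS.
suff : (+oo <= \int[pi]_c energy c)%E by rewrite leNgt fin.
have <- : (\int[pi]_(c in ~` S) +oo = +oo)%E.
  by rewrite integral_cst// gt0_mulye.
rewrite integral_mkcond; apply: ge0_le_lower_integral => c _.
  by rewrite /patch; case: ifP.
rewrite /patch; case: ifPn => [/set_mem Sc|_]; last exact: energy_ge0.
by rewrite energy_not_abs_cont.
Qed.

Lemma abs_cont_bounded (c : R -> X) (x0 : X) : abs_cont (@mdist R X) 1 c ->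
  exists2 D : R, 0 <= D & forall t, 0 <= t <= 1 -> mdist (c t) x0 <= D.
Proof.
move=> /abs_cont_dominated[g [ig g0 cg]].
exists (mdist (c 0) x0 + \int[leb]_(r in `[0, 1]) g r).
  by rewrite addr_ge0 ?mdist_ge0 ?Rintegral_ge0.
move=> t /andP[t0 t1].
apply: le_trans (metric_triangle _ (c 0) _) _.
rewrite addrC lerD2l.
move: t0; rewrite le_eqVlt => /predU1P[<-|t0].
  by rewrite mdistxx Rintegral_ge0.
apply: le_trans (cg _ _ (lexx _) t0 t1) _.
rewrite -!primitiveB//; last exact: ltW.
by rewrite lerD2r primitive_homo.
Qed.

(** Almost every curve of a test plan is absolutely continuous, hence bounded,
    and [f] is Lipschitz on bounded sets. *)
Lemma slope_weak_upper_gradient f G (A : R) (x0 : X) :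
  measurable_fun setT (f : borel X -> R) ->
  (G : borel X -> R) \in Lfun m 2%:E -> (forall x, 0 <= G x) ->
  (forall x y, `|f x - f y| <= mdist x y * (A + mdist x x0 + mdist y x0)) ->
  (forall x e, 0 < e -> exists2 d, 0 < d & forall y, mdist y x < d ->
     `|f y - f x| <= (G x + e) * mdist y x) ->
  weak_upper_gradient m f G.
Proof.
move=> mf LG G0 fA fG; split => // pi pitest.
apply: ae_le_lower_integral => //.
- exact: measurable_increment.
- move=> c _; apply: integral_ge0 => t _; rewrite lee_fin mulr_ge0//.
  exact: metric_speed_ge0.
have := test_plan_abs_cont pitest.
apply: filterS => c ac _.
have [D D0 cD] := abs_cont_bounded x0 ac.
apply: (upper_gradient_along_curve (K := A + D + D)) ac _ G0 fG.
move=> a b a01 b01; rewrite mulrC.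
apply: le_trans (fA _ _) _; rewrite ler_wpM2l ?mdist_ge0//.
by have := cD _ a01; have := cD _ b01; lra.
Qed.

(** The increments of [f] and [g] at the end points are measurable, so their
    integrals add up; on the side of the gradients superadditivity suffices. *)
Lemma weak_upper_gradientD f g G H : measurable_fun setT (f : borel X -> R) ->
  measurable_fun setT (g : borel X -> R) ->
  weak_upper_gradient m f G -> weak_upper_gradient m g H ->
  weak_upper_gradient m (f \+ g) (G \+ H).
Proof.
move=> mf mg [LG G0 fG] [LH H0 gH]; split.
- by rewrite rpredD// lee1n.
- by move=> x; rewrite addr_ge0.
move=> pi pit.
have mfgD : measurable_fun setT ((f \+ g)%R : borel X -> R) by exact: measurable_funD.
apply: (@le_trans _ _ (\int[pi]_c (`|f (eval_at 1%R c) - f (eval_at 0%R c)|%:E +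
     `|g (eval_at 1%R c) - g (eval_at 0%R c)|%:E))%E).
  apply: ge0_le_lower_integral => c _; rewrite lee_fin//.
  by rewrite opprD addrACA ler_normD.
rewrite ge0_integralD//; last 2 first.
- exact: measurable_increment.
- exact: measurable_increment.
apply: le_trans (leeD (fG _ pit) (gH _ pit)) _.
apply: le_trans (lower_integralD _ _ _ _) _ => //.
- move=> c _; apply: integral_ge0 => t _; rewrite lee_fin mulr_ge0//.
  exact: metric_speed_ge0.
- move=> c _; apply: integral_ge0 => t _; rewrite lee_fin mulr_ge0//.
  exact: metric_speed_ge0.
apply: ge0_le_lower_integral => c _.
  by rewrite adde_ge0//; apply: integral_ge0 => t _; rewrite lee_fin mulr_ge0//;
    exact: metric_speed_ge0.
apply: le_trans (lower_integralD _ _ _ _) _ => //.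
- by move=> t _; rewrite lee_fin mulr_ge0//; exact: metric_speed_ge0.
- by move=> t _; rewrite lee_fin mulr_ge0//; exact: metric_speed_ge0.
apply: ge0_le_lower_integral => t _.
  by rewrite -EFinD lee_fin addr_ge0// mulr_ge0//; exact: metric_speed_ge0.
by rewrite -EFinD mulrDl.
Qed.

Lemma weak_upper_gradientZ (a : R) f G : measurable_fun setT (f : borel X -> R) ->
  weak_upper_gradient m f G -> weak_upper_gradient m (a \*o f) (`|a| \*o G).
Proof.
move=> mf [LG G0 fG]; split.
- have : (`|a| *: (G : borel X -> R)) \in Lfun m 2%:E by rewrite rpredZ// lee1n.
  by rewrite (_ : _ *: _ = `|a| \*o G).
- by move=> x /=; rewrite mulr_ge0.
move=> pi pit.
under eq_integral do rewrite /= -mulrBr normrM EFinM.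
rewrite ge0_integralZl//; last exact: measurable_increment.
apply: le_trans (lee_wpmul2l _ (fG _ pit)) _; first by rewrite lee_fin.
apply: le_trans (lower_integralZl _ _ _ _) _ => //.
  by move=> c _; apply: integral_ge0 => t _; rewrite lee_fin mulr_ge0//;
    exact: metric_speed_ge0.
apply: ge0_le_lower_integral => c _.
  by rewrite mule_ge0 ?lee_fin//; apply: integral_ge0 => t _;
    rewrite lee_fin mulr_ge0//; exact: metric_speed_ge0.
apply: le_trans (lower_integralZl _ _ _ _) _ => //.
  by move=> t _; rewrite lee_fin mulr_ge0//; exact: metric_speed_ge0.
apply: ge0_le_lower_integral => t _.
  by rewrite mule_ge0 ?lee_fin// mulr_ge0//; exact: metric_speed_ge0.
by rewrite -EFinM /= mulrA.
Qed.

Lemma S2D f g : S2 m f -> S2 m g -> S2 m (f \+ g).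
Proof.
move=> [mf [G fG]] [mg [H gH]]; split; first exact: measurable_funD.
by exists (G \+ H); exact: weak_upper_gradientD.
Qed.

Lemma S2Z (a : R) f : S2 m f -> S2 m (a \*o f).
Proof.
move=> [mf [G fG]]; split; first exact: measurable_funM.
by exists (`|a| \*o G); exact: weak_upper_gradientZ.
Qed.

End WeakUpperGradients.

(** * The cotangent seminorm and its dual norm *)

Section MinimalGradient.
Context (R : realType) (X : completeMetricType R).
Variable m : {measure set (borel X) -> \bar R}.
Implicit Types (f G : X -> R).

Lemma Lfun2_of_integral (G : borel X -> R) : measurable_fun setT G ->
  (\int[m]_x (G x ^+ 2)%:E < +oo)%E -> G \in Lfun m 2%:E.
Proof.
move=> mG fG; rewrite inE; apply/andP; split; rewrite inE//=.
rewrite /finite_norm unlock poweR_lty//.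
rewrite (eq_integral (fun x => (G x ^+ 2)%:E))// => x _.
rewrite -[(EFin \o G) x]/((G x)%:E) abse_EFin poweR_EFin powR_mulrn//.
by rewrite -normrX ger0_norm ?sqr_ge0.
Qed.

Lemma Lfun2_measurable (G : borel X -> R) : G \in Lfun m 2%:E ->
  measurable_fun setT G.
Proof. by move=> /sub_Lfun_mfun; rewrite inE. Qed.

Variable mu : probability (borel X) R.
Variable C : R.
Hypothesis muC : forall A : set (borel X), measurable A -> (mu A <= C%:E * m A)%E.

Lemma compression_ae (P : set (borel X)) : {ae m, forall x, P x} -> {ae mu, forall x, P x}.
Proof.
move=> [A [mA mA0 PA]]; exists A; split => //.
apply/eqP; rewrite eq_le measure_ge0 andbT.
by apply: le_trans (muC mA) _; rewrite mA0 mule0.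
Qed.

(** When no minimal gradient exists [min_grad f] is the default [0], hence this
    bound does not depend on the existence of a minimal gradient. *)
Lemma sqnorm_le f G : weak_upper_gradient m f G ->
  (sqnorm m mu f <= \int[mu]_x (G x ^+ 2)%:E)%E.
Proof.
move=> fG; rewrite /sqnorm /min_grad.
have [LG G0 _] := fG.
case: xgetP => [H _ [[LH H0 _] /(_ _ fG) HG]|_]; last first.
  apply: ge0_le_lower_integral => x _; rewrite lee_fin ?sqr_ge0//.
  by rewrite expr0n sqr_ge0.
apply: ae_ge0_le_integral => //.
- by move=> x _; rewrite lee_fin sqr_ge0.
- by apply/measurable_EFinP; apply: measurable_funX; exact: Lfun2_measurable.
- by move=> x _; rewrite lee_fin sqr_ge0.
- by apply/measurable_EFinP; apply: measurable_funX; exact: Lfun2_measurable.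
- apply: filterS (compression_ae HG) => x Hx _.
  by rewrite lee_fin lerXn2r// nnegrE.
Qed.

Lemma sqnorm_ge0 f : (0 <= sqnorm m mu f)%E.
Proof. by apply: integral_ge0 => x _; rewrite lee_fin sqr_ge0. Qed.

(** For nonzero [a], minimal gradients of [f] and of [a f] correspond to each
    other, and in particular exist simultaneously. *)
Lemma sqnorm_scale (a : R) f : measurable_fun setT (f : borel X -> R) ->
  (exists G, weak_upper_gradient m f G) ->
  (sqnorm m mu (a \*o f) <= (a ^+ 2)%:E * sqnorm m mu f)%E.
Proof.
move=> mf [G fG].
have [->|a0] := eqVneq a 0.
  apply: le_trans (sqnorm_le (weak_upper_gradientZ 0 mf fG)) _.
  rewrite expr0n/= mul0e; under eq_integral do rewrite normr0 mul0r expr0n/=.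
  by rewrite integral0.
rewrite {2}/sqnorm /min_grad; case: xgetP => [H _ [fH Hmin]|noH].
  apply: le_trans (sqnorm_le (weak_upper_gradientZ a mf fH)) _.
  under eq_integral do rewrite exprMn real_normK ?num_real// EFinM.
  rewrite ge0_integralZl ?lee_fin ?sqr_ge0//.
    apply/measurable_EFinP; apply: measurable_funX; apply: Lfun2_measurable.
    by case: fH.
  by move=> x _; rewrite lee_fin sqr_ge0.
rewrite (_ : sqnorm m mu (a \*o f) = 0%E).
  rewrite mule_ge0// ?lee_fin ?sqr_ge0//.
  by apply: integral_ge0 => x _; rewrite lee_fin sqr_ge0.
rewrite /sqnorm /min_grad xgetPN.
  by under eq_integral do rewrite expr0n/=; rewrite integral0.
move=> H [afH Hmin].
have maf : measurable_fun setT ((a \*o f) : borel X -> R) by exact: measurable_funM.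
have fE : a^-1 \*o (a \*o f) = f by apply/funext => x /=; rewrite mulKf.
apply: (noH (`|a^-1| \*o H)); split.
  by rewrite -{1}fE; exact: weak_upper_gradientZ.
move=> G' fG'; have := Hmin _ (weak_upper_gradientZ a mf fG').
apply: filterS => x /=.
by rewrite normfV ler_pdivrMl// normr_gt0.
Qed.

Lemma S2_sqnorm_fin f : S2 m f -> sqnorm m mu f \is a fin_num.
Proof.
move=> [mf [G fG]]; have [LG G0 _] := fG.
rewrite ge0_fin_numE ?sqnorm_ge0//.
apply: le_lt_trans (sqnorm_le fG) _.
have mG2 : measurable_fun setT (fun x : borel X => (G x ^+ 2)%:E).
  by apply/measurable_EFinP; apply: measurable_funX; exact: Lfun2_measurable.
have /integrableP[_] := Lfun2_integrable_sqr LG.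
under eq_integral do rewrite /= ger0_norm ?sqr_ge0//.
move=> fin.
have C0 : 0 <= `|C| by [].
apply: (@le_lt_trans _ _ (\int[mscale (NngNum C0) m]_x (G x ^+ 2)%:E)%E).
  apply: ge0_le_measure_integral => //.
  - move=> S mS; apply: le_trans (muC mS) _; rewrite /mscale/=.
    by rewrite lee_wpmul2r// lee_fin ler_norm.
  - by move=> x; rewrite lee_fin sqr_ge0.
rewrite ge0_integral_mscale//; last by move=> x _; rewrite lee_fin sqr_ge0.
by rewrite lte_mul_pinfty// ?lee_fin.
Qed.

Lemma cst_weak_upper_gradient (c : R) : weak_upper_gradient m (cst c) (cst 0).
Proof.
split=> [|//|pi _].
  apply: Lfun2_of_integral => //.
  by under eq_integral do rewrite /= expr0n/=; rewrite integral0 ltry.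
apply: ge0_le_lower_integral => x _; first by rewrite lee_fin.
rewrite /= subrr normr0; apply: integral_ge0 => t _.
by rewrite mul0r.
Qed.

Lemma S2_cst (c : R) : S2 m (cst c).
Proof. by split=> //; exists (cst 0); exact: cst_weak_upper_gradient. Qed.

Lemma sqnorm_cst (c : R) : sqnorm m mu (cst c) = 0%E.
Proof.
apply/eqP; rewrite eq_le sqnorm_ge0 andbT.
apply: le_trans (sqnorm_le (cst_weak_upper_gradient c)) _.
by under eq_integral do rewrite /= expr0n/=; rewrite integral0.
Qed.

Variables (L : (X -> R) -> R) (k : R).
Hypothesis linL : S2_linear m L.
Hypothesis normL : dual_norm m mu L = k%:E.

Lemma S2_linear0 : L (cst 0) = 0.
Proof.
have := linL 1 (S2_cst 0) (S2_cst 0); rewrite mul1r.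
rewrite (_ : 1 \*o cst 0 \+ cst 0 = cst 0); last first.
  by apply/funext => x /=; rewrite mulr0 addr0.
by move/eqP; rewrite -subr_eq0 opprD addrA subrr sub0r oppr_eq0 => /eqP.
Qed.

Lemma S2_linearZ (a : R) f : S2 m f -> L (a \*o f) = a * L f.
Proof.
move=> Sf; have := linL a Sf (S2_cst 0); rewrite S2_linear0 addr0 => <-.
by congr L; apply/funext => x /=; rewrite addr0.
Qed.

Lemma S2_linearB f g : S2 m f -> S2 m g -> L (f \- g) = L f - L g.
Proof.
move=> Sf Sg; have := linL (-1) Sg Sf; rewrite mulN1r addrC => <-.
by congr L; apply/funext => x /=; rewrite mulN1r addrC.
Qed.

Lemma S2B f g : S2 m f -> S2 m g -> S2 m (f \- g).
Proof.
move=> Sf Sg; have -> : f \- g = f \+ ((-1) \*o g).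
  by apply/funext => x /=; rewrite mulN1r.
by apply: S2D => //; exact: S2Z.
Qed.

(** The supremum defining the dual norm is tested on the multiples [b f] with
    [b = a] and [b = - a]. Having [a] as a free parameter replaces the product of
    the two norms, and only an upper bound [s] of the seminorm enters. *)
Lemma dual_norm_bound f (a s : R) : S2 m f -> 0 < a ->
  (sqnorm m mu f <= s%:E)%E -> `|L f| <= k ^+ 2 / (2 * a) + a / 2 * s.
Proof.
move=> Sf a0 fs.
set T := [set ((L f)%:E - (2^-1)%:E * sqnorm m mu f)%E | f in S2 m].
have S0 : (0 <= ereal_sup T)%E.
  apply: ereal_sup_ubound; exists (cst 0); first exact: S2_cst.
  by rewrite S2_linear0 sqnorm_cst mule0 sube0.
have TE : (2%:E * ereal_sup T = (k ^+ 2)%:E)%E.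
  by rewrite EFin_expe -normL /dual_norm sqr_sqrte// mule_ge0.
have key b : b * L f <= k ^+ 2 / 2 + b ^+ 2 / 2 * s.
  have [mf wf] := Sf.
  have : ((b * L f)%:E - (2^-1)%:E * sqnorm m mu (b \*o f) <= (k ^+ 2 / 2)%:E)%E.
    rewrite -S2_linearZ// (_ : (k ^+ 2 / 2)%:E = ereal_sup T).
      by apply: ereal_sup_ubound; exists (b \*o f) => //; exact: S2Z.
    by rewrite mulrC EFinM -TE muleA -EFinM mulVf// mul1e.
  have Sbf := S2Z b Sf.
  rewrite -(fineK (S2_sqnorm_fin Sbf)) -EFinM -EFinB lee_fin.
  have : fine (sqnorm m mu (b \*o f)) <= b ^+ 2 * s.
    rewrite -lee_fin fineK ?S2_sqnorm_fin//.
    apply: le_trans (sqnorm_scale b mf wf) _.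
    by rewrite [(b ^+ 2 * s)%:E]EFinM lee_wpmul2l// lee_fin sqr_ge0.
  lra.
have <- : a^-1 * (k ^+ 2 / 2 + a ^+ 2 / 2 * s) = k ^+ 2 / (2 * a) + a / 2 * s.
  by field; rewrite gt_eqF.
have aL : a * `|L f| = `|a * L f| by rewrite normrM gtr0_norm.
rewrite ler_pdivlMl// aL ler_norml.
rewrite (key a) andbT lerNl -mulNr; have := key (- a); by rewrite sqrrN.
Qed.

Lemma dual_norm_cvg0 (u : nat -> X -> R) : (forall n, S2 m (u n)) ->
  (forall e : R, 0 < e -> exists n0, forall n, (n0 <= n)%N ->
     (sqnorm m mu (u n) <= e%:E)%E) ->
  L (u n) @[n --> \oo] --> (0 : R).
Proof.
move=> Su u0; apply/cvgrPdist_le => e e0.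
pose a := (k ^+ 2 + 1) / e.
have k1 : 0 < k ^+ 2 + 1 by rewrite ltr_wpDl ?sqr_ge0.
have a0 : 0 < a by rewrite divr_gt0.
have [|n0 hn] := u0 (e / a); first by rewrite divr_gt0.
exists n0 => // n /= n0n; rewrite sub0r normrN.
apply: le_trans (dual_norm_bound (Su n) a0 (hn _ n0n)) _.
have -> : a / 2 * (e / a) = e / 2 by field; rewrite gt_eqF.
have -> : k ^+ 2 / (2 * a) = e / 2 * (k ^+ 2 / (k ^+ 2 + 1)).
  by rewrite /a; field; rewrite !gt_eqF.
have : e / 2 * (k ^+ 2 / (k ^+ 2 + 1)) <= e / 2 * 1.
  by rewrite ler_pM2l ?divr_gt0// ler_pdivrMr// mul1r lerDl.
lra.
Qed.

Lemma dual_norm_cst (c : R) : L (cst c) = 0.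
Proof.
have h : L (cst c) @[n --> \oo] --> (0 : R).
  apply: (dual_norm_cvg0 (u := fun=> cst c)) => [_|e e0]; first exact: S2_cst.
  by exists 0%N => _ _; rewrite sqnorm_cst lee_fin ltW.
exact: (cvg_unique (@Rhausdorff R) (cvg_cst (L (cst c))) h).
Qed.

End MinimalGradient.

(** * Gluing couplings along a partition *)

Section SliceMeasures.
Local Open Scope ereal_scope.
Context (R : realType).

Lemma ge0_integral_mrestr d (T : measurableType d)
    (m : {measure set T -> \bar R}) (S : set T) (mS : measurable S)
    (h : T -> \bar R) : (forall x, 0 <= h x) -> measurable_fun setT h ->
  \int[mrestr m mS]_x h x = \int[m]_(x in S) h x.
Proof.
move=> h0 mh; have mSC := measurableC mS.
rewrite -{1}(setUv S) ge0_integral_setU ?setUv//; last first.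
  by apply/disj_set2P; rewrite setICr.
rewrite [X in _ + X](_ : _ = 0) ?adde0; last first.
  apply/eqP; rewrite eq_le integral_ge0// andbT.
  rewrite (eq_measure_integral mzero) ?integral_measure_zero// => A mA AS.
  change (m (A `&` S) = 0); by rewrite (disjoints_subset _ _).2 ?measure0.
apply: eq_measure_integral => A mA AS.
by change (m (A `&` S) = m A); rewrite setIidl.
Qed.

(** The distribution of [f] restricted to the event [S]. *)
Lemma slice_measure d d' (T1 : measurableType d) (T2 : measurableType d')
    (g : probability T1 R) (f : T1 -> T2) (S : set T1) :
  measurable_fun setT f -> measurable S ->
  exists alpha : {finite_measure set T2 -> \bar R},
    (forall A, alpha A = g (f @^-1` A `&` S)) /\
    (forall h, (forall y, 0 <= h y) -> measurable_fun setT h ->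
      \int[alpha]_y h y = \int[g]_(x in S) h (f x)).
Proof.
move=> mf mS.
have gS : g S < +oo by rewrite -ge0_fin_numE// fin_num_measure.
pose gr : {finite_measure set T1 -> \bar R} := mfrestr mS gS.
pose al0 : {measure set T2 -> \bar R} :=
  measure_function_pushforward__canonical__measure_function_Measure gr mf.
have fin : fin_num_fun al0.
  move=> A mA; rewrite /al0/= /pushforward fin_num_measure//.
  by rewrite -[X in measurable X]setTI; exact: (mf measurableT A mA).
pose al : {finite_measure set T2 -> \bar R} :=
  HB.pack (al0 : set T2 -> \bar R) (Measure.class al0) (Measure_isFinite.Build _ _ _ al0 fin).
exists al; split => // h h0 mh.
transitivity (\int[al0]_y h y) => //.
rewrite ge0_integral_pushforward//.
rewrite preimage_setT /gr /mfrestr.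
exact: (ge0_integral_mrestr _ _ (fun x => h0 (f x)) (measurableT_comp mh mf)).
Qed.

End SliceMeasures.

Section SeparableMetric.
Context (R : realType) (X : completeMetricType R).
Hypothesis X_separable : separable_space X.

Lemma dense_sequence : exists e : nat -> X,
  forall (x : X) (r : R), 0 < r -> exists k, mdist x (e k) < r.
Proof.
have [D cD dD] := X_separable.
have near (x : X) r : 0 < r -> exists2 y, D y & mdist x y < r.
  move=> r0; have [|y [xy Dy]] := dD (ball x r)^° _ (@open_interior _ _).
    exists x; apply: nbhs_singleton; apply: nbhs_interior.
    exact: nbhsx_ballx.
  exists y => //; have := interior_subset xy.
  by rewrite ballEmdist.
have [D0|[f]] := pfcard_geP cD.
  by have [y] := near point _ ltr01; rewrite D0.
exists f => x r r0; have [y Dy xy] := near x r r0.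
by have [k _ fk] := @surj _ _ _ _ f y Dy; exists k; rewrite fk.
Qed.

Lemma measurable_mdist_l (x : X) :
  measurable_fun setT (fun y : borel X => mdist (y : X) x : R).
Proof.
apply: (@continuous_borel_fun R X (fun y => mdist y x)).
apply: continuous_mdist; [by move=> ?; exact: cvg_id|exact: cst_continuous].
Qed.

(** The Borel sets of a product contain the product sigma-algebra only; that the
    distance is measurable for the latter uses separability, through
    [d(x, y) = inf_k (d(x, e_k) + d(y, e_k))]. *)
Lemma measurable_mdist :
  measurable_fun setT (fun z : borel X * borel X => mdist (z.1 : X) (z.2 : X) : R).
Proof.
have [e eP] := dense_sequence.
pose f k (z : borel X * borel X) : R := mdist (z.1 : X) (e k) + mdist (z.2 : X) (e k).
have mf k : measurable_fun setT (f k).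
  apply: measurable_funD.
    exact: (measurableT_comp (measurable_mdist_l (e k)) (@measurable_fst _ _ (borel X) (borel X))).
  exact: (measurableT_comp (measurable_mdist_l (e k)) (@measurable_snd _ _ (borel X) (borel X))).
apply/measurable_EFinP.
rewrite (_ : _ \o _ = (fun z => einfs (fun k => (f k z)%:E) 0%N)).
  by apply: measurable_fun_einfs => k; apply/measurable_EFinP.
apply/funext => -[x y]; rewrite /einfs/= /sdrop.
apply/eqP; rewrite eq_le; apply/andP; split.
  apply: le_ereal_inf_tmp => _ [k _ <-]; rewrite lee_fin /f/=.
  by rewrite [mdist y (e k)]metric_sym; exact: metric_triangle.
apply/lee_addgt0Pr => r r0.
have r20 : 0 < r / 2 by rewrite divr_gt0.
have [k hk] := eP y _ r20.
apply: (@le_trans _ _ (f k (x, y))%:E).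
  by apply: ereal_inf_lbound; exists k.
rewrite -EFinD lee_fin /f/=; have := metric_triangle x y (e k); lra.
Qed.

Lemma borel_ball (x : X) (r : R) : measurable (ball x r : set (borel X)).
Proof.
rewrite ballEmdist (_ : mkset _ = (fun y => mdist y x) @^-1` [set s | s < r]).
  rewrite -[X in measurable X]setTI; apply: (measurable_mdist_l x) => //.
  by apply: open_measurable; exact: open_lt.
by apply/seteqP; split => y /=; rewrite metric_sym.
Qed.

Lemma small_partition (r : R) : 0 < r -> exists (A : nat -> set (borel X)) (e : nat -> X),
  [/\ forall k, measurable (A k), trivIset setT A, \bigcup_k A k = setT &
      forall k x, A k x -> mdist x (e k) < r].
Proof.
move=> r0; have [e eP] := dense_sequence.
pose B k : set (borel X) := ball (e k) r.
have mB k : measurable (B k) by exact: borel_ball.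
exists (seqDU B), e; split.
- by apply: seqDU_measurable.
- exact: trivIset_seqDU.
- rewrite -seqDU_bigcup_eq; apply/seteqP; split => // x _.
  have [k xk] := eP x r r0; exists k => //.
  by rewrite /B ballEmdist/= metric_sym.
- by move=> k x [+ _]; rewrite /B ballEmdist/= metric_sym.
Qed.

End SeparableMetric.

Lemma measure_probability d (T : measurableType d) (R : realType)
    (m : {measure set T -> \bar R}) : m setT = 1%E ->
  exists P : probability T R, forall A, P A = m A.
Proof.
move=> m1; pose m' := mrestr m measurableT.
have m'1 : m' setT = 1%E by rewrite /m' /mrestr setIT.
pose P : probability T R := HB.pack (m' : set T -> \bar R) (Measure.class m')
  (Measure_isProbability.Build _ _ _ m' m'1).
by exists P => A; change (m (A `&` setT) = m A); rewrite setIT.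
Qed.

Section Gluing.
Context (R : realType) (X : completeMetricType R).
Hypothesis X_separable : separable_space X.
Implicit Types (mu nu sg : probability (borel X) R).
Local Notation XX := (borel X * borel X)%type.

Lemma measurable_cost (a : R) :
  measurable_fun setT (fun z : XX => ((mdist (z.1 : X) (z.2 : X) + a) ^+ 2)%:E).
Proof.
apply/measurable_EFinP; apply: measurable_funX; apply: measurable_funD => //.
exact: measurable_mdist.
Qed.

Lemma measurable_dist2 (x : X) :
  measurable_fun setT (fun y : borel X => (mdist (y : X) x ^+ 2)%:E).
Proof.
by apply/measurable_EFinP; apply: measurable_funX; exact: measurable_mdist_l.
Qed.

Lemma sqr_add_le (a x y z : R) : 0 < a -> 0 <= x <= y + z ->
  x ^+ 2 <= (1 + a) * y ^+ 2 + (1 + a^-1) * z ^+ 2.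
Proof.
move=> a0 /andP[x0 xyz].
have : x ^+ 2 <= (y + z) ^+ 2 by rewrite ler_sqr ?nnegrE// (le_trans x0).
have -> : (1 + a) * y ^+ 2 + (1 + a^-1) * z ^+ 2 =
  (y + z) ^+ 2 + a^-1 * (a * y - z) ^+ 2 by field; rewrite gt_eqF.
move=> h; apply: le_trans h _; rewrite lerDl mulr_ge0 ?sqr_ge0//.
by rewrite invr_ge0 ltW.
Qed.

(** Young's inequality applied to d(x, y) <= d(x, e) + d(y, e). *)
Lemma split_cost (alpha beta : {finite_measure set (borel X) -> \bar R}) (e : X) (a : R) :
  0 < a ->
  (\int[alpha \x beta]_z (mdist (z.1 : X) (z.2 : X) ^+ 2)%:E <=
   (1 + a)%:E * (beta setT * \int[alpha]_x (mdist (x : X) e ^+ 2)%:E) +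
   (1 + a^-1)%:E * (alpha setT * \int[beta]_y (mdist (y : X) e ^+ 2)%:E))%E.
Proof.
move=> a0.
have mc : measurable_fun setT (fun z : XX => (mdist (z.1 : X) (z.2 : X) ^+ 2)%:E).
  by apply/measurable_EFinP; apply: measurable_funX; exact: measurable_mdist.
have a1 : 0 <= 1 + a by rewrite addr_ge0// ltW.
have a2 : 0 <= 1 + a^-1 by rewrite addr_ge0// invr_ge0 ltW.
rewrite fubini_tonelli1//; last by move=> z; rewrite lee_fin sqr_ge0.
apply: (@le_trans _ _ (\int[alpha]_x
    (((1 + a) * mdist (x : X) e ^+ 2)%:E * beta setT +
     (1 + a^-1)%:E * \int[beta]_y (mdist (y : X) e ^+ 2)%:E))%E).
  apply: ge0_le_lower_integral => x _.
    by apply: integral_ge0 => y _; rewrite lee_fin sqr_ge0.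
  rewrite /fubini_F/=.
  apply: (@le_trans _ _ (\int[beta]_y (((1 + a) * mdist (x : X) e ^+ 2)%:E +
     (1 + a^-1)%:E * (mdist (y : X) e ^+ 2)%:E))%E).
    apply: ge0_le_lower_integral => y _; first by rewrite lee_fin sqr_ge0.
    rewrite -EFinM -EFinD lee_fin; apply: sqr_add_le => //.
    by rewrite mdist_ge0/= [mdist y e]metric_sym metric_triangle.
  rewrite ge0_integralD//; last 3 first.
  - by move=> y _; rewrite lee_fin mulr_ge0// sqr_ge0.
  - by move=> y _; rewrite -EFinM lee_fin mulr_ge0// sqr_ge0.
  - by apply: emeasurable_funM => //; exact: measurable_dist2.
  rewrite integral_cst// ge0_integralZl//; last 2 first.
  - exact: measurable_dist2.
  - by move=> y _; rewrite lee_fin sqr_ge0.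
rewrite ge0_integralD//; last 3 first.
- by move=> y _; rewrite mule_ge0// lee_fin mulr_ge0// sqr_ge0.
- apply: emeasurable_funM => //.
  under eq_fun do rewrite EFinM.
  by apply: emeasurable_funM => //; exact: measurable_dist2.
- move=> y _; rewrite mule_ge0 ?lee_fin//; apply: integral_ge0 => z _.
  by rewrite lee_fin sqr_ge0.
rewrite integral_cst// -muleA [X in (_ * X)%E]muleC.
rewrite leeD2r//.
under eq_integral do rewrite EFinM muleAC.
rewrite ge0_integralZl//; last 3 first.
- exact: measurable_dist2.
- by move=> y _; rewrite lee_fin sqr_ge0.
- by rewrite mule_ge0.
by rewrite muleA.
Qed.

(** Couplings of [mu] with [sg] and of [sg] with [nu] are glued along a partition
    of the space into cells of radius [r]: given the cell of the midpoint, its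
    two neighbours are drawn independently. The triangle inequality through the
    centre of the cell separates the cost. *)
Lemma approximate_gluing mu nu sg (g1 g2 : probability XX R) (a r : R) :
  0 < a -> 0 < r -> coupling mu sg g1 -> coupling sg nu g2 ->
  exists2 g : probability XX R, coupling mu nu g &
    (\int[g]_z (mdist (z.1 : X) (z.2 : X) ^+ 2)%:E <=
     (1 + a)%:E * \int[g1]_z ((mdist (z.1 : X) (z.2 : X) + r) ^+ 2)%:E +
     (1 + a^-1)%:E * \int[g2]_z ((mdist (z.1 : X) (z.2 : X) + r) ^+ 2)%:E)%E.
Proof.
move=> a0 r0 g1P g2P.
have [A [e [mA tA UA Ae]]] := small_partition X_separable r0.
have m1 := @measurable_fst _ _ (borel X) (borel X).
have m2 := @measurable_snd _ _ (borel X) (borel X).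
have mS1 k : measurable (snd @^-1` (A k) : set XX).
  by rewrite -[X in measurable X]setTI; exact: m2.
have mS2 k : measurable (fst @^-1` (A k) : set XX).
  by rewrite -[X in measurable X]setTI; exact: m1.
have tS1 : trivIset setT (fun k => snd @^-1` (A k) : set XX).
  by move=> i j _ _ [z [zi zj]]; apply: tA => //; exists z.2.
have tS2 : trivIset setT (fun k => fst @^-1` (A k) : set XX).
  by move=> i j _ _ [z [zi zj]]; apply: tA => //; exists z.1.
have /choice[al alP] := fun k => slice_measure g1 m1 (mS1 k).
have /choice[be beP] := fun k => slice_measure g2 m2 (mS2 k).
have alT k : al k setT = sg (A k).
  by rewrite (alP k).1 preimage_setT setTI; have [_ <-] := g1P (A k) (mA k).
have beT k : be k setT = sg (A k).
  by rewrite (beP k).1 preimage_setT setTI; have [<- _] := g2P (A k) (mA k).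
(* The restrictions of the couplings to a cell both have the mass s k of the
   cell; their product is divided by it, which is harmless for cells of mass 0. *)
pose s k : R := fine (sg (A k)).
have sE k : sg (A k) = (s k)%:E by rewrite fineK// fin_num_measure.
have s0 k : 0 <= s k by rewrite fine_ge0.
have sV0 k : 0 <= (s k)^-1 by rewrite invr_ge0.
pose ga := mseries (fun k => mscale (NngNum (sV0 k)) (al k \x be k)%E) 0.
have cancelE k (x : \bar R) : (0 <= x)%E -> (x <= (s k)%:E)%E ->
    ((s k)^-1%:E * (x * (s k)%:E) = x)%E.
  move=> x0 xs; have [sk0|sk0] := eqVneq (s k) 0.
    have -> : x = 0%E by apply/eqP; rewrite eq_le x0 andbT; move: xs; rewrite sk0.
    by rewrite mul0e mule0.
  by rewrite muleCA -EFinM mulVf// mule1.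
have al_le k B : measurable B -> (al k B <= (s k)%:E)%E.
  by move=> mB; rewrite -sE -alT; apply: le_measure; rewrite ?inE.
have be_le k B : measurable B -> (be k B <= (s k)%:E)%E.
  by move=> mB; rewrite -sE -beT; apply: le_measure; rewrite ?inE.
have gaX B C : measurable B -> measurable C ->
    ga (B `*` C) = (\sum_(0 <= k <oo) (s k)^-1%:E * (al k B * be k C))%E.
  move=> mB mC; rewrite /ga/= /mseries; apply: eq_eseriesr => k _.
  by rewrite /mscale/= -product_measure1E.
have ga1 B : measurable B -> ga (B `*` setT) = mu B.
  move=> mB; rewrite gaX//.
  transitivity (\sum_(0 <= k <oo) g1 (fst @^-1` B `&` snd @^-1` (A k)))%E.
    by apply: eq_eseriesr => k _; rewrite beT sE cancelE ?al_le// (alP k).1.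
  have [<- _] := g1P B mB.
  have mB1 : measurable (fst @^-1` B : set XX).
    by rewrite -[X in measurable X]setTI; exact: m1.
  rewrite -measure_semi_bigcup.
  - by rewrite -setI_bigcupr -preimage_bigcup UA preimage_setT setIT.
  - by move=> k; exact: measurableI.
  - exact: trivIset_setIl.
  - by apply: bigcup_measurable => k _; exact: measurableI.
have ga2 C : measurable C -> ga (setT `*` C) = nu C.
  move=> mC; rewrite gaX//.
  transitivity (\sum_(0 <= k <oo) g2 (snd @^-1` C `&` fst @^-1` (A k)))%E.
    by apply: eq_eseriesr => k _; rewrite alT sE [X in (_ * X)%E]muleC cancelE ?be_le// (beP k).1.
  have [_ <-] := g2P C mC.
  have mC1 : measurable (snd @^-1` C : set XX).
    by rewrite -[X in measurable X]setTI; exact: m2.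
  rewrite -measure_semi_bigcup.
  - by rewrite -setI_bigcupr -preimage_bigcup UA preimage_setT setIT.
  - by move=> k; exact: measurableI.
  - exact: trivIset_setIl.
  - by apply: bigcup_measurable => k _; exact: measurableI.
have gaT : ga setT = 1%E by rewrite -setXTT ga1// probability_setT.
have [g gE] := measure_probability gaT.
exists g.
  move=> B mB; split.
    apply: etrans (ga1 B mB); apply: etrans (gE _) _.
    by apply: (congr1 ga); apply/seteqP; split => z //=; case.
  apply: etrans (ga2 B mB); apply: etrans (gE _) _.
  by apply: (congr1 ga); apply/seteqP; split => z //=; case.
rewrite (eq_measure_integral ga); last by move=> B _ _; exact: gE.
have mc : measurable_fun setT (fun z : XX => (mdist (z.1 : X) (z.2 : X) ^+ 2)%:E).
  by apply/measurable_EFinP; apply: measurable_funX; exact: measurable_mdist.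
have mcr := measurable_cost r.
have cost0 (z : XX) : (0 <= (mdist (z.1 : X) (z.2 : X) ^+ 2)%:E)%E.
  by rewrite lee_fin sqr_ge0.
have costr0 (z : XX) : (0 <= ((mdist (z.1 : X) (z.2 : X) + r) ^+ 2)%:E)%E.
  by rewrite lee_fin sqr_ge0.
have a1 : (0 <= (1 + a)%:E :> \bar R)%E by rewrite lee_fin addr_ge0// ltW.
have a2 : (0 <= (1 + a^-1)%:E :> \bar R)%E by rewrite lee_fin addr_ge0// invr_ge0 ltW.
have mT1 : measurable (\bigcup_k (snd @^-1` (A k) : set XX)).
  exact: bigcup_measurable.
have mT2 : measurable (\bigcup_k (fst @^-1` (A k) : set XX)).
  exact: bigcup_measurable.
have J1 : (\int[g1]_z ((mdist (z.1 : X) (z.2 : X) + r) ^+ 2)%:E =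
    \sum_(0 <= k <oo) \int[g1]_(z in snd @^-1` (A k))
      ((mdist (z.1 : X) (z.2 : X) + r) ^+ 2)%:E)%E.
  rewrite -(_ : \bigcup_k (snd @^-1` (A k) : set XX) = setT); last first.
    by rewrite -preimage_bigcup UA preimage_setT.
  rewrite ge0_integral_bigcup//.
  - exact: measurable_funTS.
have J2 : (\int[g2]_z ((mdist (z.1 : X) (z.2 : X) + r) ^+ 2)%:E =
    \sum_(0 <= k <oo) \int[g2]_(z in fst @^-1` (A k))
      ((mdist (z.1 : X) (z.2 : X) + r) ^+ 2)%:E)%E.
  rewrite -(_ : \bigcup_k (fst @^-1` (A k) : set XX) = setT); last first.
    by rewrite -preimage_bigcup UA preimage_setT.
  rewrite ge0_integral_bigcup//.
  - exact: measurable_funTS.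
have int0 (p : {measure set XX -> \bar R}) (D : set XX) :
    (0 <= \int[p]_(z in D) ((mdist (z.1 : X) (z.2 : X) + r) ^+ 2)%:E)%E.
  by apply: integral_ge0.
rewrite J1 J2 -!nneseriesZl//.
rewrite -nneseriesD//; last 2 first.
- by move=> k _ _; rewrite mule_ge0.
- by move=> k _ _; rewrite mule_ge0.
rewrite (ge0_integral_measure_series _ measurableT)//.
apply: lee_nneseries => [k _ _|k _]; first exact: integral_ge0.
rewrite ge0_integral_mscale//=.
have I0 (p : {finite_measure set (borel X) -> \bar R}) :
    (0 <= \int[p]_x (mdist (x : X) (e k) ^+ 2)%:E)%E.
  by apply: integral_ge0 => x _; rewrite lee_fin sqr_ge0.
have cancelM (b x y : \bar R) : (0 <= b)%E -> (0 <= x)%E -> (x <= y)%E ->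
    ((s k)^-1%:E * (b * ((s k)%:E * x)) <= b * y)%E.
  move=> b0 x0 xy; rewrite muleCA lee_wpmul2l// muleA -EFinM.
  have [->|sk0] := eqVneq (s k) 0; first by rewrite mulr0 mul0e (le_trans x0).
  by rewrite mulVf// mul1e.
apply: (@le_trans _ _ ((s k)^-1%:E *
  ((1 + a)%:E * ((s k)%:E * \int[al k]_x (mdist (x : X) (e k) ^+ 2)%:E) +
   (1 + a^-1)%:E * ((s k)%:E * \int[be k]_y (mdist (y : X) (e k) ^+ 2)%:E)))%E).
  rewrite lee_wpmul2l ?lee_fin//.
  by apply: le_trans (split_cost (al k) (be k) (e k) a0) _; rewrite alT beT sE.
rewrite ge0_muleDr; last 2 first.
- by rewrite !mule_ge0// lee_fin.
- by rewrite !mule_ge0// lee_fin.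
have le_cell x y : mdist y (e k) < r ->
    ((mdist x (e k) ^+ 2)%:E <= ((mdist x y + r) ^+ 2)%:E :> \bar R)%E.
  move=> yr; rewrite lee_fin ler_sqr ?nnegrE ?mdist_ge0//; last first.
    by rewrite addr_ge0 ?mdist_ge0// ltW.
  by apply: le_trans (metric_triangle _ y _) _; rewrite lerD2l ltW.
apply: leeD; apply: cancelM => //.
- rewrite (alP k).2//; last 2 first.
  + by move=> y; rewrite lee_fin sqr_ge0.
  + exact: measurable_dist2.
  apply: ge0_le_lower_integral => z Az; first by rewrite lee_fin sqr_ge0.
  by apply: le_cell; exact: Ae Az.
- rewrite (beP k).2//; last 2 first.
  + by move=> y; rewrite lee_fin sqr_ge0.
  + exact: measurable_dist2.
  apply: ge0_le_lower_integral => z Az; first by rewrite lee_fin sqr_ge0.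
  by rewrite [mdist z.1 _]metric_sym; apply: le_cell; exact: Ae Az.
Qed.

End Gluing.

(** * The quadratic transportation distance *)

Section Wasserstein.
Context (R : realType) (X : completeMetricType R).
Hypothesis X_separable : separable_space X.
Implicit Types (mu nu sg : probability (borel X) R).
Local Notation XX := (borel X * borel X)%type.
Local Notation leb := (@lebesgue_measure R).

Definition cost (g : probability XX R) : \bar R :=
  (\int[g]_z (mdist (z.1 : X) (z.2 : X) ^+ 2)%:E)%E.

Lemma cost_ge0 g : (0 <= cost g)%E.
Proof. by apply: integral_ge0 => z _; rewrite lee_fin sqr_ge0. Qed.

Lemma W2sq_ge0 mu nu : (0 <= W2sq mu nu)%E.
Proof. by apply: le_ereal_inf_tmp => _ [g _ <-]; exact: cost_ge0. Qed.

Lemma W2sq_le mu nu g : coupling mu nu g -> (W2sq mu nu <= cost g)%E.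
Proof. by move=> gP; apply: ereal_inf_lbound; exists g. Qed.

Lemma W2_sqr mu nu : W2 mu nu ^+ 2 = fine (W2sq mu nu).
Proof. by rewrite sqr_sqrtr// fine_ge0// W2sq_ge0. Qed.

Lemma W2_ge0 mu nu : 0 <= W2 mu nu.
Proof. exact: sqrtr_ge0. Qed.

Lemma integral_cst_probability d (T : measurableType d) (p : probability T R) (k : R) :
  (\int[p]_x k%:E = k%:E)%E.
Proof. by rewrite integral_cst// [X in (_ * X)%E](probability_setT p) mule1. Qed.

Lemma pushforward_probability d d' (T1 : measurableType d) (T2 : measurableType d')
    (g : probability T1 R) (f : T1 -> T2) : measurable_fun setT f ->
  exists p : probability T2 R, (forall A, p A = g (f @^-1` A)) /\
    (forall h, (forall y, (0 <= h y)%E) -> measurable_fun setT h ->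
      (\int[p]_y h y = \int[g]_x h (f x))%E).
Proof.
move=> mf; have [al [alE ali]] := slice_measure g mf measurableT.
have alT : al setT = 1%E by rewrite alE preimage_setT setIT probability_setT.
have [p pE] := measure_probability alT.
exists p; split=> [A|h h0 mh]; first by apply: etrans (pE A) _; apply: etrans (alE A) _; rewrite setIT.
apply: etrans (ali _ h0 mh); apply: eq_measure_integral => A _ _; exact: pE.
Qed.

Lemma measurable_sqdist :
  measurable_fun setT (fun z : XX => (mdist (z.1 : X) (z.2 : X) ^+ 2)%:E).
Proof. by apply/measurable_EFinP; apply: measurable_funX; exact: measurable_mdist. Qed.

Lemma W2sq_sym mu nu : W2sq mu nu = W2sq nu mu.
Proof.
suff le mu' nu' : (W2sq mu' nu' <= W2sq nu' mu')%E.
  by apply/eqP; rewrite eq_le !le.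
apply: le_ereal_inf_tmp => _ [g gP <-].
have mswap : measurable_fun setT (fun z : XX => (z.2, z.1) : XX).
  by apply: measurable_fun_pair; [exact: measurable_snd|exact: measurable_fst].
have [p [pE pint]] := pushforward_probability g mswap.
have pP : coupling mu' nu' p.
  move=> A mA; have [g1 g2] := gP A mA; split.
    by rewrite /pushforward pE -g2.
  by rewrite /pushforward pE -g1.
apply: le_trans (W2sq_le pP) _; rewrite /cost pint//.
- by under eq_integral do rewrite /= metric_sym.
- by move=> z; rewrite lee_fin sqr_ge0.
- exact: measurable_sqdist.
Qed.

Lemma W2_sym mu nu : W2 mu nu = W2 nu mu.
Proof. by rewrite /W2 W2sq_sym. Qed.

Lemma second_moment_lty mu (e : X) : finite_second_moment mu ->
  (\int[mu]_x (mdist (x : X) e ^+ 2)%:E < +oo)%E.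
Proof.
move=> [x0 fin].
apply: (@le_lt_trans _ _ (\int[mu]_x
   ((2 * mdist (x : X) x0 ^+ 2)%:E + (2 * mdist x0 e ^+ 2)%:E))%E).
  apply: ge0_le_lower_integral => x _; first by rewrite lee_fin sqr_ge0.
  rewrite -EFinD lee_fin.
  have := @sqr_add_le _ 1 (mdist (x : X) e) (mdist (x : X) x0) (mdist x0 e) ltr01.
  by rewrite invr1; apply; rewrite mdist_ge0 metric_triangle.
under eq_integral do rewrite EFinM.
have m2 := measurable_dist2 x0.
rewrite ge0_integralD//; last 3 first.
- by move=> x _; rewrite -EFinM lee_fin mulr_ge0// sqr_ge0.
- by apply: emeasurable_funM.
- by move=> x _; rewrite lee_fin mulr_ge0// sqr_ge0.
rewrite ge0_integralZl//; last by move=> x _; rewrite lee_fin sqr_ge0.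
rewrite integral_cst_probability.
by rewrite lte_add_pinfty ?ltry// lte_mul_pinfty.
Qed.

Lemma W2sq_lty mu nu : finite_second_moment mu -> finite_second_moment nu ->
  (W2sq mu nu < +oo)%E.
Proof.
move=> fmu fnu.
have prodT : (mu \x nu)%E setT = 1%E.
  rewrite -setXTT product_measure1E// [X in (X * _)%E](probability_setT mu).
  by rewrite [X in (_ * X)%E](probability_setT nu) mule1.
have [g gE] := measure_probability prodT.
have gP : coupling mu nu g.
  move=> A mA; split.
    apply: etrans (gE _) _.
    have -> : (fst @^-1` A : set XX) = A `*` setT.
      by apply/seteqP; split => z //=; case.
    apply: etrans (product_measure1E _ _ _ _) _ => //.
    by rewrite [X in (_ * X)%E](probability_setT nu) mule1.
  apply: etrans (gE _) _.
  have -> : (snd @^-1` A : set XX) = setT `*` A.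
    by apply/seteqP; split => z //=; case.
  apply: etrans (product_measure1E _ _ _ _) _ => //.
  by rewrite [X in (X * _)%E](probability_setT mu) mul1e.
apply: le_lt_trans (W2sq_le gP) _.
have [x0 _] := fmu.
rewrite /cost (eq_measure_integral (mu \x nu)%E); last by move=> B _ _; exact: gE.
apply: le_lt_trans (split_cost X_separable mu nu x0 ltr01) _.
rewrite [X in (_ * (X * _) + _)%E](probability_setT nu).
rewrite [X in (_ + _ * (X * _))%E](probability_setT mu) !mul1e invr1.
by rewrite lte_add_pinfty// lte_mul_pinfty// ?second_moment_lty// lee_fin.
Qed.

Lemma W2sqE mu nu : finite_second_moment mu -> finite_second_moment nu ->
  W2sq mu nu = (W2 mu nu ^+ 2)%:E.
Proof.
move=> fmu fnu; rewrite W2_sqr fineK// ge0_fin_numE ?W2sq_ge0//.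
exact: W2sq_lty.
Qed.

Lemma near_optimal_coupling mu nu (e : R) : finite_second_moment mu ->
  finite_second_moment nu -> 0 < e ->
  exists2 g, coupling mu nu g & (cost g <= (W2 mu nu ^+ 2 + e)%:E)%E.
Proof.
move=> fmu fnu e0.
have fin : W2sq mu nu \is a fin_num by rewrite W2sqE.
have [_ [g gP <-] glt] := lb_ereal_inf_adherent e0 fin.
by exists g => //; rewrite EFinD -W2sqE//; exact: ltW.
Qed.

(** The infimum over [a] of the right-hand side is the square of the sum of the
    two distances. The errors of the approximate gluing and of the nearly optimal
    couplings vanish for each fixed [a]. *)
Lemma W2_triangle mu nu sg (a : R) : 0 < a ->
  finite_second_moment mu -> finite_second_moment nu -> finite_second_moment sg ->
  W2 mu nu ^+ 2 <= (1 + a) * W2 mu sg ^+ 2 + (1 + a^-1) * W2 sg nu ^+ 2.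
Proof.
move=> a0 fmu fnu fsg; apply/ler_addgt0Pr => e e0.
have a1 : 0 <= 1 + a by rewrite addr_ge0// ltW.
have a2 : 0 <= 1 + a^-1 by rewrite addr_ge0// invr_ge0 ltW.
set P := W2 mu sg ^+ 2; set Q := W2 sg nu ^+ 2.
have P0 : 0 <= P by exact: sqr_ge0.
have Q0 : 0 <= Q by exact: sqr_ge0.
pose K := (1 + a) * (P + 4) + (1 + a^-1) * (Q + 4).
have K0 : 0 < K.
  have P4 : 0 < P + 4 by rewrite ltr_wpDl.
  have Q4 : 0 < Q + 4 by rewrite ltr_wpDl.
  have b1 : 0 < 1 + a by rewrite addr_gt0.
  have b2 : 0 < 1 + a^-1 by rewrite addr_gt0 ?invr_gt0.
  by apply: addr_gt0; exact: mulr_gt0.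
pose r := Num.min 1 (e / K).
have r0 : 0 < r by rewrite lt_min ltr01 divr_gt0.
have r1 : r <= 1 by rewrite ge_min lexx.
have rK : r * K <= e by rewrite -ler_pdivlMr// ge_min lexx orbT.
have [g1 g1P c1] := near_optimal_coupling fmu fsg r0.
have [g2 g2P c2] := near_optimal_coupling fsg fnu r0.
have [g gP gle] := approximate_gluing X_separable a0 r0 g1P g2P.
have cr (p : probability XX R) (s : R) : 0 <= s -> (cost p <= (s + r)%:E)%E ->
    (\int[p]_z ((mdist (z.1 : X) (z.2 : X) + r) ^+ 2)%:E <= (s + r * (s + 4))%:E)%E.
  move=> s0 ps.
  apply: (@le_trans _ _ (\int[p]_z ((1 + r)%:E * (mdist (z.1 : X) (z.2 : X) ^+ 2)%:E
     + (r + r ^+ 2)%:E))%E).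
    apply: ge0_le_lower_integral => z _; first by rewrite lee_fin sqr_ge0.
    rewrite -EFinM -EFinD lee_fin.
    have := @sqr_add_le _ r (mdist z.1 z.2 + r) (mdist z.1 z.2) r r0.
    rewrite lexx andbT addr_ge0 ?mdist_ge0 ?(ltW r0)// => /(_ isT).
    by have -> : (1 + r^-1) * r ^+ 2 = r + r ^+ 2 by field; rewrite gt_eqF.
  rewrite ge0_integralD//; last 3 first.
  - by move=> z _; rewrite -EFinM lee_fin mulr_ge0 ?sqr_ge0// addr_ge0// ltW.
  - by apply: emeasurable_funM => //; exact: measurable_sqdist.
  - by move=> z _; rewrite lee_fin addr_ge0 ?sqr_ge0// ltW.
  rewrite ge0_integralZl//; last 3 first.
  - exact: measurable_sqdist.
  - by move=> z _; rewrite lee_fin sqr_ge0.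
  - by rewrite lee_fin addr_ge0// ltW.
  rewrite integral_cst_probability.
  apply: (@le_trans _ _ ((1 + r)%:E * (s + r)%:E + (r + r ^+ 2)%:E)%E).
    by rewrite leeD2r// lee_wpmul2l// lee_fin addr_ge0// ltW.
  rewrite -EFinM -EFinD lee_fin.
  have : r * r <= r by rewrite ler_piMl// ltW.
  rewrite expr2; lra.
have : (W2sq mu nu <= ((1 + a) * (P + r * (P + 4)) + (1 + a^-1) * (Q + r * (Q + 4)))%:E)%E.
  apply: le_trans (W2sq_le gP) _; apply: le_trans gle _.
  rewrite [leRHS]EFinD; apply: leeD; rewrite [leRHS]EFinM.
    by apply: lee_wpmul2l; rewrite ?lee_fin//; exact: cr.
  by apply: lee_wpmul2l; rewrite ?lee_fin//; exact: cr.
rewrite W2sqE// lee_fin => h; apply: le_trans h _.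
move: rK; rewrite /K; lra.
Qed.

(** The triangle inequality with parameter [a = W2 mu sg], and a limit of [a] to 0
    when this is zero. *)
Lemma W2_increment mu nu sg : finite_second_moment mu ->
  finite_second_moment nu -> finite_second_moment sg ->
  W2 mu nu ^+ 2 - W2 sg nu ^+ 2 <=
  W2 mu sg * (W2 sg nu ^+ 2 + W2 mu sg + 1).
Proof.
move=> fmu fnu fsg.
have tri a : 0 < a -> W2 mu nu ^+ 2 <= (1 + a) * W2 sg nu ^+ 2 + (1 + a^-1) * W2 mu sg ^+ 2.
  by move=> a0; rewrite W2_sym (W2_sym sg) (W2_sym mu); exact: W2_triangle.
have := W2_ge0 mu sg; rewrite le_eqVlt => /predU1P[D0|D0].
  rewrite -D0 mul0r subr_le0; apply/ler_addgt0Pr => e e0.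
  have P0 : 0 <= W2 sg nu ^+ 2 := sqr_ge0 _.
  have P1 : 0 < W2 sg nu ^+ 2 + 1 by rewrite ltr_wpDl.
  have := tri (e / (W2 sg nu ^+ 2 + 1)); rewrite divr_gt0// => /(_ isT).
  rewrite -D0 expr0n mulr0 addr0 => h; apply: le_trans h _.
  rewrite mulrDl mul1r lerD2l mulrAC ler_pdivrMr// ler_pM2l// lerDl//.
have := tri _ D0; set D := W2 mu sg; set P := W2 sg nu ^+ 2 => h.
rewrite lerBlDr; apply: le_trans h _.
have -> : (1 + D^-1) * D ^+ 2 = D * (D + 1) by field; rewrite gt_eqF.
lra.
Qed.

Lemma abs_cont21 (Y : Type) (d : Y -> Y -> R) (c : R -> Y) :
  abs_cont d 2 c -> abs_cont d 1 c.
Proof.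
move=> [g [mg ig dg]]; exists g; split => //.
apply: (@le_lt_trans _ _ (\int[leb]_(r in `[0%R, 1%R]) (1 + (`|g r| ^+ 2)%:E))%E).
  apply: ge0_le_lower_integral => r _; first by rewrite lee_fin.
  rewrite -EFinD lee_fin expr1; have := sqr_ge0 (`|g r| - 1).
  by rewrite sqrrB1; have := normr_ge0 (g r); lra.
rewrite ge0_integralD//.
- rewrite integral_cst// mul1e lte_add_pinfty//.
  by rewrite [X in (X < _)%E]lebesgue_measure_itv/= lte_fin ltr01 -EFinD ltry.
- by apply/measurable_EFinP; apply: measurable_funX; exact: measurableT_comp.
Qed.

Lemma W2_abs_cont (mu : R -> probability (borel X) R) nu :
  (forall t : R, 0 <= t <= 1 -> finite_second_moment (mu t)) ->
  finite_second_moment nu -> abs_cont (@W2 R X) 2 mu ->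
  abs_cont (@rdist R) 1 (fun t : R => 2^-1 * W2 (mu t) nu ^+ 2).
Proof.
move=> fmu fnu /abs_cont21/abs_cont_dominated[g [ig g0 mug]].
pose M := \int[leb]_(r in `[0, 1]) g r.
have M0 : 0 <= M by rewrite Rintegral_ge0.
have itvM a b : 0 <= a -> a <= b -> b <= 1 -> \int[leb]_(r in `[a, b]) g r <= M.
  move=> a0 ab b1; rewrite /M -!primitiveB//.
  by apply: lerB; apply: primitive_homo.
have f0 : finite_second_moment (mu 0) by apply: fmu; rewrite lexx ler01.
have W2_refl0 t : 0 <= t <= 1 -> W2 (mu t) (mu 0) <= M + W2 (mu 0) (mu 0).
  move=> /andP[]; rewrite le_eqVlt => /predU1P[<- _|t0 t1]; first by rewrite lerDr.
  by apply: le_trans (mug _ _ (lexx _) t0 t1) _; rewrite -[leLHS]addr0 lerD ?itvM ?W2_ge0// ltW.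
pose M' := M + W2 (mu 0) (mu 0).
pose Q := 2 * M' ^+ 2 + 2 * W2 (mu 0) nu ^+ 2.
have WQ t : 0 <= t <= 1 -> W2 (mu t) nu ^+ 2 <= Q.
  move=> t01; have ft := fmu _ t01.
  have := @W2_triangle (mu t) nu (mu 0) 1 ltr01 ft fnu f0.
  rewrite invr1 => h; apply: le_trans h _; rewrite /Q lerD2r ler_pM2l//.
  by rewrite ler_sqr ?nnegrE ?W2_ge0 ?W2_refl0// addr_ge0 ?W2_ge0.
have Q0 : 0 <= Q by rewrite addr_ge0// mulr_ge0 ?sqr_ge0.
pose K := 2^-1 * (Q + M + 1).
have K0 : 0 <= K by apply: mulr_ge0 => //; exact: addr_ge0 (addr_ge0 Q0 M0) ler01.
have iKg : leb.-integrable setT (EFin \o (fun r => K * g r)).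
  rewrite (_ : _ \o _ = (fun x => K%:E * (g x)%:E)%E)//.
  exact: integrableZl.
exists (fun r => K * g r); split.
- by apply: measurable_funTS; apply/measurable_EFinP; apply: (measurable_int leb).
- have i01 : leb.-integrable `[0, 1]%classic (EFin \o (fun r => K * g r)).
    by apply: integrableS iKg.
  have /integrableP[_] := i01.
  by under eq_integral do rewrite /= -[`|_ * g _|]expr1.
move=> a b a0 ab b1.
have a01 : 0 <= a <= 1 by rewrite a0 (le_trans (ltW ab)).
have b01 : 0 <= b <= 1 by rewrite b1 (le_trans a0 (ltW ab)).
rewrite RintegralZl//; last by apply: integrableS ig.
set D := \int[leb]_(r in `[a, b]) g r.
have DW : W2 (mu b) (mu a) <= D := mug _ _ a0 ab b1.
have DM : D <= M by apply: itvM => //; exact: ltW.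
have key p q : 0 <= p <= 1 -> 0 <= q <= 1 -> W2 (mu p) (mu q) <= D ->
    2^-1 * (W2 (mu p) nu ^+ 2 - W2 (mu q) nu ^+ 2) <= K * D.
  move=> p01 q01 pq.
  have := W2_increment (fmu _ p01) fnu (fmu _ q01).
  have : W2 (mu p) (mu q) * (W2 (mu q) nu ^+ 2 + W2 (mu p) (mu q) + 1) <= D * (Q + M + 1).
    rewrite ler_pM ?W2_ge0 ?addr_ge0 ?sqr_ge0 ?W2_ge0//.
    by rewrite lerD2r lerD ?WQ// (le_trans pq).
  rewrite /K; lra.
rewrite /rdist -mulrBr ler_norml; apply/andP; split.
  by have := key _ _ a01 b01; rewrite W2_sym => /(_ DW); lra.
exact: key.
Qed.

End Wasserstein.

(** * Potentials touched by parabolas *)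

Section Potentials.
Context (R : realType) (X : completeMetricType R).
Implicit Types (phi : X -> \bar R) (f : X -> R).

Lemma c_superdifferential_fin phi x y : c_superdifferential phi x y ->
  phi x \is a fin_num /\ c_transform phi y \is a fin_num.
Proof.
move=> xy; apply/andP; rewrite -fin_numD.
by rewrite xy /half_sqdist.
Qed.

Lemma c_transform_le phi x y : (c_transform phi y <= half_sqdist x y - phi x)%E.
Proof. by apply: ereal_inf_lbound; exists x. Qed.

(** What is used of a potential whose superdifferential meets a bounded set: it
    is finite, and at each point it is touched from above by a parabola centred
    in a fixed ball. *)
Definition touched_by_parabolas (x0 : X) (rho : R) f := forall x, exists2 y,
  mdist y x0 < rho &
  forall x', f x' - f x <= (mdist x' y ^+ 2 - mdist x y ^+ 2) / 2.

Lemma bounded_superdifferential phi (B : set X) : metric_bounded B ->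
  (forall x, c_superdifferential phi x `&` B !=set0) ->
  exists (f : X -> R) (x0 : X) (rho : R),
    [/\ phi = EFin \o f, 0 < rho & touched_by_parabolas x0 rho f].
Proof.
move=> [x0 [r Br]] phiB.
have phi_fin x : phi x \is a fin_num.
  by have [y [/c_superdifferential_fin[]]] := phiB x.
have phiE : phi = EFin \o (fine \o phi) by apply/funext => x /=; rewrite fineK.
exists (fine \o phi), x0, (Num.max r 1); split => //.
  by rewrite lt_max ltr01 orbT.
move=> x; have [y [xy By]] := phiB x; exists y.
  rewrite lt_max; apply/orP; left.
  by have := Br _ By; rewrite ballEmdist/= metric_sym.
move=> x'; have [_ cy] := c_superdifferential_fin xy.
have := c_transform_le phi x' y; move: xy.
rewrite /c_superdifferential/= /half_sqdist -(fineK cy) -(fineK (phi_fin x)).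
rewrite -(fineK (phi_fin x')) -EFinD -EFinB lee_fin => -[xy].
by move: xy; lra.
Qed.

Section Touched.
Variables (x0 : X) (rho : R) (f : X -> R).
Hypothesis rho0 : 0 < rho.
Hypothesis ft : touched_by_parabolas x0 rho f.

(** The parabola touching at [x] is evaluated at [x']; its centre is at distance
    less than [rho] from [x0]. *)
Lemma touched_increment x x' :
  f x' - f x <= mdist x' x * (mdist x' x0 + mdist x x0 + 2 * rho) / 2.
Proof.
have [y yr fy] := ft x; apply: le_trans (fy x') _; rewrite ler_pM2r ?invr_gt0//.
have -> : mdist x' y ^+ 2 - mdist x y ^+ 2 =
  (mdist x' y - mdist x y) * (mdist x' y + mdist x y) by ring.
have h1 := metric_triangle x' x y.
have h2 := metric_triangle x' x0 y.
have h3 := metric_triangle x x0 y.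
rewrite [mdist x0 y]metric_sym in h2 h3.
apply: (@le_trans _ _ (mdist x' x * (mdist x' y + mdist x y))).
  by rewrite ler_wpM2r ?addr_ge0 ?mdist_ge0// lerBlDr.
rewrite ler_wpM2l ?mdist_ge0//; lra.
Qed.

Lemma touched_lipschitz x x' :
  `|f x' - f x| <= mdist x' x * (mdist x' x0 + mdist x x0 + 2 * rho) / 2.
Proof.
rewrite ler_norml touched_increment andbT.
have := touched_increment x' x; rewrite metric_sym.
have -> : mdist x x0 + mdist x' x0 + 2 * rho = mdist x' x0 + mdist x x0 + 2 * rho by ring.
lra.
Qed.

(** The parabola that touches at [x] is evaluated at [x0], where it is at least
    [f x0]. *)
Lemma touched_ge x : f x0 - rho ^+ 2 / 2 + (Num.max (mdist x x0 - rho) 0) ^+ 2 / 2 <= f x.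
Proof.
have [y yr fy] := ft x; have := fy x0.
have : mdist x0 y ^+ 2 <= rho ^+ 2.
  by rewrite ler_sqr ?nnegrE ?mdist_ge0 ?(ltW rho0)// metric_sym ltW.
have : (Num.max (mdist x x0 - rho) 0) ^+ 2 <= mdist x y ^+ 2.
  rewrite ler_sqr ?nnegrE ?mdist_ge0 ?le_max ?lexx ?orbT// ge_max mdist_ge0 andbT.
  by have := metric_triangle x y x0; move: yr; lra.
lra.
Qed.

Lemma touched_bounded_above (K : R) : 0 <= K -> exists n : nat,
  forall x, mdist x x0 <= K -> f x <= n%:R.
Proof.
move=> K0; exists (Num.trunc (`|f x0| + K * (K + 2 * rho))).+1 => x xK.
apply: ltW; apply: le_lt_trans (truncnS_gt _).
have := touched_increment x0 x; rewrite mdistxx addr0.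
have : mdist x x0 * (mdist x x0 + 2 * rho) <= K * (K + 2 * rho).
  by rewrite ler_pM ?mdist_ge0// ?addr_ge0 ?mdist_ge0 ?mulr_ge0 ?(ltW rho0)// lerD2r.
have := ler_norm (f x0).
have : 0 <= K * (K + 2 * rho) by rewrite mulr_ge0// addr_ge0// mulr_ge0// ltW.
lra.
Qed.

Lemma touched_sublevel_bounded (n : R) : exists D : R,
  forall x, f x <= n -> mdist x x0 <= D.
Proof.
pose s := 1 + 2 * `|n + rho ^+ 2 / 2 - f x0|.
have s1 : 1 <= s by rewrite lerDl mulr_ge0.
exists (rho + s) => x fn; rewrite leNgt; apply/negP => xs.
have := touched_ge x.
have : s ^+ 2 <= (Num.max (mdist x x0 - rho) 0) ^+ 2.
  rewrite ler_sqr ?nnegrE ?le_max ?lexx ?orbT//; last by rewrite (le_trans ler01).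
  by apply/orP; left; move: xs; lra.
have : s <= s ^+ 2 by rewrite expr2 ler_peMr// (le_trans ler01).
have : n + rho ^+ 2 / 2 - f x0 <= `|n + rho ^+ 2 / 2 - f x0| by exact: ler_norm.
by move: fn; rewrite {1}/s; lra.
Qed.

Lemma touched_continuous : continuous f.
Proof.
move=> x; apply/cvgrPdist_le => e e0.
pose K := 2 * mdist x x0 + 2 * rho + 1.
have K0 : 0 < K.
  by rewrite ltr_wpDl// addr_ge0 ?mulr_ge0 ?mdist_ge0// ltW.
have d0 : 0 < Num.min 1 (e / K) by rewrite lt_min ltr01 divr_gt0.
have := nbhsx_ballx x _ d0; apply: filterS => y.
rewrite ballEmdist/= lt_min => /andP[xy1 xye].
rewrite (le_trans (touched_lipschitz y x))//.
apply: (@le_trans _ _ (mdist x y * K)).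
  rewrite -mulrA ler_wpM2l ?mdist_ge0// /K.
  have := metric_triangle y x x0; rewrite [mdist y x]metric_sym.
  by have := mdist_ge0 x x0; move: xy1 rho0; lra.
by rewrite -ler_pdivlMr// ltW.
Qed.

Lemma touched_measurable : measurable_fun setT (f : borel X -> R).
Proof. by apply: continuous_borel_fun; exact: touched_continuous. Qed.

Lemma touched_integrable (mu : probability (borel X) R) :
  finite_second_moment mu -> mu.-integrable setT (EFin \o (f : borel X -> R)).
Proof.
move=> fmu.
have m2 := measurable_dist2 x0.
have i2 : mu.-integrable setT (fun x : borel X => (mdist (x : X) x0 ^+ 2)%:E).
  apply/integrableP; split => //.
  by under eq_integral do rewrite gee0_abs ?lee_fin ?sqr_ge0//; exact: second_moment_lty.
have ic : mu.-integrable setT (EFin \o cst (`|f x0| + rho ^+ 2)).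
  exact: finite_measure_integrable_cst.
have i3 := integrableD measurableT i2 ic.
apply: (le_integrable measurableT _ _ i3).
  by apply/measurable_EFinP; exact: touched_measurable.
move=> x _ /=; rewrite lee_fin [leRHS]ger0_norm; last first.
  by rewrite !addr_ge0 ?sqr_ge0.
have := touched_lipschitz x0 x; rewrite mdistxx addr0.
have : 0 <= (mdist x x0 - rho) ^+ 2 by exact: sqr_ge0.
have := ler_normD (f x - f x0) (f x0); rewrite subrK.
have := sqr_ge0 rho.
rewrite sqrrB; lra.
Qed.

(** As an infimum of continuous functions the transform is upper
    semicontinuous. *)
Lemma touched_c_transform_measurable :
  measurable_fun setT (c_transform (EFin \o f) : borel X -> \bar R).
Proof.
apply: (measurability _ (ErealGenInftyO.measurableE R)).
move=> _ [_ [r ->] <-]; rewrite setTI; apply: borel_open.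
rewrite (_ : _ @^-1` _ = \bigcup_(x in [set: X])
    [set y | mdist x y ^+ 2 / 2 - f x < r]).
  apply: bigcup_open => x _.
  rewrite (_ : [set _ | _] = (fun y => mdist x y ^+ 2 / 2 - f x) @^-1` [set s | s < r])//.
  apply: open_comp; last exact: open_lt.
  move=> y _; apply: cvgB; last exact: cvg_cst.
  apply: cvgMl; apply: (@continuous_comp _ _ _ (mdist x) (fun s => s ^+ 2)).
    apply: (@continuous_mdist _ _ X (cst x) id); first exact: cst_continuous.
    by move=> ?; exact: cvg_id.
  exact: exprn_continuous.
apply/seteqP; split => y /=; rewrite in_itv/=.
  by move=> /ereal_inf_lt[_ [x _ <-]]; rewrite /half_sqdist -EFinB lte_fin => ?; exists x.
move=> [x _ xr]; apply: le_lt_trans (c_transform_le _ x y) _.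
by rewrite /half_sqdist -EFinB lte_fin.
Qed.

End Touched.
End Potentials.

(** * Integrals against the marginals of a coupling *)

Section Marginals.
Context (R : realType).

Lemma marginal_integral d d' (T1 : measurableType d) (T2 : measurableType d')
    (g : probability T1 R) (p : probability T2 R) (f : T1 -> T2) (h : T2 -> \bar R) :
  measurable_fun setT f -> (forall A, measurable A -> g (f @^-1` A) = p A) ->
  measurable_fun setT h -> (\int[g]_x h (f x) = \int[p]_y h y)%E.
Proof.
move=> mf gp mh.
have nonneg k : (forall y, (0 <= k y)%E) -> measurable_fun setT k ->
    (\int[g]_x k (f x) = \int[p]_y k y)%E.
  move=> k0 mk; have [q [qE qint]] := pushforward_probability g mf.
  rewrite -qint//; apply: eq_measure_integral => A mA _.
  by apply: etrans (qE A) _; exact: gp.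
rewrite integralE [RHS]integralE -!nonneg//; last 2 first.
- exact: measurable_funeneg.
- exact: measurable_funepos.
by rewrite -[fun x => h (f x)]/(h \o f) funepos_comp funeneg_comp.
Qed.

Lemma marginal_integrable d d' (T1 : measurableType d) (T2 : measurableType d')
    (g : probability T1 R) (p : probability T2 R) (f : T1 -> T2) (h : T2 -> \bar R) :
  measurable_fun setT f -> (forall A, measurable A -> g (f @^-1` A) = p A) ->
  p.-integrable setT h -> g.-integrable setT (h \o f).
Proof.
move=> mf gp /integrableP[mh hfin]; apply/integrableP; split.
  exact: measurableT_comp.
rewrite (_ : (\int[g]_x `|(h \o f) x|)%E = (\int[p]_y `|h y|)%E)//.
by apply: (marginal_integral mf gp (h := fun y => `|h y|%E)); exact: measurableT_comp.
Qed.

End Marginals.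

Section CouplingEstimates.
Context (R : realType) (X : completeMetricType R).
Hypothesis X_separable : separable_space X.
Implicit Types (mu nu : probability (borel X) R) (h w : X -> R).
Local Notation XX := (borel X * borel X)%type.

Lemma coupling_fst mu nu (g : probability XX R) : coupling mu nu g ->
  forall A, measurable A -> g (fst @^-1` A) = mu A.
Proof. by move=> gP A mA; have [] := gP A mA. Qed.

Lemma coupling_snd mu nu (g : probability XX R) : coupling mu nu g ->
  forall A, measurable A -> g (snd @^-1` A) = nu A.
Proof. by move=> gP A mA; have [] := gP A mA. Qed.

(** Under a nearly optimal coupling the increment of [h] is at most
    3 d (d + 2 w), where d is the distance and [w] is taken at the second point;
    the product d w is separated by Young's inequality with parameter [l]. *)
Lemma W2_integral_diff mu nu h w (l : R) :
  finite_second_moment mu -> finite_second_moment nu -> 0 < l ->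
  mu.-integrable setT (EFin \o (h : borel X -> R)) ->
  nu.-integrable setT (EFin \o (h : borel X -> R)) ->
  nu.-integrable setT (EFin \o (fun x : borel X => w x ^+ 2)) ->
  (forall x y, `|h x - h y| <= 3 * mdist x y * (w x + w y)) ->
  (forall x y, w x - w y <= mdist x y) ->
  `|\int[mu]_x h x - \int[nu]_x h x| <=
  (3 + 3 * l) * W2 mu nu ^+ 2 + 3 / l * \int[nu]_x (w x ^+ 2).
Proof.
move=> fmu fnu l0 imu inu iw hw wl; apply/ler_addgt0Pr => e e0.
have l3 : 0 < 3 + 3 * l by rewrite addr_gt0// mulr_gt0.
have e3 : 0 < e / (3 + 3 * l) by rewrite divr_gt0.
have [g gP gle] := near_optimal_coupling X_separable fmu fnu e3.
have m1 := @measurable_fst _ _ (borel X) (borel X).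
have m2 := @measurable_snd _ _ (borel X) (borel X).
have g1 := coupling_fst gP; have g2 := coupling_snd gP.
have i1 := marginal_integrable m1 g1 imu.
have i2 := marginal_integrable m2 g2 inu.
have i3 := marginal_integrable m2 g2 iw.
have ic : g.-integrable setT (fun z : XX => (mdist (z.1 : X) (z.2 : X) ^+ 2)%:E).
  apply/integrableP; split; first exact: measurable_sqdist.
  under eq_integral do rewrite gee0_abs ?lee_fin ?sqr_ge0//.
  by apply: le_lt_trans gle _; rewrite ltry.
have -> : \int[mu]_x h x - \int[nu]_x h x = \int[g]_z (h z.1 - h z.2).
  rewrite RintegralB//; congr (_ - _); rewrite /Rintegral; congr fine; apply/esym.
    by apply: (marginal_integral m1 g1); apply: (measurable_int mu).
  by apply: (marginal_integral m2 g2); apply: (measurable_int nu).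
apply: le_trans (le_normr_Rintegral _ _) _ => //.
  rewrite (_ : _ \o _ = ((EFin \o h) \o fst) \- ((EFin \o h) \o snd))%E//.
  exact: integrableB.
pose k (z : XX) := (3 + 3 * l) * mdist (z.1 : X) (z.2 : X) ^+ 2 + 3 / l * w z.2 ^+ 2.
have hk z : `|h z.1 - h z.2| <= k z.
  apply: le_trans (hw _ _) _; rewrite /k.
  have := wl z.1 z.2; set d := mdist z.1 z.2 => wd.
  have d0 : 0 <= d by exact: mdist_ge0.
  apply: (@le_trans _ _ (3 * d * (d + 2 * w z.2))).
    by rewrite ler_wpM2l ?mulr_ge0//; lra.
  have -> : (3 + 3 * l) * d ^+ 2 + 3 / l * w z.2 ^+ 2 =
    3 * d * (d + 2 * w z.2) + 3 / l * (l * d - w z.2) ^+ 2 by field; rewrite gt_eqF.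
  by rewrite lerDl mulr_ge0 ?sqr_ge0// divr_ge0// ltW.
have ik1 : g.-integrable setT (EFin \o (fun z : XX => (3 + 3 * l) * mdist (z.1 : X) (z.2 : X) ^+ 2)).
  rewrite (_ : _ \o _ = (fun z : XX => (3 + 3 * l)%:E * (mdist (z.1 : X) (z.2 : X) ^+ 2)%:E)%E)//.
  exact: integrableZl.
have ik2 : g.-integrable setT (EFin \o (fun z : XX => 3 / l * w z.2 ^+ 2)).
  rewrite (_ : _ \o _ = (fun z : XX => (3 / l)%:E * (w z.2 ^+ 2)%:E)%E)//.
  exact: integrableZl.
apply: (@le_trans _ _ (\int[g]_z k z)).
  apply: le_Rintegral => //.
  - rewrite (_ : _ \o _ = abse \o (((EFin \o h) \o fst) \- ((EFin \o h) \o snd))%E)//.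
    by apply: integrable_abse; exact: integrableB.
  - exact: (integrableD measurableT ik1 ik2).
rewrite RintegralD// RintegralZl// RintegralZl//.
have -> : \int[g]_z (w z.2 ^+ 2) = \int[nu]_x (w x ^+ 2).
  rewrite /Rintegral; congr fine.
  exact: (marginal_integral m2 g2 (measurable_int nu iw)).
rewrite [leRHS]addrAC; apply: lerD => //.
have : \int[g]_z mdist z.1 z.2 ^+ 2 <= W2 mu nu ^+ 2 + e / (3 + 3 * l).
  by rewrite -lee_fin /Rintegral fineK//; exact: integrable_fin_num.
rewrite -(ler_pM2l l3) => h1; apply: le_trans h1 _.
by rewrite mulrDr lerD2l mulrC divfK// gt_eqF.
Qed.

Lemma second_moment_tail mu (x0 : X) (e : R) : finite_second_moment mu -> 0 < e ->
  exists n0 : nat, forall n, (n0 <= n)%N ->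
    mu.-integrable setT (EFin \o (fun x : borel X => Num.max (mdist (x : X) x0 - n%:R) 0 ^+ 2)) /\
    \int[mu]_x (Num.max (mdist (x : X) x0 - n%:R) 0 ^+ 2) < e.
Proof.
move=> fmu e0.
have md := measurable_mdist_l x0.
have i2 : mu.-integrable setT (EFin \o (fun x : borel X => mdist (x : X) x0 ^+ 2)).
  apply/integrableP; split.
    by apply/measurable_EFinP; exact: measurable_funX.
  under eq_integral do rewrite /= ger0_norm ?sqr_ge0//.
  exact: second_moment_lty.
have mw n : measurable_fun setT (fun x : borel X => Num.max (mdist (x : X) x0 - n%:R) 0 ^+ 2).
  by apply: measurable_funX; apply: measurable_maxr => //; exact: measurable_funB.
have wle n (x : borel X) : 0 <= Num.max (mdist (x : X) x0 - n%:R) 0 ^+ 2 <= mdist (x : X) x0 ^+ 2.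
  rewrite sqr_ge0/= ler_sqr ?nnegrE ?mdist_ge0 ?le_max ?lexx ?orbT//.
  by rewrite ge_max mdist_ge0 andbT lerBlDr lerDl.
have w0 (x : borel X) : exists n0, forall n, (n0 <= n)%N ->
    Num.max (mdist (x : X) x0 - n%:R) 0 ^+ 2 = 0.
  exists (Num.trunc (mdist (x : X) x0)).+1 => n xn.
  have -> : Num.max (mdist (x : X) x0 - n%:R) 0 = 0; last by rewrite expr0n.
  apply/max_idPr; rewrite subr_le0.
  by rewrite ltW// (lt_le_trans (truncnS_gt (mdist (x : X) x0)))// ler_nat.
have [n0 hn] := vanishing_integral i2 mw wle w0 e0.
exists n0 => n n0n.
have iw : mu.-integrable setT (EFin \o (fun x : borel X => Num.max (mdist (x : X) x0 - n%:R) 0 ^+ 2)).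
  apply: (le_integrable measurableT _ _ i2); first exact/measurable_EFinP.
  move=> x _ /=; have /andP[h1 h2] := wle n x.
  by rewrite lee_fin !ger0_norm ?sqr_ge0.
split => //; rewrite -lte_fin /Rintegral fineK; first exact: hn.
exact: integrable_fin_num.
Qed.

End CouplingEstimates.

(** * Truncated potentials *)

Lemma min_lipschitz (R : realType) (a r s : R) :
  `|Num.min a r - Num.min a s| <= `|r - s|.
Proof.
have := ler_norm (r - s); have := ler_norm (s - r); rewrite [`|s - r|]distrC.
rewrite ler_norml /Num.min; case: (ltP a r) => ar; case: (ltP a s) => aS; lra.
Qed.

Lemma minB_lipschitz (R : realType) (a b r s : R) :
  `|Num.min a r - Num.min b r - (Num.min a s - Num.min b s)| <= `|r - s|.
Proof.
have := ler_norm (r - s); have := ler_norm (s - r); rewrite [`|s - r|]distrC.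
rewrite ler_norml /Num.min.
case: (ltP a r) => ar; case: (ltP a s) => aS;
  case: (ltP b r) => br; case: (ltP b s) => bs; lra.
Qed.

Section FunctionsOfPotential.
Context (R : realType) (X : completeMetricType R).
Variable m : {measure set (borel X) -> \bar R}.
Hypothesis m_bounded : forall B : set (borel X),
  measurable B -> metric_bounded (B : set X) -> (m B < +oo)%E.
Variables (x0 : X) (rho : R) (f : X -> R).
Hypothesis rho0 : 0 < rho.
Hypothesis ft : touched_by_parabolas x0 rho f.
Implicit Types (T : R -> R).

Let mf : measurable_fun setT (f : borel X -> R).
Proof. exact: touched_measurable rho0 ft. Qed.

(** An upper bound for the slope of [f], restricted to a set of values of [f]. *)
Definition band_gradient (a b : R) (x : X) : R :=
  if a <= f x <= b then mdist x x0 + rho else 0.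

Lemma band_gradient_ge0 a b x : 0 <= band_gradient a b x.
Proof. by rewrite /band_gradient; case: ifP => // _; rewrite addr_ge0 ?mdist_ge0// ltW. Qed.

Lemma measurable_band_gradient a b :
  measurable_fun setT (band_gradient a b : borel X -> R).
Proof.
apply: measurable_fun_ifT => //.
  apply: measurable_and.
    exact: measurable_fun_ler.
  exact: measurable_fun_ler.
by apply: measurable_funD => //; exact: measurable_mdist_l.
Qed.

Lemma band_gradient_Lfun a b :
  (band_gradient a b : borel X -> R) \in Lfun m 2%:E.
Proof.
have [D fD] := touched_sublevel_bounded rho0 ft b.
pose M := (`|D| + rho) ^+ 2.
apply: Lfun2_of_integral; first exact: measurable_band_gradient.
pose B : set (borel X) := ball x0 (`|D| + 1).
have mB : measurable B by exact: borel_ball.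
apply: (@le_lt_trans _ _ (\int[m]_(x in B) M%:E)%E).
  rewrite [leRHS]integral_mkcond; apply: ge0_le_lower_integral => x _.
    by rewrite lee_fin sqr_ge0.
  rewrite /patch /band_gradient; case: ifPn => [/andP[_ fb]|_]; last first.
    by rewrite expr0n/=; case: ifP => // _; rewrite lee_fin sqr_ge0.
  have xD := fD x fb; have nD := ler_norm D.
  rewrite mem_set; last by rewrite /B ballEmdist/= metric_sym; move: xD nD; lra.
  rewrite lee_fin /M ler_sqr ?nnegrE ?addr_ge0 ?mdist_ge0 ?(ltW rho0)//.
  by rewrite lerD2r (le_trans xD).
rewrite integral_cst// lte_mul_pinfty ?lee_fin ?sqr_ge0//.
apply: m_bounded => //; first by exists x0, (`|D| + 1).
Qed.

(** [T \o f] is constant near the points where [f] lies outside of [a, b], and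
    its slope at the other points is at most that of [f]. *)
Lemma band_weak_upper_gradient T a b :
  (forall r s, `|T r - T s| <= `|r - s|) ->
  (forall x y, f x < a -> f y < a -> T (f x) = T (f y)) ->
  (forall r s, b < r -> b < s -> T r = T s) ->
  weak_upper_gradient m (T \o f) (band_gradient a b).
Proof.
move=> T1 Ta Tb.
have TL x y : `|T (f x) - T (f y)| <= mdist x y * (mdist x x0 + mdist y x0 + 2 * rho) / 2.
  exact: le_trans (T1 _ _) (touched_lipschitz ft y x).
have mT : measurable_fun setT T.
  apply: continuous_measurable_fun => r; apply/cvgrPdist_le => e e0.
  near=> s; apply: le_trans (T1 _ _) _; near: s.
  by apply: cvgr_dist_le; [exact: cvg_id|exact: e0].
apply: (slope_weak_upper_gradient (A := 2 * rho) (x0 := x0)).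
- exact: measurableT_comp.
- exact: band_gradient_Lfun.
- exact: band_gradient_ge0.
- move=> x y; apply: le_trans (TL _ _) _.
  have -> : 2 * rho + mdist x x0 + mdist y x0 = mdist x x0 + mdist y x0 + 2 * rho by ring.
  rewrite -mulrA ler_wpM2l ?mdist_ge0// ler_pdivrMr// ler_peMr ?ler1n//.
  by rewrite !addr_ge0 ?mdist_ge0// mulr_ge0// ltW.
move=> x e e0; rewrite /band_gradient; case: ifPn => [_|].
  exists (2 * e); first by rewrite mulr_gt0.
  move=> y ye; apply: le_trans (TL _ _) _; rewrite -mulrA mulrC ler_wpM2r ?mdist_ge0//.
  have := metric_triangle y x x0; lra.
rewrite negb_and -!ltNge add0r => xab.
have fc := touched_continuous rho0 ft (x := x).
suff [d d0 Tc] : exists2 d, 0 < d & forall y, mdist y x < d -> T (f y) = T (f x).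
  by exists d => // y /Tc TE; rewrite /= TE subrr normr0 mulr_ge0 ?mdist_ge0// ltW.
have ball_near (P : set X) : (\forall y \near x, P y) ->
    exists2 d : R, 0 < d & forall y, mdist y x < d -> P y.
  move=> /nbhs_ballP[d /= d0 dP]; exists d => // y yx; apply: dP.
  by rewrite ballEmdist/= metric_sym.
case/orP: xab => [fa|fb].
- apply: ball_near; have : \forall r \near f x, r < a by exact: lt_nbhsl.
  by move=> /fc; apply: (@filterS _ (nbhs x)) => y fy; exact: Ta.
- apply: ball_near; have : \forall r \near f x, b < r by exact: lt_nbhsr.
  by move=> /fc; apply: (@filterS _ (nbhs x)) => y fy; exact: Tb.
Unshelve. all: by end_near. Qed.

Definition trunc_fun (n : nat) (x : X) : R := Num.min n%:R (f x).

Lemma trunc_fun_S2 n : S2 m (trunc_fun n).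
Proof.
split; first exact: measurable_minr.
(* The lower end of the band is a lower bound of f. *)
exists (band_gradient (f x0 - rho ^+ 2 / 2) n%:R).
apply: (@band_weak_upper_gradient (fun r => Num.min n%:R r)).
- exact: min_lipschitz.
- move=> x y fa; have := touched_ge rho0 ft x.
  have := sqr_ge0 (Num.max (mdist x x0 - rho) 0); move: fa; lra.
- by move=> r s nr ns; rewrite !min_l// ltW.
Qed.

Lemma trunc_funB_gradient (n0 i j : nat) : (n0 <= i)%N -> (n0 <= j)%N ->
  weak_upper_gradient m (trunc_fun i \- trunc_fun j)
    (band_gradient n0%:R (maxn i j)%:R).
Proof.
move=> n0i n0j.
have n0iR : n0%:R <= i%:R :> R by rewrite ler_nat.
have n0jR : n0%:R <= j%:R :> R by rewrite ler_nat.
have iM : i%:R <= (maxn i j)%:R :> R by rewrite ler_nat leq_maxl.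
have jM : j%:R <= (maxn i j)%:R :> R by rewrite ler_nat leq_maxr.
apply: (@band_weak_upper_gradient (fun r => Num.min i%:R r - Num.min j%:R r)).
- exact: minB_lipschitz.
- by move=> x y fx fy; rewrite !min_r ?subrr// ltW// (lt_le_trans _ n0iR, lt_le_trans _ n0jR).
- by move=> r s br bs; rewrite !min_l// ltW// (le_lt_trans iM, le_lt_trans jM).
Qed.

(** [f] is bounded on the ball of radius [2 K], and outside of it the slope
    [mdist x x0 + rho] of [f] is comparable to the distance to the ball of radius
    [K], which is small in the mean for large [K]. *)
Lemma sublevel_far (K : R) : rho <= K -> exists n : nat, forall x, n%:R <= f x ->
  mdist x x0 + rho <= 3 * Num.max (mdist x x0 - K) 0.
Proof.
move=> rK; have K0 : 0 < K := lt_le_trans rho0 rK.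
have K2 : 0 <= 2 * K by rewrite mulr_ge0// ltW.
have [n nP] := touched_bounded_above rho0 ft K2.
exists n.+1 => x fx.
have xK : 2 * K < mdist x x0.
  rewrite ltNge; apply/negP => /nP fn.
  by have := le_trans fx fn; rewrite ler_nat ltnn.
have -> : Num.max (mdist x x0 - K) 0 = mdist x x0 - K.
  by apply/max_idPl; move: xK K0; lra.
by move: xK rK; lra.
Qed.

Lemma trunc_fun_cauchy (C : R) (mu : probability (borel X) R) :
  (forall A : set (borel X), measurable A -> (mu A <= C%:E * m A)%E) ->
  finite_second_moment mu -> cauchy_S2 m mu trunc_fun.
Proof.
move=> muC fmu; split=> [n|e e0]; first exact: trunc_fun_S2.
have [k0 hk] := second_moment_tail x0 fmu (divr_gt0 e0 (ltr0n R 9)).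
pose k := maxn k0 (Num.trunc rho).+1.
have [iw wk] := hk k (leq_maxl _ _).
have rk : rho <= k%:R.
  by rewrite ltW// (lt_le_trans (truncnS_gt rho))// ler_nat leq_maxr.
have [n0 far] := sublevel_far rk.
exists n0 => i j n0i n0j.
apply: le_lt_trans (sqnorm_le muC (trunc_funB_gradient n0i n0j)) _.
apply: (@le_lt_trans _ _ (9%:E * \int[mu]_x (Num.max (mdist (x : X) x0 - k%:R) 0 ^+ 2)%:E)%E).
  rewrite -ge0_integralZl//.
  - apply: ge0_le_lower_integral => x _; first by rewrite lee_fin sqr_ge0.
    rewrite -EFinM lee_fin /band_gradient; case: ifPn => [/andP[fx _]|_]; last first.
      by rewrite expr0n/= mulr_ge0// sqr_ge0.
    have -> : 9 = 3 ^+ 2 :> R by ring.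
    rewrite -exprMn ler_sqr ?nnegrE ?far//.
      by rewrite addr_ge0 ?mdist_ge0// ltW.
    by rewrite mulr_ge0// le_max lexx orbT.
  - exact: (measurable_int mu iw).
  - by move=> x _; rewrite lee_fin sqr_ge0.
rewrite -(fineK (integrable_fin_num measurableT iw)) -EFinM lte_fin.
by rewrite mulrC -ltr_pdivlMr.
Qed.

(** Subtracting the constant makes the truncation vanish off a bounded set, which
    matters as [m] may be infinite. *)
Lemma trunc_fun_integrable n :
  m.-integrable setT (EFin \o (fun x : borel X => trunc_fun n x - n%:R)).
Proof.
have [D fD] := touched_sublevel_bounded rho0 ft n%:R.
pose B : set (borel X) := ball x0 (`|D| + 1).
have mB : measurable B by exact: borel_ball.
have mBoo : (m B < +oo)%E by apply: m_bounded => //; exists x0, (`|D| + 1).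
pose M := `|f x0 - rho ^+ 2 / 2| + n%:R.
have M0 : 0 <= M by rewrite addr_ge0.
have iM : m.-integrable B (EFin \o cst M).
  apply: measurable_bounded_integrable => //.
  by exists `|M|; split=> [|K kM x _ /=]; [exact: num_real|exact: ltW].
have iM' : m.-integrable setT ((EFin \o cst M) \_ B) by exact: ((integrable_mkcond (EFin \o cst M) mB).1 iM).
apply: (le_integrable measurableT _ _ iM').
  by apply/measurable_EFinP; apply: measurable_funB => //; exact: measurable_minr.
move=> x _; rewrite /= /patch /trunc_fun.
have [fn|fn] := leP n%:R (f x); first by rewrite subrr normr0 abse_ge0.
have xD := fD x (ltW fn); have nD := ler_norm D.
rewrite mem_set/=; last by rewrite /B ballEmdist/= metric_sym; move: xD nD; lra.
rewrite lee_fin (ger0_norm M0) /M.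
have := touched_ge rho0 ft x.
have := sqr_ge0 (Num.max (mdist x x0 - rho) 0).
have := ler_norm (- (f x0 - rho ^+ 2 / 2)); rewrite normrN.
have : 0 <= n%:R :> R by [].
by rewrite [`|f x - _|]ltr0_norm ?subr_lt0//; lra.
Qed.

Lemma trunc_fun_second_moment_integrable (mu : probability (borel X) R) n :
  finite_second_moment mu ->
  mu.-integrable setT (EFin \o (fun x : borel X => trunc_fun n x - n%:R)).
Proof.
move=> fmu; have fi := touched_integrable rho0 ft fmu.
have ic : mu.-integrable setT (EFin \o cst (n%:R : R)).
  exact: finite_measure_integrable_cst.
have ia := integrableD measurableT (integrable_abse fi) ic.
apply: (le_integrable measurableT _ _ ia).
  by apply/measurable_EFinP; apply: measurable_funB => //; exact: measurable_minr.
move=> x _ /=; rewrite lee_fin [leRHS]ger0_norm ?addr_ge0//.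
rewrite /trunc_fun; case: (leP n%:R (f x)) => fx.
  by rewrite subrr normr0 addr_ge0.
by apply: le_trans (ler_normB _ _) _; rewrite (ger0_norm (ler0n R n)).
Qed.

End FunctionsOfPotential.

(** * Differentiating the potential along the curve *)

Section Quotients.
Context (R : realType).
Implicit Types (u : R -> R) (t l : R).

Lemma is_derive_quotient u t l :
  is_derive t 1 u l <-> (u (t + h) - u t) / h @[h --> 0^'] --> l.
Proof.
pose Q := fun h : R => h^-1 *: ((u \o shift t) (h *: (1 : R)) - u t).
have QE : (fun h => (u (t + h) - u t) / h) = Q.
  apply/funext => h; rewrite /Q/= [LHS]mulrC.
  by rewrite (mulr1 h : h *: 1 = h) [t + h]addrC.
rewrite QE; split=> [[ut <-]|Ql]; first exact: ut.
split; first by apply/cvg_ex; exists l.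
exact: (cvg_lim (@Rhausdorff R) Ql).
Qed.

(** The functions [u_ n] approximate [u] near [t] up to small multiples of
    |h|, which makes their derivatives a Cauchy sequence. *)
Lemma is_derive_approx u (u_ : nat -> R -> R) (l_ : nat -> R) t :
  (forall n, is_derive t 1 (u_ n) (l_ n)) ->
  (forall e : R, 0 < e -> exists n0, forall n, (n0 <= n)%N ->
     \forall h \near 0^', `|(u (t + h) - u t) - (u_ n (t + h) - u_ n t)| <= e * `|h|) ->
  exists2 l, l_ n @[n --> \oo] --> l & is_derive t 1 u l.
Proof.
move=> du ua.
have q n e : 0 < e -> \forall h \near 0^', `|(u_ n (t + h) - u_ n t) / h - l_ n| <= e.
  move=> e0; have /is_derive_quotient/cvgrPdist_le/(_ _ e0) := du n.
  by apply: (@filterS _ 0^') => h; rewrite distrC.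
have ql e : 0 < e -> exists n0, forall n, (n0 <= n)%N ->
    \forall h \near 0^', `|(u (t + h) - u t) / h - l_ n| <= e.
  move=> e0; have e2 : 0 < e / 2 by rewrite divr_gt0.
  have [n0 hn] := ua _ e2; exists n0 => n /hn uan.
  near=> h; have h0 : h != 0 by near: h; exact: nbhs_dnbhs_neq.
  have : `|(u (t + h) - u t) / h - (u_ n (t + h) - u_ n t) / h| <= e / 2.
    rewrite -mulrBl normrM normfV ler_pdivrMr ?normr_gt0//.
    by near: h.
  have : `|(u_ n (t + h) - u_ n t) / h - l_ n| <= e / 2.
    by near: h; exact: q.
  rewrite !ler_norml => /andP[? ?] /andP[? ?]; apply/andP; split; lra.
have lc : cvg (l_ n @[n --> \oo]).
  apply/cauchy_cvgP/cauchy_ballP => e e0.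
  have e4 : 0 < e / 4 by rewrite divr_gt0.
  have [n0 hn] := ql _ e4.
  pose F : set (R^o) := l_ @` [set n | (n0 <= n)%N].
  exists (F, F) => /=; first by split; exists n0 => // n n0n; exists n.
  move=> [_ _] /= [[i n0i <-] [j n0j <-]]; rewrite /ball/=.
  have [h [hi hj]] := filter_ex (filterI (hn _ n0i) (hn _ n0j)).
  rewrite -(@subrK _ ((u (t + h) - u t) / h) (l_ i)) -addrA.
  apply: le_lt_trans (ler_normD _ _) _; rewrite distrC.
  apply: le_lt_trans (lerD hi hj) _; lra.
exists (lim (l_ n @[n --> \oo])); first exact: lc.
apply/is_derive_quotient/cvgrPdist_le => e e0.
have e2 : 0 < e / 2 by rewrite divr_gt0.
have [n0 hn] := ql _ e2.
have /cvgrPdist_le/(_ _ e2)[n1 _ hn1] := lc.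
have := hn _ (leq_maxl n0 n1); apply: (@filterS _ 0^') => h hh.
have := hn1 (maxn n0 n1) (leq_maxr _ _).
move: hh; rewrite !ler_norml => /andP[? ?] /andP[? ?]; apply/andP; split; lra.
Unshelve. all: by end_near. Qed.

(** The difference quotients of [u - g] have the sign of the increment [h]. *)
Lemma is_derive_touching u g t l k (e : R) : 0 < e ->
  is_derive t 1 u l -> is_derive t 1 g k ->
  (forall h, `|h| < e -> u t - g t <= u (t + h) - g (t + h)) -> k = l.
Proof.
move=> e0 du dg ug.
have /is_derive_quotient := is_deriveB du dg.
have [-> //|lk] := eqVneq k l; have lk0 : 0 < `|l - k|.
  by rewrite normr_gt0 subr_eq0 eq_sym.
move=> /cvgrPdist_lt/(_ _ lk0)/nbhs_ballP[d /= d0 hd].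
pose h := Num.min d e / 2.
have h0 : 0 < h by rewrite divr_gt0// lt_min d0.
have hde : h < d /\ h < e.
  have : Num.min d e <= d by rewrite ge_min lexx.
  have : Num.min d e <= e by rewrite ge_min lexx orbT.
  by move: h0; rewrite /h; lra.
have := hd h; rewrite /ball/= sub0r normrN gtr0_norm// gt_eqF//.
move=> /(_ hde.1 isT) hp.
have := hd (- h); rewrite /ball/= sub0r opprK gtr0_norm// oppr_eq0 gt_eqF//.
move=> /(_ hde.1 isT) hn.
have up : 0 <= (u (t + h) - g (t + h) - (u t - g t)) / h.
  by rewrite divr_ge0 ?(ltW h0)// subr_ge0 ug// gtr0_norm// hde.2.
have un : (u (t + - h) - g (t + - h) - (u t - g t)) / (- h) <= 0.
  rewrite invrN mulrN oppr_le0 divr_ge0 ?(ltW h0)// subr_ge0 ug// normrN gtr0_norm//.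
  exact: hde.2.
move: hp hn up un; rewrite /=.
set a := _ / h; set b := _ / - h.
have [c0|c0] := ltP 0 (l - k).
  by rewrite (gtr0_norm c0) => _; rewrite ltr_norml => /andP[? ?] _ ?; lra.
rewrite (ler0_norm c0) ltr_norml => /andP[? ?] _ ? _; lra.
Qed.

End Quotients.

Section PotentialDerivative.
Context (R : realType) (X : completeMetricType R).
Hypothesis X_separable : separable_space X.
Variable m : {measure set (borel X) -> \bar R}.
Hypothesis m_bounded : forall B : set (borel X),
  measurable B -> metric_bounded (B : set X) -> (m B < +oo)%E.
Variables (x0 : X) (rho : R) (f : X -> R).
Hypothesis rho0 : 0 < rho.
Hypothesis ft : touched_by_parabolas x0 rho f.

Lemma far_distance_lipschitz (K : R) (x y : X) :
  Num.max (mdist x x0 - K) 0 - Num.max (mdist y x0 - K) 0 <= mdist x y.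
Proof.
rewrite lerBlDr ge_max addr_ge0 ?mdist_ge0 ?le_max ?lexx ?orbT// andbT.
have := metric_triangle x y x0.
have : mdist y x0 - K <= Num.max (mdist y x0 - K) 0 by rewrite le_max lexx.
lra.
Qed.

(** The slope of the excess at a point where it is positive is at most
    [mdist x x0 + rho]. When only one of the two points is of this kind, the other
    one is either nearer to [x0], or farther and then also far from it. *)
Lemma trunc_excess_lipschitz (K : R) (n : nat) :
  (forall x, n%:R <= f x -> mdist x x0 + rho <= 3 * Num.max (mdist x x0 - K) 0) ->
  forall x y, `|(f x - trunc_fun f n x) - (f y - trunc_fun f n y)| <=
    3 * mdist x y * (Num.max (mdist x x0 - K) 0 + Num.max (mdist y x0 - K) 0).
Proof.
move=> far.
pose w x := Num.max (mdist x x0 - K) 0.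
have w0 x : 0 <= w x by rewrite le_max lexx orbT.
have sym (P : X -> X -> Prop) : (forall x y, P x y -> P y x) ->
    (forall x y, f y <= f x -> P x y) -> forall x y, P x y.
  by move=> Ps Pxy x y; have [|/ltW] := leP (f y) (f x); [exact: Pxy|move=> /Pxy/Ps].
apply: sym => [x y|x y fyx].
  by rewrite distrC [mdist y x]metric_sym [X in _ * X]addrC.
rewrite -/(w x) -/(w y) /trunc_fun.
have [fx|fx] := leP n%:R (f x); last first.
  rewrite (min_r (ltW (le_lt_trans fyx fx))) !subrr normr0.
  by rewrite !mulr_ge0 ?mdist_ge0 ?addr_ge0.
have xw := far _ fx; rewrite -/(w x) in xw.
have yw : mdist y x0 + rho <= 3 * (w x + w y).
  have [yx|/ltW xy] := leP (mdist y x0) (mdist x x0).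
    by have := w0 y; move: xw yx; lra.
  have wE : w x = mdist x x0 - K.
    apply/max_idPl; rewrite leNgt; apply/negP => wneg.
    have wx0 : w x = 0 by apply/max_idPr; exact: ltW.
    by have := mdist_ge0 x x0; move: xw rho0; rewrite wx0; lra.
  have : mdist y x0 - K <= w y by rewrite le_max lexx.
  by have := w0 x; move: xw xy; rewrite wE; lra.
have fxy := touched_increment ft y x.
apply: (@le_trans _ _ (f x - f y)).
  by case: (leP n%:R (f y)) => fy; rewrite ger0_norm; lra.
apply: le_trans fxy _; rewrite [3 * _]mulrC -!mulrA ler_wpM2l ?mdist_ge0//.
by have := w0 y; move: xw yw; lra.
Qed.

Variables (mu : R -> probability (borel X) R) (t : R) (C k : R) (L : (X -> R) -> R).
Hypothesis t01 : 0 < t < 1.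
Hypothesis mu_P2 : forall s, 0 <= s <= 1 -> finite_second_moment (mu s).
Hypothesis muC : forall A : set (borel X), measurable A -> (mu t A <= C%:E * m A)%E.
Hypothesis speed : has_metric_speed (@W2 R X) mu t.
Hypothesis linL : S2_linear m L.
Hypothesis normL : dual_norm m (mu t) L = k%:E.
Hypothesis derL : forall g, S2 m g -> m.-integrable setT (EFin \o g : borel X -> \bar R) ->
  is_derive t 1 (fun s => \int[mu s]_x g x : R) (L g).

Let t01' : 0 <= t <= 1.
Proof. by move: t01 => /andP[? ?]; rewrite !ltW. Qed.

(** The excess of [f] over its truncation is Lipschitz with a small constant in
    the mean, so that its integral along the curve moves slowly. *)
Lemma potential_integral_derive :
  exists2 l, L (trunc_fun f n) @[n --> \oo] --> l &
    is_derive t 1 (fun s => \int[mu s]_x f x : R) l.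
Proof.
apply: (is_derive_approx (u_ := fun n s => \int[mu s]_x (trunc_fun f n x - n%:R))).
  move=> n; have := derL (S2B (trunc_fun_S2 m_bounded rho0 ft n) (S2_cst m n%:R))
    (trunc_fun_integrable m_bounded rho0 ft n).
  rewrite (S2_linearB linL) ?(dual_norm_cst muC linL normL) ?subr0//; last exact: S2_cst.
  exact: (trunc_fun_S2 m_bounded rho0 ft n).
move=> e e0.
pose v := metric_speed (@W2 R X) mu t.
(* By the metric speed, W2 (mu (t + h)) (mu t) ^+ 2 <= S h^2. Young's inequality is
   applied with parameter eta / |h|, and S eta is a fraction of e. *)
pose S := (v + 1) ^+ 2 + 1.
have S0 : 0 < S by rewrite ltr_wpDl ?sqr_ge0.
pose eta := e / (9 * S).
have eta0 : 0 < eta by rewrite divr_gt0// mulr_gt0.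
have tau0 : 0 < e * eta / 9 by rewrite divr_gt0// mulr_gt0.
have [k0 hk] := second_moment_tail x0 (mu_P2 t01') tau0.
pose K := maxn k0 (Num.trunc rho).+1.
have [iw wK] := hk K (leq_maxl _ _).
have rK : rho <= K%:R.
  by rewrite ltW// (lt_le_trans (truncnS_gt rho))// ler_nat leq_maxr.
have [n0 far] := sublevel_far rho0 ft rK.
exists n0 => n n0n.
have lip := @trunc_excess_lipschitz K%:R n
  (fun x fx => far x (le_trans (_ : n0%:R <= n%:R) fx)).
have {}lip := lip ltac:(by rewrite ler_nat).
near=> h.
have h0 : h != 0 by near: h; exact: nbhs_dnbhs_neq.
have th01 : 0 <= t + h <= 1.
  have : `|h| < Num.min t (1 - t).
    by near: h; apply: dnbhs0_lt; rewrite lt_min subr_gt0.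
  by rewrite lt_min !ltr_norml => /andP[/andP[? ?] /andP[? ?]]; apply/andP; split; lra.
have hW : W2 (mu (t + h)) (mu t) ^+ 2 <= S * `|h| ^+ 2.
  have : `|v - difference_quotient (@W2 R X) mu t h| <= 1.
    by near: h; move/cvgrPdist_le: speed; apply.
  rewrite /difference_quotient ler_norml => /andP[+ _].
  rewrite lerNl opprB lerBlDr ler_pdivrMr ?normr_gt0// [1 + v]addrC => hv.
  apply: (@le_trans _ _ (((v + 1) * `|h|) ^+ 2)).
    by rewrite ler_sqr ?nnegrE ?W2_ge0// (le_trans (W2_ge0 _ _) hv).
  by rewrite exprMn ler_wpM2r ?sqr_ge0// lerDl.
have hS : 3 * `|h| * S <= e / 3.
  have : `|h| < e / (9 * S) by near: h; exact: dnbhs0_lt.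
  rewrite ltr_pdivlMr ?mulr_gt0// => /ltW; lra.
have fi s : 0 <= s <= 1 -> (mu s).-integrable setT (EFin \o (f : borel X -> R)).
  by move=> s01; exact: (touched_integrable rho0 ft (mu_P2 s01)).
have BE s : 0 <= s <= 1 -> \int[mu s]_x f x - \int[mu s]_x (trunc_fun f n x - n%:R) =
    \int[mu s]_x (f x - (trunc_fun f n x - n%:R)).
  by move=> s01; rewrite RintegralB//; [exact: fi|exact: (trunc_fun_second_moment_integrable rho0 ft n (mu_P2 s01))].
have -> : \int[mu (t + h)]_x f x - \int[mu t]_x f x -
    (\int[mu (t + h)]_x (trunc_fun f n x - n%:R) - \int[mu t]_x (trunc_fun f n x - n%:R)) =
  \int[mu (t + h)]_x (f x - (trunc_fun f n x - n%:R)) -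
  \int[mu t]_x (f x - (trunc_fun f n x - n%:R)).
  by rewrite -!BE//; ring.
have hi s : 0 <= s <= 1 -> (mu s).-integrable setT
    (EFin \o (fun x : borel X => f x - (trunc_fun f n x - n%:R))).
  by move=> s01; exact: (integrableB measurableT (fi _ s01) (trunc_fun_second_moment_integrable rho0 ft n (mu_P2 s01))).
have l0 : 0 < eta / `|h| by rewrite divr_gt0 ?normr_gt0.
apply: le_trans (W2_integral_diff X_separable (mu_P2 th01) (mu_P2 t01') l0
  (hi _ th01) (hi _ t01') iw _ _) _.
- move=> x y; rewrite [X in `|X| <= _](_ : _ =
    (f x - trunc_fun f n x) - (f y - trunc_fun f n y)); last by ring.
  exact: lip.
- exact: far_distance_lipschitz.
have nh0 : 0 < `|h| by rewrite normr_gt0.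
have a1 : (3 + 3 * (eta / `|h|)) * W2 (mu (t + h)) (mu t) ^+ 2 <=
    (3 + 3 * (eta / `|h|)) * (S * `|h| ^+ 2).
  by rewrite ler_wpM2l// addr_ge0// mulr_ge0// ltW.
have a2 : (3 + 3 * (eta / `|h|)) * (S * `|h| ^+ 2) =
    (3 * `|h| * S + e / 3) * `|h|.
  by rewrite /eta; field; rewrite !gt_eqF.
have a3 : 3 / (eta / `|h|) *
    \int[mu t]_x Num.max (mdist x x0 - K%:R) 0 ^+ 2 <= 3 / (eta / `|h|) * (e * eta / 9).
  by apply: ler_wpM2l; [rewrite divr_ge0// ltW|exact: ltW].
have a4 : 3 / (eta / `|h|) * (e * eta / 9) = e / 3 * `|h|.
  by field; rewrite !gt_eqF.
have a5 : (3 * `|h| * S + e / 3) * `|h| <= (e / 3 + e / 3) * `|h|.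
  by rewrite ler_wpM2r// lerD2r.
by move: a1 a3; rewrite a2 a4 => a1 a3; lra.
Unshelve. all: by end_near. Qed.

End PotentialDerivative.

(** * Duality *)

Section Duality.
Context (R : realType) (X : completeMetricType R).
Hypothesis X_separable : separable_space X.
Implicit Types (mu nu : probability (borel X) R).
Local Notation XX := (borel X * borel X)%type.

(** The potential is admissible in the dual problem for every other first
    marginal, where it yields a lower bound that is attained at [mu]. *)
Lemma potential_dual_bound mu nu (x0 : X) (rho : R) (f : X -> R) :
  finite_second_moment mu -> finite_second_moment nu ->
  0 < rho -> touched_by_parabolas x0 rho f ->
  (\int[mu]_x (f x)%:E + \int[nu]_y c_transform (EFin \o f) y =
   (2^-1)%:E * W2sq mu nu)%E ->
  exists2 c : R, 2^-1 * W2 mu nu ^+ 2 = \int[mu]_x f x + c &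
    forall mu', finite_second_moment mu' ->
      \int[mu']_x f x + c <= 2^-1 * W2 mu' nu ^+ 2.
Proof.
move=> fmu fnu rho0 ft.
pose fc := c_transform (EFin \o f).
have mfc : measurable_fun setT (fc : borel X -> \bar R) := touched_c_transform_measurable f.
have fi (mu' : probability (borel X) R) : finite_second_moment mu' ->
    mu'.-integrable setT (EFin \o (f : borel X -> R)).
  by move=> fmu'; exact: (touched_integrable rho0 ft fmu').
rewrite (W2sqE X_separable fmu fnu) -EFinM => duality.
have [_ fc_fin] : (\int[mu]_x (f x)%:E)%E \is a fin_num /\
    (\int[nu]_y fc y)%E \is a fin_num.
  by apply/andP; rewrite -fin_numD duality.
have ifc : nu.-integrable setT (fc : borel X -> \bar R).
  apply/integrableP; split => //; apply/abse_integralP => //.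
  by rewrite -(fineK fc_fin) ltry.
exists (fine (\int[nu]_y fc y)).
  apply: EFin_inj; rewrite -duality EFinD /Rintegral !fineK//.
  exact: integrable_fin_num (fi _ fmu).
move=> mu' fmu'; apply/ler_addgt0Pr => e e0.
have e2 : 0 < 2 * e by rewrite mulr_gt0.
have [g gP gle] := near_optimal_coupling X_separable fmu' fnu e2.
have m1 := @measurable_fst _ _ (borel X) (borel X).
have m2 := @measurable_snd _ _ (borel X) (borel X).
have i1 := marginal_integrable m1 (coupling_fst gP) (fi _ fmu').
have i2 := marginal_integrable m2 (coupling_snd gP) ifc.
have ic : g.-integrable setT (fun z : XX => (mdist (z.1 : X) (z.2 : X) ^+ 2)%:E).
  apply/integrableP; split; first exact: measurable_sqdist.
  under eq_integral do rewrite gee0_abs ?lee_fin ?sqr_ge0//.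
  by apply: le_lt_trans gle _; rewrite ltry.
have e1 := marginal_integral m1 (coupling_fst gP) (measurable_int mu' (fi _ fmu')).
have e3 := marginal_integral m2 (coupling_snd gP) mfc.
have E : (\int[mu']_x (f x)%:E + \int[nu]_y fc y <= (2^-1)%:E * cost g)%E.
  rewrite -e1 -e3 /cost -integralZl//.
  rewrite -(integralD measurableT i1 i2).
  apply: le_integral => //.
  - exact: (integrableD measurableT i1 i2).
  - exact: integrableZl.
  - move=> [x y] _ /=; apply: le_trans (leeD2l _ (c_transform_le _ x y)) _.
    by rewrite /half_sqdist/= -EFinB -EFinD -EFinM lee_fin addrC subrK mulrC.
rewrite -lee_fin EFinD /Rintegral !fineK//; last first.
  exact: integrable_fin_num (fi _ fmu').
apply: le_trans E _; apply: le_trans (lee_wpmul2l _ gle) _; first by rewrite lee_fin.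
by rewrite -EFinM lee_fin; lra.
Qed.

(** The limit does not depend on the sequence that represents the element of the
    cotangent space, since [L] is continuous for the seminorm. *)
Lemma cotan_ext_cvg (m : {measure set (borel X) -> \bar R}) mu (C k : R)
    (L : (X -> R) -> R) (u : nat -> X -> R) (l : R) :
  (forall A : set (borel X), measurable A -> (mu A <= C%:E * m A)%E) ->
  S2_linear m L -> dual_norm m mu L = k%:E ->
  cauchy_S2 m mu u -> L (u n) @[n --> \oo] --> l ->
  cotan_ext L (cotan_class m mu u) = l.
Proof.
move=> muC linL normL cu ul; have [Su _] := cu.
apply: get_unique.
  exists u => //; split => //; apply: cvg_near_cst; near=> n.
  rewrite (_ : u n \- u n = cst 0); last by apply/funext => x /=; rewrite subrr.
  exact: (sqnorm_cst muC).
move=> y [v [cv uv0] vy]; have [Sv _] := cv.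
have h : L (u n \- v n) @[n --> \oo] --> (0 : R).
  apply: (dual_norm_cvg0 muC linL normL (u := fun n => u n \- v n)) => [n|e e0].
    exact: S2B.
  have /fine_cvgP[[n1 _ finn] /cvgrPdist_lt/(_ e e0)[n2 _ hn]] := uv0.
  exists (maxn n1 n2) => n; rewrite geq_max => /andP[n1n n2n].
  rewrite -(fineK (finn _ n1n)) lee_fin; have := hn _ n2n.
  by rewrite /= sub0r normrN => /ltW; apply: le_trans; rewrite ler_norm.
have h' : L (u n \- v n) @[n --> \oo] --> l - y.
  rewrite (_ : (fun n => L (u n \- v n)) = (fun n => L (u n) - L (v n))).
    exact: cvgB.
  by apply/funext => n; exact: (S2_linearB linL (Su n) (Sv n)).
have ly : l - y = 0 by exact: (cvg_unique (@Rhausdorff R) h' h).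
exact: esym (subr0_eq ly).
Unshelve. all: by end_near. Qed.

End Duality.

Theorem proposition3p10 (R : realType) (X : completeMetricType R)
  (m : {measure set (borel X) -> \bar R})
  (X_separable : separable_space X)
  (m_radon : radon m)
  (m_neq0 : m setT <> 0%E)
  (m_S2_separable : S2_separable m)
  (m_bounded : forall B : set (borel X),
     measurable B -> metric_bounded (B : set X) -> (m B < +oo)%E)
  (mu : R -> probability (borel X) R)
  (mu_P2 : forall t : R, 0 <= t <= 1 -> finite_second_moment (mu t))
  (mu_2ac : abs_cont (@W2 R X) 2 mu)
  (mu_compression : bounded_compression m (fun t => mu t))
  (N : set R) (L : R -> (X -> R) -> R)
  (L_operators : associated_operators m mu N L)
  (nu : probability (borel X) R)
  (nu_P2 : finite_second_moment nu)
  (nu_support : metric_bounded (msupport nu)) :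
  abs_cont (@rdist R) 1 (fun t : R => 2^-1 * W2 (mu t) nu ^+ 2) /\
  {ae @lebesgue_measure R, forall t : R, 0 <= t <= 1 ->
    forall phi : X -> \bar R,
      kantorovich_potential (mu t) nu phi ->
      (exists2 B : set X, metric_bounded B &
         forall x, c_superdifferential phi x `&` B !=set0) ->
      cauchy_S2 m (mu t) (truncation phi) /\
      is_derive t (1 : R) (fun s : R => 2^-1 * W2 (mu s) nu ^+ 2 : R)
        (cotan_ext (L t) (cotan_of m (mu t) phi))}.
Proof.
have F_ac := W2_abs_cont X_separable mu_P2 nu_P2 mu_2ac; split => //.
have [g [ig g0 Fg]] := abs_cont_dominated F_ac.
have [v [_ _ F_derivable]] := dominated_increments_ftc ig g0 Fg.
have [N_negligible L_speed L_derive] := L_operators.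
have [C _ muC] := mu_compression.
have N_ae : {ae @lebesgue_measure R, forall t, ~ N t}.
  by apply: negligibleS N_negligible => t /= /contrapT.
have ends_ae : {ae @lebesgue_measure R, forall t : R, t != 0 /\ t != 1}.
  by apply: filterI; [exact: (ae_filter_ringOfSetsType (@lebesgue_measure R))
    |exact: ae_lebesgue_neq|exact: ae_lebesgue_neq].
apply: (filterS3 _ _ F_derivable N_ae ends_ae).
  exact: (ae_filter_ringOfSetsType (@lebesgue_measure R)).
move=> t Ft Nt [t0 t1] t01 phi [_ duality] [B B_bounded phiB].
have tio : 0 < t < 1.
  by move: t01; rewrite !le_eqVlt eq_sym (negPf t0) (negPf t1).
have [f [x0 [rho [phiE rho0 ft]]]] := bounded_superdifferential B_bounded phiB.
have [linL _ speed normL] := L_speed t tio Nt.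
have truncE : truncation phi = trunc_fun f by rewrite phiE.
have cauchy := trunc_fun_cauchy m_bounded rho0 ft (muC t t01) (mu_P2 t t01).
rewrite /cotan_of truncE; split; first exact: cauchy.
have [l Ll derivative] := potential_integral_derive X_separable m_bounded rho0 ft
  tio mu_P2 (muC t t01) speed linL (esym normL)
  (fun h Sh ih => (L_derive h Sh ih).2 t tio Nt).
rewrite (cotan_ext_cvg (muC t t01) linL (esym normL) cauchy Ll).
rewrite phiE in duality.
have [c Ft_eq F_ge] := potential_dual_bound X_separable (mu_P2 t t01) nu_P2 rho0 ft duality.
have e0 : 0 < Num.min t (1 - t) by rewrite lt_min subr_gt0.
(* F is differentiable at t, and touched there from below by the integral of the
   potential plus the constant c. *)
rewrite (is_derive_touching e0 (Ft tio) derivative); first exact: Ft.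
move=> h; rewrite lt_min !ltr_norml => /andP[/andP[? ?] /andP[? ?]].
rewrite Ft_eq addrAC subrr add0r lerBrDr addrC; apply: F_ge; apply: mu_P2.
by apply/andP; split; lra.
Qed.
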